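(* Let $\sigma=:\bar\sigma_0$ be a normal defining density for a hypersurface $\Sigma$ in a conformal manifold $(M,\boldsymbol c)$ of dimension $d\ge3$. Define recursively, for $1\le k\le d-1$, $$\bar\sigma_k:=\sigma\prod_{i=0}^{k-1}\left[1-\frac d2\,\frac{I^2_{\bar\sigma_i}-1}{(d-i-1)(i+2)}\right].$$ Then the problem of finding a smooth defining density $\bar\sigma$ for $\Sigma$ with $I^2_{\bar\sigma}=1+\bar\sigma^\ell A_\ell$, for some smooth $A_\ell\in\Gamma(\mathcal E[-\ell])$, is solved to order $\ell=d$ by recursive use of this formula. The ASC obstruction density is the obstruction to solving this problem smoothly (to higher order), and is given by $$\mathcal B=\left.\left[\frac{I^2_{\bar\sigma_{d-1}}-1}{\sigma^d}\right]\right|_\Sigma.$$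
   Context: $(M,\boldsymbol c)$ is a smooth oriented $d$-manifold with a conformal class of Riemannian metrics. $\mathcal E[w]$ is the bundle of conformal densities of weight $w$ (oriented $\frac w{2d}$-th root of $(\Lambda^dTM)^2$; a section is represented by functions $f_g$, $g\in\boldsymbol c$, with $f_{\Omega^2g}=\Omega^wf_g$); $\boldsymbol g$ is the conformal metric. For $g\in\boldsymbol c$, $\nabla$ is the Levi-Civita connection, $\Delta=\boldsymbol g^{ab}\nabla_a\nabla_b$, $\mathrm J=\mathrm{Sc}/(2(d-1))$. For $\sigma\in\Gamma(\mathcal E[1])$, $$I_\sigma^2:=\boldsymbol g^{ab}(\nabla_a\sigma)(\nabla_b\sigma)-\tfrac2d\,\sigma(\Delta\sigma+\mathrm J\sigma),$$ independent of $g\in\boldsymbol c$; equivalently $I_\sigma^2=(\widehat D^A\sigma)(\widehat D_A\sigma)$, where $\widehat D^A\sigma$ is the tractor given in the scale $g$ by $(\sigma,\nabla_a\sigma,-\frac1d(\Delta+\mathrm J)\sigma)$ and the tractor metric is $h(U,U)=2U^+U^-+\boldsymbol g^{ab}U_aU_b$ for $U=(U^+,U_a,U^-)$. A defining density for a smoothly embedded codimension-1 submanifold $\Sigma$ is a $\sigma\in\Gamma(\mathcal E[1])$ with zero locus $\Sigma$ and $\nabla\sigma\ne0$ along $\Sigma$; it is normal if $\boldsymbol g^{ab}(\nabla_a\sigma)(\nabla_b\sigma)=1+\sigma A$ with $A$ smooth. Considerations are local near $\Sigma$ and defining densities are compatibly oriented (positive ratios). ASC obstruction density: $\mathcal B:=B_{\bar\sigma}|_\Sigma\in\Gamma(\mathcal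 E\Sigma[-d])$, where $\bar\sigma$ is any defining density with $I^2_{\bar\sigma}=1+\bar\sigma^dB_{\bar\sigma}$, $B_{\bar\sigma}$ smooth; it is independent of the choice of such $\bar\sigma$. *)

(* Defs.v *)
From HB Require Import structures.
From mathcomp Require Import all_boot all_order all_algebra.
From mathcomp Require Import boolp classical_sets reals.
From mathcomp Require Import topology normedtype derive.

Set Implicit Arguments.
Unset Strict Implicit.
Unset Printing Implicit Defensive.

Import Order.TTheory GRing.Theory Num.Theory.
Import numFieldNormedType.Exports.

Local Open Scope classical_set_scope.
Local Open Scope ring_scope.

Definition partial (R : realType) (d : nat) (a : 'I_d) (f : 'rV[R]_d -> R) :
  'rV[R]_d -> R := fun x => 'D_(delta_mx 0 a) f x.

(* C^oo at x, for a function defined near x: every iterated partial derivative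
   is differentiable at x.  It is only used at all points x of an open set. *)
Definition smooth_at (R : realType) (d : nat) (f : 'rV[R]_d -> R)
    (x : 'rV[R]_d) : Prop :=
  forall s : seq 'I_d, differentiable (foldr (@partial R d) f s) x.

(* Smooth oriented d-manifolds.  [chart i] and [cinv i] are total functions,
   meaningful only on [cdom i] and on [chart i @` cdom i].  [chart_at p] selects
   a chart around p. [jacobian] follows the row-vector convention:
   (jacobian f x) a b is the a-th partial derivative of the b-th component. *)
Record manifold (R : realType) (d : nat) := Manifold {
  mpoint :> topologicalType;
  m_hausdorff : hausdorff_space mpoint;
  m_second_countable : @second_countable mpoint;
  cidx : Type;
  cdom : cidx -> set mpoint;
  chart : cidx -> mpoint -> 'rV[R]_d;
  cinv : cidx -> 'rV[R]_d -> mpoint;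
  chart_at : mpoint -> cidx;
  mem_chart_at : forall p, cdom (chart_at p) p;
  cdom_open : forall i, open (cdom i);
  ccod_open : forall i, open (chart i @` cdom i);
  chartK : forall i p, cdom i p -> cinv i (chart i p) = p;
  chart_continuous : forall i p, cdom i p -> {for p, continuous (chart i)};
  cinv_continuous : forall i p, cdom i p ->
    {for chart i p, continuous (cinv i)};
  transition_smooth : forall i j p, cdom i p -> cdom j p -> forall b : 'I_d,
    smooth_at (fun x => chart j (cinv i x) 0 b) (chart i p);
  transition_oriented : forall i j p, cdom i p -> cdom j p ->
    0 < \det (jacobian (chart j \o cinv i) (chart i p))
}.

Definition smooth_on (R : realType) (d : nat) (M : manifold R d)
    (U : set M) (f : M -> R) : Prop :=
  forall (i : cidx M) (p : M), U p -> cdom i p ->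
    smooth_at (f \o cinv i) (chart i p).

(* d/dx^a in the coordinates x of the i-th chart, as an operator on functions
   on M; the value is meaningful on [cdom i]. *)
Definition pd (R : realType) (d : nat) (M : manifold R d) (i : cidx M)
    (a : 'I_d) (f : M -> R) : M -> R :=
  fun p => partial a (f \o cinv i) (chart i p).

Definition differential (R : realType) (d : nat) (M : manifold R d)
    (f : M -> R) (p : M) : 'rV[R]_d := \row_a pd (chart_at p) a f p.

(* [gmx g i p] is the matrix g_ab at p in the i-th chart. *)
Record metric (R : realType) (d : nat) (M : manifold R d) := Metric {
  gmx : cidx M -> M -> 'M[R]_d;
  gmx_sym : forall i p, cdom i p -> (gmx i p)^T = gmx i p;
  gmx_pos : forall i p, cdom i p -> forall v : 'rV[R]_d, v != 0 ->
    0 < (v *m gmx i p *m v^T) 0 0;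
  gmx_smooth : forall i a b, smooth_on (cdom i) (fun p => gmx i p a b);
  gmx_change : forall i j p, cdom i p -> cdom j p ->
    let J := jacobian (chart j \o cinv i) (chart i p) in
    gmx i p = J *m gmx j p *m J^T
}.

Section LeviCivita.
Variables (R : realType) (d : nat) (M : manifold R d) (g : metric M).
Variable i : cidx M.

Definition ginv (a b : 'I_d) (p : M) : R := invmx (gmx g i p) a b.

(* [christoffel a b c] is Gamma^a_{bc}. *)
Definition christoffel (a b c : 'I_d) (p : M) : R :=
  2^-1 * \sum_e ginv a e p *
    (pd i b (fun q => gmx g i q e c) p + pd i c (fun q => gmx g i q e b) p
     - pd i e (fun q => gmx g i q b c) p).

(* The sign makes the round sphere have positive scalar curvature. *)
Definition ricci (b c : 'I_d) (p : M) : R :=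
  \sum_a (pd i a (christoffel a b c) p - pd i b (christoffel a a c) p
    + \sum_e (christoffel a a e p * christoffel e b c p
              - christoffel a b e p * christoffel e a c p)).

Definition chart_scal (p : M) : R := \sum_b \sum_c ginv b c p * ricci b c p.

Definition chart_gradsq (f : M -> R) (p : M) : R :=
  \sum_a \sum_b ginv a b p * (pd i a f p * pd i b f p).

Definition chart_laplacian (f : M -> R) (p : M) : R :=
  \sum_a \sum_b ginv a b p *
    (pd i a (pd i b f) p - \sum_e christoffel e a b p * pd i e f p).

End LeviCivita.

(* These do not depend on the chart used at p. *)
Definition scal (R : realType) (d : nat) (M : manifold R d) (g : metric M)
  (p : M) : R := chart_scal g (chart_at p) p.

Definition gradsq (R : realType) (d : nat) (M : manifold R d) (g : metric M)
  (f : M -> R) (p : M) : R := chart_gradsq g (chart_at p) f p.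

Definition laplacian (R : realType) (d : nat) (M : manifold R d)
  (g : metric M) (f : M -> R) (p : M) : R := chart_laplacian g (chart_at p) f p.

Definition Jscal (R : realType) (d : nat) (M : manifold R d) (g : metric M)
  (p : M) : R := scal g p / (2 * (d%:R - 1)).

Definition conformal_to (R : realType) (d : nat) (M : manifold R d)
    (g g' : metric M) (Om : M -> R) : Prop :=
  [/\ smooth_on setT Om, forall p, 0 < Om p &
      forall i p, cdom i p -> gmx g' i p = Om p ^+ 2 *: gmx g i p].

Record conformal_class (R : realType) (d : nat) (M : manifold R d) :=
  ConformalClass {
    cmem :> metric M -> Prop;
    cmem_nonempty : exists g, cmem g;
    cmemP : forall g, cmem g -> forall g',
      cmem g' <-> exists Om, conformal_to g g' Om
  }.

(* A density is represented by the family of functions f_g. *)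
Definition scaled (R : realType) (d : nat) (M : manifold R d) :=
  metric M -> M -> R.

Section Densities.
Variables (R : realType) (d : nat) (M : manifold R d) (c : conformal_class M).

(* f is a smooth section of E[w] over the open set U *)
Definition density (U : set M) (w : int) (f : scaled M) : Prop :=
  (forall g, c g -> smooth_on U (f g)) /\
  (forall g g' Om, c g -> c g' -> conformal_to g g' Om ->
     forall p, U p -> f g' p = Om p ^ w * f g p).

(* I_s^2 computed in the scale g.  In the scale g the conformal metric is g, and
   nabla acts on densities as on the representing functions. *)
Definition Isq (s : scaled M) : scaled M := fun g p =>
  gradsq g (s g) p
  - 2 / d%:R * (s g p * (laplacian g (s g) p + Jscal g p * s g p)).

Definition hypersurface (S : set M) : Prop :=
  forall p, S p -> exists W f, [/\ open W, W p, smooth_on W f,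
    (forall q, W q -> (S q <-> f q = 0)) &
    (forall q, W q -> S q -> differential f q != 0)].

Definition defining_density (S U : set M) (s : scaled M) : Prop :=
  [/\ density U 1 s,
      (forall g p, c g -> U p -> (s g p = 0 <-> S p)) &
      (forall g p, c g -> U p -> S p -> differential (s g) p != 0)].

(* A depends on the scale: for a rescaled metric the gradient of s changes by
   a multiple of s. *)
Definition normal_density (s : scaled M) : Prop :=
  forall g, c g -> exists2 A : M -> R, smooth_on setT A &
    forall p, gradsq g (s g) p = 1 + s g p * A p.

Definition co_oriented (S U : set M) (s t : scaled M) : Prop :=
  forall g p, c g -> U p -> ~ S p -> 0 < t g p / s g p.

Definition open_nbhd (S U : set M) : Prop := open U /\ S `<=` U.

(* I_t^2 = 1 + t^l A over U, for a section A of E[-l] *)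
Definition asc_eq (U : set M) (l : nat) (t A : scaled M) : Prop :=
  density U (- l%:Z) A /\
  forall g p, c g -> U p -> Isq t g p = 1 + t g p ^+ l * A g p.

(* t is, on a neighbourhood U of S, a defining density for S with the same
   orientation as s, and solves I_t^2 = 1 + t^l A. *)
Definition solves_on (S U : set M) (s t : scaled M) (l : nat) : Prop :=
  [/\ open_nbhd S U, defining_density S U t, co_oriented S U s t &
      exists A, asc_eq U l t A].

Definition solvable (S : set M) (s : scaled M) (l : nat) : Prop :=
  exists U t, solves_on S U s t l.

(* B is the restriction to S of B_t, for some solution t of I_t^2 = 1 + t^d B_t.
   Only the values of B on S matter. *)
Definition asc_obstruction (S : set M) (s B : scaled M) : Prop :=
  exists U t Bt, [/\ open_nbhd S U, defining_density S U t,
    co_oriented S U s t, asc_eq U d t Bt &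
    forall g p, c g -> S p -> B g p = Bt g p].

(* [n / t^l]|_S = B, where the quotient off S of a density n of weight 0 by t^l
   extends to a smooth density Q near S. *)
Definition quotient_on (S : set M) (n t : scaled M) (l : nat) (B : scaled M) :
    Prop :=
  exists U Q, [/\ open_nbhd S U, density U (- l%:Z) Q,
    (forall g p, c g -> U p -> ~ S p -> Q g p = n g p / t g p ^+ l) &
    (forall g p, c g -> S p -> B g p = Q g p)].

Definition asc_recursion (s : scaled M) (sb : nat -> scaled M) : Prop :=
  forall k : nat, (k < d)%N -> forall g p, c g ->
    sb k g p = s g p * \prod_(i < k)
      (1 - d%:R / 2 * ((Isq (sb i) g p - 1) / ((d - i - 1)%N%:R * (i + 2)%N%:R))).

End Densities.

(* Main.v *)
(* Write I^2 for the squared length of the scale tractor.  If I_t^2 = 1 + O(t),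
   the Leibniz rules give, for k >= 1,
     I^2_{t + t^(k+1) a} = I_t^2 + t^k (alpha_k a + O(t)),
     alpha_k = 2 (k+1) (d-k) / d,
   so the term of order k of I_t^2 - 1 can be removed exactly when k <> d, which
   is what the recursion does.  Conversely, two solutions f and h to order d with
   the same orientation satisfy f = h + O(h^2), and the expansion improves this to
   f = h + O(h^(d+1)); at k = d, where alpha_d = 0, it then yields equality of
   the obstructions along the hypersurface.  If the obstruction vanishes there, it
   is divisible by t, and the orders above d are solved one by one.
   The independence of I^2 of the chart and of the metric is an identity in a
   commutative ring with commuting derivations, because the Levi-Civita connection
   is characterized algebraically.  Weights of quotients follow from the fact that
   t is not a zero divisor. *)
Require Import Defs.
From HB Require Import structures.
From mathcomp Require Import all_boot all_order all_algebra.
From mathcomp Require Import boolp classical_sets functions reals.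
From mathcomp Require Import topology normedtype landau derive.
From mathcomp Require Import ring lra.

Set Implicit Arguments.
Unset Strict Implicit.
Unset Printing Implicit Defensive.

Import Order.TTheory GRing.Theory Num.Theory.
Import numFieldNormedType.Exports.

Local Open Scope classical_set_scope.
Local Open Scope ring_scope.

(** * Smooth functions on open sets of coordinate space *)

Section SmoothFunctions.
Variables (R : realType) (d : nat).
Implicit Types (V : set 'rV[R]_d) (f g : 'rV[R]_d -> R) (x : 'rV[R]_d).

(** The analytic core is division: a smooth function vanishing on the zero set of [h] is [h] times a
    smooth function, if [h] has nonzero differential there. The usual proof straightens the zero set
    and integrates along a parameter. Here segments parallel to a coordinate axis reach the zero
    set, which bounds flat functions by powers of [h]; a Taylor expansion in powers of [h] then
    leaves a remainder so flat that dividing it by [h] keeps any prescribed number of derivatives.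
    The geometric identities become ring identities by collecting the functions smooth on a chart
    image in one ring. Its elements are functions on the whole coordinate space, so values off the
    image must be chosen such that the identities hold there too. The factor in the recursion is
    [1 - (I^2 - 1) / alpha_k]: when [I^2 - 1 = t^k A], it changes [t] into [t + t^(k+1) a] with
    [a = - A / alpha_k]. In this form it visibly has weight 0. It equals 1 on [S] but may vanish
    elsewhere, hence the shrinking neighbourhoods. *)

Definition smooth V f := forall x, V x -> smooth_at f x.

Lemma near_open V x (P : 'rV[R]_d -> Prop) : open V -> V x ->
  (forall y, V y -> P y) -> \forall y \near x, P y.
Proof.
move=> Vo Vx VP; have : nbhs x V by apply: open_nbhs_nbhs.
by apply: filterS.
Qed.

Lemma near_differentiable f g x : (\forall y \near x, f y = g y) ->
  differentiable f x -> differentiable g x.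
Proof.
move=> fg df; have fgx : f x = g x by apply: nbhs_singleton fg.
suff E : g \o shift x = cst (g x) + 'd f x +o_ (0 : 'rV[R]_d) id.
  have dE : 'd g x = 'd f x :> ('rV[R]_d -> R).
    by apply: diff_unique => //; apply: diff_continuous.
  apply/diff_locallyP; rewrite dE; split => //; exact: diff_continuous.
have := diff_locally df; move=> /eqaddoP ef; apply/eqaddoP => e e0.
have fg0 : \forall h \near (0 : 'rV[R]_d), f (h + x) = g (h + x).
  have := fg; rewrite (near_shift 0 x)/=.
  by apply: filterS => h; rewrite /= subr0.
apply: filterS2 (ef e e0) fg0 => h /= eh Eh; move: eh.
by rewrite /shift/= !fctE /= Eh fgx.
Qed.

Lemma near_partial f g x a : (\forall y \near x, f y = g y) ->
  partial a f x = partial a g x.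
Proof. exact: near_eq_derive. Qed.

Lemma eq_partial V f g a : open V -> (forall x, V x -> f x = g x) ->
  forall x, V x -> partial a f x = partial a g x.
Proof. by move=> Vo fg x Vx; apply: near_partial; apply: near_open Vx fg. Qed.

Lemma smooth_partial V f a : smooth V f -> smooth V (partial a f).
Proof. by move=> sf x Vx s; rewrite -foldr_rcons; apply: sf. Qed.

Lemma smooth_foldr_partial V f s :
  smooth V f -> smooth V (foldr (@partial R d) f s).
Proof. by move=> sf; elim: s => [|a s IH] //=; exact: smooth_partial. Qed.

Lemma smooth_diff V f x : smooth V f -> V x -> differentiable f x.
Proof. by move=> sf Vx; apply: (sf x Vx [::]). Qed.

Lemma smooth_derivable V f x v : smooth V f -> V x -> derivable f x v.
Proof. by move=> sf Vx; apply/diff_derivable/(smooth_diff sf). Qed.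

(* Coinduction up to equality on V. *)
Lemma smooth_coind V (P : ('rV[R]_d -> R) -> Prop) : open V ->
  (forall f x, P f -> V x -> differentiable f x) ->
  (forall f a, P f -> exists2 g, P g & forall x, V x -> partial a f x = g x) ->
  forall f, P f -> smooth V f.
Proof.
move=> Vo Pd PD f Pf.
have H s : exists2 g, P g & forall x, V x -> foldr (@partial R d) f s x = g x.
  elim: s => [|a s [g Pg fg]] /=; first by exists f.
  have [h Ph gh] := PD g a Pg; exists h => // x Vx.
  by rewrite (eq_partial a Vo fg Vx) gh.
move=> x Vx s; have [g Pg fg] := H s.
apply: (@near_differentiable g); last exact: Pd Pg Vx.
by apply: near_open Vx _ => // y Vy; rewrite fg.
Qed.

Lemma eq_smooth V f g : open V -> (forall x, V x -> f x = g x) ->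
  smooth V f -> smooth V g.
Proof.
move=> Vo fg sf; pose P g := exists2 f, smooth V f & forall x, V x -> f x = g x.
apply: (@smooth_coind V P) => //; last by exists f.
- move=> h x [k sk kh] Vx; apply: near_differentiable (smooth_diff sk Vx).
  exact: near_open Vx kh.
- move=> h a [k sk kh]; exists (partial a k); last first.
    by move=> x Vx; rewrite (eq_partial a Vo kh Vx).
  by exists (partial a k) => //; apply: smooth_partial.
Qed.

(** The Leibniz and quotient rules mix sums, products and inverses, so no single operation gives a
    class stable under partial derivatives. Closing under all of them at once does, and one
    coinduction then yields every closure property below. *)
Inductive closure_alg V : ('rV[R]_d -> R) -> Prop :=
| Calg_base f : smooth V f -> closure_alg V f
| Calg_cst c : closure_alg V (fun=> c)
| Calg_add f g : closure_alg V f -> closure_alg V g ->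
    closure_alg V (fun x => f x + g x)
| Calg_mul f g : closure_alg V f -> closure_alg V g ->
    closure_alg V (fun x => f x * g x)
| Calg_inv f : closure_alg V f -> (forall x, V x -> f x != 0) ->
    closure_alg V (fun x => (f x)^-1).

Lemma closure_alg_diff V f x : closure_alg V f -> V x -> differentiable f x.
Proof.
move=> + Vx; elim=> {f} [f sf|c|f g _ IHf _ IHg|f g _ IHf _ IHg|f _ IH f0].
- exact: smooth_diff sf Vx.
- exact: differentiable_cst.
- exact: differentiableD.
- exact: differentiableM.
- exact/differentiableV/f0.
Qed.

Lemma partialD f g a x : differentiable f x -> differentiable g x ->
  partial a (fun x => f x + g x) x = partial a f x + partial a g x.
Proof. by move=> df dg; apply: deriveD; apply: diff_derivable. Qed.

Lemma partialM f g a x : differentiable f x -> differentiable g x ->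
  partial a (fun x => f x * g x) x = f x * partial a g x + g x * partial a f x.
Proof. by move=> df dg; apply: deriveM; apply: diff_derivable. Qed.

Lemma partialV f a x : f x != 0 -> differentiable f x ->
  partial a (fun x => (f x)^-1) x = - (f x) ^- 2 * partial a f x.
Proof. by move=> f0 df; apply: deriveV => //; apply: diff_derivable. Qed.

Lemma partial_cst c a x : partial a (fun=> c) x = 0 :> R.
Proof. exact: derive_cst. Qed.

Lemma smooth_closure_alg V f : open V -> closure_alg V f -> smooth V f.
Proof.
move=> Vo; apply: smooth_coind => // [g x|{}f a Cf].
  exact: closure_alg_diff.
elim: f / Cf => [f sf|c|f g Cf [f' Cf' ff'] Cg [g' Cg' gg']|
    f g Cf [f' Cf' ff'] Cg [g' Cg' gg']|f Cf [f' Cf' ff'] f0].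
- by exists (partial a f) => //; apply/Calg_base/smooth_partial.
- exists (fun=> 0); first exact: Calg_cst.
  by move=> x _; rewrite partial_cst.
- exists (fun x => f' x + g' x); first exact: Calg_add.
  by move=> x Vx; rewrite partialD ?ff' ?gg' //; apply: closure_alg_diff Vx.
- exists (fun x => f x * g' x + g x * f' x).
    by apply: Calg_add; apply: Calg_mul.
  by move=> x Vx; rewrite partialM ?ff' ?gg' //; apply: closure_alg_diff Vx.
- exists (fun x => (-1 * ((f x)^-1 * (f x)^-1)) * f' x).
    by do !apply: Calg_mul => //; [apply: Calg_cst|apply: Calg_inv..].
  move=> x Vx; rewrite partialV ?ff' ?f0 //; last exact: closure_alg_diff Vx.
  by rewrite mulN1r expr2 invfM.
Qed.

Section Closure.
Variable V : set 'rV[R]_d.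
Hypothesis Vo : open V.

Lemma smooth_cst c : smooth V (fun=> c).
Proof. exact/smooth_closure_alg/Calg_cst. Qed.

Lemma smoothD f g : smooth V f -> smooth V g -> smooth V (fun x => f x + g x).
Proof. by move=> *; apply/smooth_closure_alg/Calg_add; try exact: Calg_base. Qed.

Lemma smoothM f g : smooth V f -> smooth V g -> smooth V (fun x => f x * g x).
Proof. by move=> *; apply/smooth_closure_alg/Calg_mul; try exact: Calg_base. Qed.

Lemma smoothV f : smooth V f -> (forall x, V x -> f x != 0) ->
  smooth V (fun x => (f x)^-1).
Proof. by move=> *; apply/smooth_closure_alg/Calg_inv; try exact: Calg_base. Qed.

Lemma smoothN f : smooth V f -> smooth V (fun x => - f x).
Proof.
move=> sf; apply: (@eq_smooth _ (fun x => -1 * f x)) => //.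
  by move=> x _; rewrite mulN1r.
by apply: smoothM => //; apply: smooth_cst.
Qed.

Lemma smoothB f g : smooth V f -> smooth V g -> smooth V (fun x => f x - g x).
Proof. by move=> sf sg; apply: smoothD => //; apply: smoothN. Qed.

Lemma smooth_sum (I : Type) (r : seq I) (P : pred I) (F : I -> 'rV[R]_d -> R) :
  (forall i, smooth V (F i)) -> smooth V (fun x => \sum_(i <- r | P i) F i x).
Proof.
move=> sF; elim: r => [|i r IH].
  apply: (@eq_smooth _ (fun=> 0)) (smooth_cst 0) => //.
  by move=> x _; rewrite big_nil.
case Pi: (P i).
  apply: (@eq_smooth _ _ _ Vo) (smoothD (sF i) IH).
  by move=> x _; rewrite big_cons Pi.
by apply: (@eq_smooth _ _ _ Vo) IH => x _; rewrite big_cons Pi.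
Qed.

Lemma smooth_prod (I : Type) (r : seq I) (P : pred I) (F : I -> 'rV[R]_d -> R) :
  (forall i, smooth V (F i)) -> smooth V (fun x => \prod_(i <- r | P i) F i x).
Proof.
move=> sF; elim: r => [|i r IH].
  apply: (@eq_smooth _ (fun=> 1)) (smooth_cst 1) => //.
  by move=> x _; rewrite big_nil.
case Pi: (P i).
  apply: (@eq_smooth _ _ _ Vo) (smoothM (sF i) IH).
  by move=> x _; rewrite big_cons Pi.
by apply: (@eq_smooth _ _ _ Vo) IH => x _; rewrite big_cons Pi.
Qed.

Lemma smooth_det n (A : 'rV[R]_d -> 'M[R]_n) :
  (forall i j, smooth V (fun x => A x i j)) -> smooth V (fun x => \det (A x)).
Proof.
move=> sA; apply: smooth_sum => s; apply: smoothM; first exact: smooth_cst.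
by apply: smooth_prod.
Qed.

Lemma smooth_invmx n (A : 'rV[R]_d -> 'M[R]_n) :
  (forall i j, smooth V (fun x => A x i j)) ->
  (forall x, V x -> \det (A x) != 0) ->
  forall i j, smooth V (fun x => invmx (A x) i j).
Proof.
move=> sA A0 i j.
apply: (@eq_smooth _ (fun x => (\det (A x))^-1 *
    ((-1) ^+ (j + i) * \det (row' j (col' i (A x)))))) => // [x Vx|].
  by rewrite /invmx unitmxE unitfE A0 // !mxE.
apply: smoothM; first by apply: smoothV => //; apply: smooth_det.
apply: smoothM; first exact: smooth_cst.
apply: smooth_det => k l.
apply: (@eq_smooth _ (fun x => A x (lift j k) (lift i l))) => // x Vx.
by rewrite !mxE.
Qed.

End Closure.

End SmoothFunctions.

(** * Symmetry of mixed partial derivatives *)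

Section Schwarz.
Variables (R : realType) (d : nat).
Implicit Types (V : set 'rV[R]_d) (f g : 'rV[R]_d -> R) (x u v : 'rV[R]_d).

Lemma is_derive_line f x u (s : R) : differentiable f (x + s *: u) ->
  is_derive s 1 (fun t => f (x + t *: u)) ('D_u f (x + s *: u)).
Proof.
move=> /(@diff_derivable _ _ _ _ _ u) df.
have E : (fun h : R => h^-1 *: (((fun t => f (x + t *: u)) \o shift s) (h *: 1)
            - f (x + s *: u)))
       = (fun h => h^-1 *: ((f \o shift (x + s *: u)) (h *: u) - f (x + s *: u))).
  apply/funext => h /=; congr (_ *: (f _ - _)).
  by rewrite scalerDl [h%:A](mulr1 h) addrCA.
by split; rewrite /derivable /derive E.
Qed.

Lemma line_MVT f x u (h : R) : 0 < h ->
  (forall s, 0 <= s <= h -> differentiable f (x + s *: u)) ->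
  exists2 c, 0 < c < h & f (x + h *: u) - f x = h * 'D_u f (x + c *: u).
Proof.
move=> h0 df.
have [c /[!in_itv]/= ch E] : exists2 c, c \in `]0, h[ &
    f (x + h *: u) - f (x + 0 *: u) = 'D_u f (x + c *: u) * (h - 0).
  apply: (MVT h0 (f := fun t => f (x + t *: u))
     (df := fun t => 'D_u f (x + t *: u))).
    move=> s; rewrite in_itv /= => /andP[s0 sh].
    by apply/is_derive_line/df; rewrite !ltW.
  apply: derivable_within_continuous => s; rewrite in_itv/= => sh.
  by have [] := is_derive_line (df s sh).
by exists c => //; move: E; rewrite scale0r addr0 subr0 mulrC.
Qed.

(** The mean value theorem is used twice: along [u] for the increment [F] of [f] in direction [v],
    then along [v] for the derivative ['D_u f]. *)
Lemma second_difference f x u v (h : R) : 0 < h ->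
  (forall s t, 0 <= s <= h -> 0 <= t <= h ->
     differentiable f (x + s *: u + t *: v) /\
     differentiable ('D_u f) (x + s *: u + t *: v)) ->
  exists s t, [/\ 0 < s < h, 0 < t < h &
    f (x + h *: u + h *: v) - f (x + h *: u) - (f (x + h *: v) - f x)
    = h ^+ 2 * 'D_v ('D_u f) (x + s *: u + t *: v)].
Proof.
move=> h0 df; have hh : 0 <= h <= h by rewrite lexx ltW.
have h00 : (0 : R) <= 0 <= h by rewrite lexx ltW.
pose F y := f (y + h *: v) - f y.
have dsh s : 0 <= s <= h ->
    differentiable (fun y => f (y + h *: v)) (x + s *: u).
  move=> sh; apply: (@differentiable_comp R _ _ _ (fun y => y + h *: v) f).
    by apply: differentiableD; [apply: ex_diff|apply: differentiable_cst].
  by have [] := df s h sh hh.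
have df0 s : 0 <= s <= h -> differentiable f (x + s *: u).
  by move=> sh; have [] := df s 0 sh h00; rewrite scale0r addr0.
have [s sh E] := @line_MVT F x u h h0
  (fun s sh => differentiableB (dsh s sh) (df0 s sh)).
have sh' : 0 <= s <= h by case/andP: sh => ? ?; rewrite !ltW.
have D1 : 'D_u (fun y => f (y + h *: v)) (x + s *: u) =
    'D_u f (x + s *: u + h *: v).
  rewrite /derive; set F1 := (fun _ : R => _); set F2 := (fun _ : R => _).
  suff -> : F1 = F2 by [].
  by apply/funext => k; rewrite /F1 /F2 /= !addrA.
have DF : 'D_u F (x + s *: u) =
    'D_u f (x + s *: u + h *: v) - 'D_u f (x + s *: u).
  rewrite -D1; apply: deriveB; first by apply/diff_derivable; exact: dsh.
  by apply/diff_derivable; exact: df0.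
have [t th E2] := @line_MVT ('D_u f) (x + s *: u) v h h0
  (fun t th => proj2 (df s t sh' th)).
by exists s, t; split=> //; rewrite -/(F x) -/(F (x + h *: u)) E DF E2 mulrA.
Qed.

(** The second difference is symmetric in [u] and [v], so both mixed derivatives share a value,
    attained at two points arbitrarily close to [x]; continuity concludes. *)
Lemma partialC V f a b x : open V -> smooth V f -> V x ->
  partial a (partial b f) x = partial b (partial a f) x.
Proof.
move=> Vo sf Vx.
set u : 'rV[R]_d := delta_mx 0 a; set v : 'rV[R]_d := delta_mx 0 b.
have cont k l : {for x, continuous (partial k (partial l f))}.
  by apply/differentiable_continuous/(@smooth_diff _ _ V) => //;
     do 2 apply: smooth_partial.
apply/eqP; rewrite -subr_eq0 -normr_eq0; apply/negPn/negP => N0.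
set e := `| _ - _ | in N0.
have e0 : 0 < e / 2 by rewrite divr_gt0 ?ltr0n // lt_neqAle eq_sym N0 normr_ge0.
have [r /= r0 rV] : exists2 r : R, 0 < r & forall y, `|y - x| < r ->
   [/\ V y, `|partial a (partial b f) x - partial a (partial b f) y| < e / 2 &
        `|partial b (partial a f) x - partial b (partial a f) y| < e / 2].
  have Vn : \forall y \near x, V y by apply: open_nbhs_nbhs.
  have /cvgrPdist_lt/(_ _ e0) Ca := cont a b.
  have /cvgrPdist_lt/(_ _ e0) Cb := cont b a.
  have [r /= r0 H] := (nbhs_normP x _).1 (filterI Vn (filterI Ca Cb)).
  exists r => // y yx; rewrite distrC in yx.
  by have [Vy [h1 h2]] := H y yx; exact: (And3 Vy h1 h2).
(* [h] is so small that the parallelogram with sides [h *: u] and [h *: v] stays within distance [r]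
   of [x]; the summand 1 makes [N] positive. *)
pose N := `|u| + `|v| + 1.
have N1 : 0 < N by rewrite ltr_wpDl // addr_ge0.
pose h := r / 2 / N.
have h0 : 0 < h by rewrite !divr_gt0.
have near s t : 0 <= s <= h -> 0 <= t <= h -> `|x + s *: u + t *: v - x| < r.
  move=> /andP[s0 sh] /andP[t0 th]; rewrite addrAC (addrAC x) subrr add0r.
  apply: (le_lt_trans (ler_normD _ _)); rewrite !normrZ !ger0_norm //.
  apply: (@le_lt_trans _ _ (h * N)).
    rewrite /N mulrDr mulr1 mulrDr -addrA.
    by rewrite lerD ?ler_wpM2r // ler_wpDr ?ler_wpM2r // ltW.
  by rewrite divfK ?gt_eqF // ltr_pdivrMr // ltr_pMr // ltr1n.
have ne s t : 0 < s < h -> 0 < t < h -> `|x + s *: u + t *: v - x| < r.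
  by move=> /andP[s0 sh] /andP[t0 th]; apply: near; rewrite !ltW.
have D l y : V y -> differentiable f y /\ differentiable (partial l f) y.
  by move=> Vy; split; apply: (@smooth_diff _ _ V) => //; apply: smooth_partial.
have [s [t [sh th E1]]] : exists s t, [/\ 0 < s < h, 0 < t < h &
    f (x + h *: u + h *: v) - f (x + h *: u) - (f (x + h *: v) - f x)
    = h ^+ 2 * partial b (partial a f) (x + s *: u + t *: v)].
  apply: second_difference => // s t sh th.
  by apply: (D a); have [] := rV _ (near s t sh th).
have [t' [s' [th' sh' E2]]] : exists s t, [/\ 0 < s < h, 0 < t < h &
    f (x + h *: v + h *: u) - f (x + h *: v) - (f (x + h *: u) - f x)
    = h ^+ 2 * partial a (partial b f) (x + s *: v + t *: u)].
  apply: second_difference => // t' s' th' sh'.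
  by apply: (D b); rewrite addrAC; have [] := rV _ (near s' t' sh' th').
have E12 : f (x + h *: u + h *: v) - f (x + h *: u) - (f (x + h *: v) - f x) =
    f (x + h *: v + h *: u) - f (x + h *: v) - (f (x + h *: u) - f x).
  by rewrite (addrAC x (h *: v)) !opprB addrACA [RHS]addrACA; congr (_ + _); exact: addrC.
have h2 : h ^+ 2 != 0 by rewrite expf_neq0 // gt_eqF.
have E := mulfI h2 (etrans (esym E1) (etrans E12 E2)).
have [_ _ H1] := rV _ (ne s t sh th).
have [_ H2 _] := rV _ (ne s' t' sh' th').
rewrite addrAC in H2.
have : e < e.
  apply: (le_lt_trans (ler_distD
    (partial a (partial b f) (x + t' *: v + s' *: u)) _ _)).
  rewrite distrC E in H1; have := ltrD H2 H1; rewrite -splitr; exact.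
by rewrite ltxx.
Qed.

End Schwarz.

(** * Connections over a commutative ring with derivations *)

Section Derivations.
Variables (K : comNzRingType) (d : nat).
Implicit Types (D : 'I_d -> K -> K) (f h : K) (G H : 'M[K]_d)
  (Gam : 'I_d -> 'M[K]_d).

Definition derivations D :=
  (forall a f h, D a (f + h) = D a f + D a h) /\
  (forall a f h, D a (f * h) = f * D a h + h * D a f).

(* [Gam b c a] is the Christoffel symbol Gamma^a_{bc}, so that [Gam b] is the
   connection matrix in the direction b acting on row vectors. *)
Definition levi_civita D G Gam :=
  (forall b c a, Gam b c a = Gam c b a) /\
  (forall b, map_mx (D b) G = Gam b *m G + (Gam b *m G)^T).

(** The Koszul formula. [H] stands for the inverse of [G], and [half] for the inverse of 2, which a
    commutative ring need not contain. *)
Definition koszul D G H (half : K) b : 'M[K]_d :=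
  half *: (\matrix_(c, e) (D b (G e c) + D c (G e b) - D e (G b c)) *m H).

(** Connection matrices act on row vectors, so products appear in reversed order: [Gam b *m Gam a]
    carries the term Gamma^e_{aq} Gamma^q_{bc}. *)
Definition curvature D Gam a b :=
  map_mx (D a) (Gam b) - map_mx (D b) (Gam a) + Gam b *m Gam a - Gam a *m Gam b.

Definition Ric D Gam := \matrix_(b, c) \sum_a curvature D Gam a b c a.

Definition contract H (S : 'M[K]_d) := \sum_a \sum_b H a b * S a b.

Definition grad D f : 'cV[K]_d := \col_a D a f.

Definition carre D H f h := contract H (grad D f *m (grad D h)^T).

Definition hess D Gam f :=
  \matrix_(a, b) (D a (D b f) - \sum_e Gam a b e * D e f).

Definition lap D H Gam f := contract H (hess D Gam f).

Definition sc D H Gam := contract H (Ric D Gam).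

Lemma contractE H S : contract H S = \tr (H^T *m S).
Proof.
rewrite /contract exchange_big; apply: eq_bigr => b _; rewrite !mxE.
by apply: eq_bigr => a _; rewrite mxE.
Qed.

Section OneFamily.
Variable D : 'I_d -> K -> K.
Hypothesis derD : derivations D.

Lemma derE a f h : D a (f + h) = D a f + D a h. Proof. exact: derD.1. Qed.
Lemma derM a f h : D a (f * h) = f * D a h + h * D a f.
Proof. exact: derD.2. Qed.
Lemma der0 a : D a 0 = 0.
Proof. by apply: (@addrI _ (D a 0)); rewrite -derE !addr0. Qed.
Lemma der1 a : D a 1 = 0.
Proof.
by apply: (@addrI _ (D a 1)); rewrite addr0 -{3}(mulr1 1) derM !mul1r.
Qed.
Lemma derN a f : D a (- f) = - D a f.
Proof. by apply/eqP; rewrite -addr_eq0 -derE addNr der0. Qed.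
Lemma derB a f h : D a (f - h) = D a f - D a h.
Proof. by rewrite derE derN. Qed.
Lemma der_sum (I : Type) (r : seq I) (P : pred I) (F : I -> K) a :
  D a (\sum_(i <- r | P i) F i) = \sum_(i <- r | P i) D a (F i).
Proof. exact: (big_morph _ (derE a) (der0 a)). Qed.
Lemma der_nat n a : D a n%:R = 0.
Proof. by elim: n => [|n IH]; rewrite ?der0 // -natr1 derE IH der1 addr0. Qed.

Lemma mderD n m (A B : 'M[K]_(n, m)) a :
  map_mx (D a) (A + B) = map_mx (D a) A + map_mx (D a) B.
Proof. by apply/matrixP => i j; rewrite !mxE derE. Qed.

Lemma mderM n m p (A : 'M[K]_(n, m)) (B : 'M[K]_(m, p)) a :
  map_mx (D a) (A *m B) = map_mx (D a) A *m B + A *m map_mx (D a) B.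
Proof.
apply/matrixP => i j; rewrite !mxE der_sum -big_split; apply: eq_bigr => k _ /=.
by rewrite derM !mxE addrC [B k j * _]mulrC.
Qed.

Section Metric.
Variables (G H : 'M[K]_d) (half : K).
Hypotheses (Gsym : G^T = G) (GH : G *m H = 1%:M) (HG : H *m G = 1%:M).
Hypothesis half2 : half * 2%:R = 1.

Lemma inv_sym : H^T = H.
Proof.
have H1 : G *m H^T = 1%:M by rewrite -{1}Gsym -trmx_mul HG trmx1.
by rewrite -[LHS]mul1mx -HG -mulmxA H1 mulmx1.
Qed.

Lemma symG a b : G a b = G b a. Proof. by rewrite -{1}Gsym mxE. Qed.
Lemma symH a b : H a b = H b a. Proof. by rewrite -{1}inv_sym mxE. Qed.

Lemma sumHG a c : \sum_e H a e * G e c = (a == c)%:R.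
Proof. by move/matrixP: HG => /(_ a c); rewrite !mxE. Qed.

Lemma levi_civita_entry Gam b c e : levi_civita D G Gam ->
  D b (G c e) = \sum_a (Gam b c a * G a e + Gam b e a * G a c).
Proof.
by case=> _ /(_ b)/matrixP/(_ c e); rewrite !mxE => ->; rewrite big_split.
Qed.

Lemma sum_delta (F : 'I_d -> K) a : \sum_b F b * (a == b)%:R = F a.
Proof.
rewrite (bigD1 a) //= eqxx mulr1 big1 ?addr0 // => b ba.
by rewrite eq_sym (negbTE ba) mulr0.
Qed.

(** In the Koszul combination of three metric equations, the symmetry of the lower indices cancels
    every term except twice [Gam b *m G]. Uniqueness is the tool for all transformation laws: a
    candidate connection need only be checked against the two defining equations. *)
Lemma levi_civita_unique Gam b :
  levi_civita D G Gam -> Gam b = koszul D G H half b.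
Proof.
move=> LC; have [Gs _] := LC.
rewrite /koszul; set X := \matrix_(c, e) _.
have -> : X = 2%:R *: (Gam b *m G).
  apply/matrixP => c e; rewrite !mxE !(levi_civita_entry _ _ _ LC).
  rewrite -big_split -sumrB mulr_sumr; apply: eq_bigr => q _ /=.
  by rewrite !(Gs e) !(Gs c b) (symG q e) (symG q c) (symG q b); ring.
by rewrite -scalemxAl scalerA half2 scale1r -mulmxA GH mulmx1.
Qed.

Lemma koszulP : levi_civita D G (koszul D G H half).
Proof.
split=> [b c a|b].
  rewrite !mxE; congr (_ * _); apply: eq_bigr => e _; rewrite !mxE.
  by rewrite [D b _ + _]addrC (symG b c).
rewrite /koszul -scalemxAl -mulmxA HG mulmx1.
apply/matrixP => c e; rewrite !mxE (symG e c) (symG b c) (symG b e).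
rewrite -mulrDr addrACA -[in RHS]opprD.
rewrite (_ : _ + _ - _ = 2%:R * D b (G c e)); first by rewrite mulrA half2 mul1r.
rewrite (symG c b) (symG e b); ring.
Qed.

End Metric.
End OneFamily.
End Derivations.

Lemma addmxE (V : zmodType) m n (A B : 'M[V]_(m, n)) i j :
  (A + B) i j = A i j + B i j.
Proof. by rewrite mxE. Qed.

Lemma oppmxE (V : zmodType) m n (A : 'M[V]_(m, n)) i j : (- A) i j = - A i j.
Proof. by rewrite mxE. Qed.

Lemma mapmxE (V W : Type) (f : V -> W) m n (A : 'M[V]_(m, n)) i j :
  map_mx f A i j = f (A i j).
Proof. by rewrite mxE. Qed.

Lemma curvature_entry (K : comNzRingType) d (D : 'I_d -> K -> K)
    (Gam : 'I_d -> 'M[K]_d) a b c e :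
  curvature D Gam a b c e = D a (Gam b c e) - D b (Gam a c e) +
    \sum_q (Gam a q e * Gam b c q - Gam b q e * Gam a c q).
Proof.
rewrite /curvature !(addmxE, oppmxE) -addrA sumrB; congr (_ + (_ - _)).
- by rewrite !mapmxE.
- by rewrite mxE; apply: eq_bigr => q _; exact: mulrC.
- by rewrite mxE; apply: eq_bigr => q _; exact: mulrC.
Qed.

(** * Transformation laws under a change of coordinates *)

Section ChartChange.
Variables (K : comNzRingType) (d : nat) (D D' : 'I_d -> K -> K).
Variables (J Ji G G' H H' : 'M[K]_d) (half : K) (Gam Gam' : 'I_d -> 'M[K]_d).
Hypothesis derD : derivations D.
Hypothesis DC : forall a b f, D a (D b f) = D b (D a f).
Hypotheses (JJi : J *m Ji = 1%:M) (JiJ : Ji *m J = 1%:M).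
Hypothesis DJ : forall a b c, D a (J b c) = D b (J a c).
Hypothesis DD' : forall a f, D a f = \sum_c J a c * D' c f.
Hypotheses (Gsym : G^T = G) (GH : G *m H = 1%:M) (HG : H *m G = 1%:M).
Hypotheses (GH' : G' *m H' = 1%:M).
Hypothesis half2 : half * 2%:R = 1.
Hypothesis GG' : G = J *m G' *m J^T.
Hypotheses (LC : levi_civita D G Gam) (LC' : levi_civita D' G' Gam').

(** The primed connection taken in the directions of the unprimed frame; the matrix indices remain
    primed. *)
Let Gt b := \sum_c J b c *: Gam' c.

Lemma JTJi : J^T *m Ji^T = 1%:M.
Proof. by rewrite -trmx_mul JiJ trmx1. Qed.

Lemma inverse_change : H = Ji^T *m H' *m Ji.
Proof.
rewrite -[RHS]mul1mx -HG GG' -!mulmxA (mulmxA J^T) JTJi mul1mx.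
by rewrite (mulmxA G') GH' mul1mx JJi mulmx1.
Qed.

Lemma mDE a n m (A : 'M[K]_(n, m)) :
  map_mx (D a) A = \sum_c J a c *: map_mx (D' c) A.
Proof.
apply/matrixP => i j; rewrite !mxE DD' summxE; apply: eq_bigr => c _.
by rewrite !mxE.
Qed.

(* Both sides define a connection satisfying the equations that characterize the
   Levi-Civita connection of G. *)
Lemma connection_change b : Gam b *m J = J *m Gt b + map_mx (D b) J.
Proof.
suff LCh : levi_civita D G (fun b => (J *m Gt b + map_mx (D b) J) *m Ji).
  rewrite (levi_civita_unique Gsym GH half2 b LC).
  rewrite -(levi_civita_unique Gsym GH half2 b LCh).
  by rewrite -mulmxA JiJ mulmx1.
split=> [{}b c a|{}b].
  rewrite !mxE; apply: eq_bigr => e _; congr (_ * _); rewrite !mxE DJ; congr (_ + _).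
  under eq_bigr => q _ do rewrite summxE mulr_sumr.
  rewrite exchange_big; apply: eq_bigr => p _ /=.
  rewrite summxE mulr_sumr; apply: eq_bigr => q _.
  by rewrite !mxE (LC'.1 q); ring.
set A := J *m Gt b + _.
have E : A *m Ji *m G = A *m G' *m J^T.
  by rewrite GG' !mulmxA -(mulmxA A) JiJ mulmx1.
have G's : G'^T = G'.
  have -> : G' = Ji *m G *m Ji^T.
    by rewrite GG' !mulmxA JiJ mul1mx -!mulmxA JTJi mulmx1.
  by rewrite !trmx_mul trmxK Gsym mulmxA.
have DG' : map_mx (D b) G' = Gt b *m G' + (Gt b *m G')^T.
  rewrite mDE mulmx_suml linear_sum -big_split; apply: eq_bigr => c _ /=.
  by rewrite LC'.2 scalerDr -scalemxAl linearZ.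
rewrite E; have -> : A *m G' *m J^T = J *m (Gt b *m G') *m J^T + map_mx (D b) J *m G' *m J^T.
  by rewrite /A !mulmxDl !mulmxA.
have trD (X Y : 'M[K]_d) : (X + Y)^T = X^T + Y^T by exact: linearD.
rewrite GG' !mderM // DG' -map_trmx trD.
rewrite [(J *m (Gt b *m G') *m J^T)^T]trmx_mul [(J *m (Gt b *m G'))^T]trmx_mul.
rewrite [(map_mx (D b) J *m G' *m J^T)^T]trmx_mul [(map_mx (D b) J *m G')^T]trmx_mul.
rewrite !trmxK G's !mulmxDl mulmxDr mulmxDl !mulmxA.
by rewrite -!addrA addrCA; congr (_ + _); rewrite addrCA.
Qed.

(** The curvature is the antisymmetrization in [a], [b] of [map_mx (D a) (Gam b) + Gam b *m Gam a].
    Each such half transforms with extra terms symmetric in [a] and [b], which therefore cancel. *)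
Lemma curvature_change a b : curvature D Gam a b *m J =
  J *m \sum_c \sum_e (J a c * J b e) *: curvature D' Gam' c e.
Proof.
have half_curv a' b' : (map_mx (D a') (Gam b') + Gam b' *m Gam a') *m J =
    J *m (map_mx (D a') (Gt b') + Gt b' *m Gt a') +
    (map_mx (D a') J *m Gt b' + map_mx (D b') J *m Gt a'
     + map_mx (D a') (map_mx (D b') J)).
  have := congr1 (map_mx (D a')) (connection_change b').
  rewrite mderM // mderD // mderM // => E.
  rewrite mulmxDl -mulmxA connection_change mulmxDr mulmxA connection_change.
  have {E} -> : map_mx (D a') (Gam b') *m J = map_mx (D a') J *m Gt b' +
      J *m map_mx (D a') (Gt b') + map_mx (D a') (map_mx (D b') J)
      - Gam b' *m map_mx (D a') J by rewrite -E addrK.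
  rewrite mulmxDl mulmxDr !mulmxA.
  by apply/matrixP => i j; rewrite !(addmxE, oppmxE); ring.
have curvE X a' b' (E : 'I_d -> K -> K) : curvature E X a' b' =
   (map_mx (E a') (X b') + X b' *m X a') - (map_mx (E b') (X a') + X a' *m X b').
  by rewrite /curvature opprD addrACA -!addrA; congr (_ + _); rewrite addrCA.
have DDJ : map_mx (D b) (map_mx (D a) J) = map_mx (D a) (map_mx (D b) J).
  by apply/matrixP => i j; rewrite !mxE DC.
transitivity (J *m curvature D Gt a b).
  rewrite !curvE mulmxBl !half_curv DDJ mulmxBr.
  by rewrite (addrC (map_mx (D b) J *m _)) opprD addrACA subrr addr0.
congr (_ *m _).
(* The only non-tensorial term left contains [D a' (J b' c)], which is symmetric in [a'] and [b'] by
   [DJ]. *)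
have halfGt a' b' : map_mx (D a') (Gt b') + Gt b' *m Gt a' =
    \sum_c D a' (J b' c) *: Gam' c +
    \sum_c \sum_e (J a' c * J b' e) *: (map_mx (D' c) (Gam' e) + Gam' e *m Gam' c).
  have -> : map_mx (D a') (Gt b') = \sum_c D a' (J b' c) *: Gam' c +
      \sum_c J b' c *: map_mx (D a') (Gam' c).
    rewrite -big_split; apply/matrixP => i j; rewrite mxE !summxE der_sum //.
    by apply: eq_bigr => c _; rewrite !mxE derM // addrC [Gam' c i j * _]mulrC.
  rewrite -addrA; congr (_ + _).
  rewrite [RHS]exchange_big mulmx_suml -big_split; apply: eq_bigr => c _ /=.
  rewrite mulmx_sumr mDE scaler_sumr -big_split; apply: eq_bigr => e _ /=.
  by rewrite -scalemxAl -scalemxAr !scalerA scalerDr mulrC.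
rewrite curvE !halfGt opprD addrACA.
under eq_bigr => c _ do rewrite DJ.
rewrite subrr add0r [X in _ - X]exchange_big -sumrB; apply: eq_bigr => c _ /=.
rewrite -sumrB; apply: eq_bigr => e _.
by rewrite curvE scalerBr [J b e * _]mulrC.
Qed.

Lemma sumJiJ c e : \sum_a Ji c a * J a e = (c == e)%:R.
Proof. by move/matrixP: JiJ => /(_ c e); rewrite !mxE. Qed.

(** Summing over the traced index [a] pairs the [Ji] of the conjugation with the factor [J a p], and
    the two collapse to a delta. *)
Lemma Ric_change : Ric D Gam = J *m Ric D' Gam' *m J^T.
Proof.
apply/matrixP => b c; rewrite mxE.
have curvJ a : curvature D Gam a b =
    J *m (\sum_p \sum_q (J a p * J b q) *: curvature D' Gam' p q) *m Ji.
  by rewrite -curvature_change -mulmxA JJi mulmx1.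
under eq_bigr => a _ do rewrite curvJ mulmx_sumr mulmx_suml summxE.
rewrite exchange_big /=.
transitivity (\sum_p \sum_q J b q * (J *m curvature D' Gam' p q) c p).
  apply: eq_bigr => p _.
  under eq_bigr => a _ do rewrite mulmx_sumr mulmx_suml summxE.
  rewrite exchange_big /=; apply: eq_bigr => q _.
  under eq_bigr => a _ do rewrite -scalemxAr -scalemxAl mxE mxE mulr_sumr.
  rewrite exchange_big /=.
  rewrite (eq_bigr (fun e => (J b q * (J *m curvature D' Gam' p q) c e) *
    \sum_a Ji e a * J a p)); last first.
    by move=> e _; rewrite mulr_sumr; apply: eq_bigr => a _; ring.
  by under eq_bigr => e _ do rewrite sumJiJ eq_sym; rewrite sum_delta.
rewrite exchange_big -mulmxA mxE; apply: eq_bigr => q _.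
rewrite -mulr_sumr; congr (_ * _); rewrite mxE.
under eq_bigr => p _ do rewrite mxE.
rewrite exchange_big; apply: eq_bigr => e _ /=.
by rewrite -mulr_sumr !mxE mulrC.
Qed.

Lemma contract_change S : contract H (J *m S *m J^T) = contract H' S.
Proof.
rewrite !contractE inverse_change !trmx_mul trmxK -!mulmxA mxtrace_mulC.
by rewrite !mulmxA -(mulmxA _ Ji J) JiJ mulmx1 -(mulmxA _ J^T) JTJi mulmx1.
Qed.

Lemma sc_change : sc D H Gam = sc D' H' Gam'.
Proof. by rewrite /sc Ric_change contract_change. Qed.

Lemma grad_change f : grad D f = J *m grad D' f.
Proof.
apply/matrixP => a j; rewrite !mxE DD'; apply: eq_bigr => c _; by rewrite mxE.
Qed.

Lemma carre_change f h : carre D H f h = carre D' H' f h.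
Proof.
rewrite /carre -contract_change; congr (contract H _).
by rewrite !grad_change trmx_mul !mulmxA.
Qed.

Lemma hess_change f : hess D Gam f = J *m hess D' Gam' f *m J^T.
Proof.
(* A row of the Hessian is the covariant derivative of the gradient, taken as a column, so
   [connection_change] applies to the whole row; the terms with derivatives of [J] cancel. *)
pose hcol (E : 'I_d -> K -> K) (X : 'I_d -> 'M[K]_d) a (u : 'cV[K]_d) : 'cV[K]_d := map_mx (E a) u - X a *m u.
have hessE E X a b : hess E X f a b = hcol E X a (grad E f) b 0.
  by rewrite !mxE; congr (_ - _); apply: eq_bigr => e _; rewrite mxE.
have E a : hcol D Gam a (grad D f) =
    J *m \sum_c J a c *: hcol D' Gam' c (grad D' f).
  rewrite /hcol grad_change mderM // mulmxA connection_change mulmxDl.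
  have zE (X Y Z : 'cV[K]_d) : X + Y - (Z + X) = Y - Z.
    by apply/matrixP => i j; rewrite !(addmxE, oppmxE); ring.
  rewrite zE -mulmxA -mulmxBr; congr (_ *m _).
  by rewrite mDE mulmx_suml -sumrB; apply: eq_bigr => c _; rewrite scalerBr scalemxAl.
apply/matrixP => a b; rewrite hessE E -mulmxA.
rewrite [RHS]mxE [LHS]mxE; under [RHS]eq_bigr => c _ do rewrite mxE mulr_sumr.
rewrite [RHS]exchange_big; apply: eq_bigr => e _ /=.
rewrite summxE mulr_sumr; apply: eq_bigr => c _.
by rewrite mxE hessE [J^T e b]mxE; ring.
Qed.

Lemma lap_change f : lap D H Gam f = lap D' H' Gam' f.
Proof. by rewrite /lap hess_change contract_change. Qed.


End ChartChange.

(** * Connection, Laplacian and scalar curvature under conformal rescaling *)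

Section ConformalChange.
Variables (K : comNzRingType) (d : nat) (D : 'I_d -> K -> K).
Variables (G H : 'M[K]_d) (half w wi : K) (Gam Gamw : 'I_d -> 'M[K]_d).
Hypotheses (derD : derivations D).
Hypotheses (Gsym : G^T = G) (GH : G *m H = 1%:M) (HG : H *m G = 1%:M).
Hypothesis half2 : half * 2%:R = 1.
Hypothesis wwi : w * wi = 1.
Hypotheses (LC : levi_civita D G Gam) (LCw : levi_civita D (w ^+ 2 *: G) Gamw).

(** [Y] is the logarithmic differential of [w], [Yu] is [Y] with its index raised, and [T] is the
    difference of the Levi-Civita connections of [w ^+ 2 *: G] and [G]. *)
Let Y a := wi * D a w.
Let Yu a := \sum_e H a e * Y e.
Let T b : 'M[K]_d :=
  \matrix_(c, a) ((b == a)%:R * Y c + (c == a)%:R * Y b - G b c * Yu a).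

Let sG a b : G a b = G b a. Proof. exact: symG. Qed.
Let sH a b : H a b = H b a. Proof. exact: (symH Gsym HG). Qed.

Lemma sumdl (F : 'I_d -> K) a : \sum_b (a == b)%:R * F b = F a.
Proof. by under eq_bigr => b _ do rewrite mulrC; rewrite sum_delta. Qed.

Lemma lower_Yu b : \sum_a G b a * Yu a = Y b.
Proof.
rewrite /Yu; under eq_bigr => a _ do rewrite mulr_sumr.
rewrite exchange_big /=; under eq_bigr => e _ do
  (under eq_bigr => a _ do rewrite mulrA); under eq_bigr => e _ do
  rewrite -mulr_suml.
rewrite -[RHS](sumdl Y); apply: eq_bigr => e _; congr (_ * _).
by move/matrixP: GH => /(_ b e); rewrite !mxE.
Qed.

Lemma T_lower b c e : \sum_a T b c a * G a e =
  G b e * Y c + G c e * Y b - G b c * Y e.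
Proof.
under eq_bigr => a _ do rewrite mxE mulrBl mulrDl -!mulrA.
rewrite sumrB big_split /= !sumdl -mulr_sumr -(lower_Yu e) ![_ * G _ e]mulrC.
congr (_ - _ * _); first by rewrite /Y; ring.
by apply: eq_bigr => a _; rewrite sG mulrC.
Qed.

(** [T] is symmetric in its lower indices. Once its upper index is lowered, its symmetrization is
    [2 Y_b G_ce], exactly the contribution of the derivative of [w ^+ 2]. Uniqueness concludes. *)
Lemma levi_civita_conformal b : Gamw b = Gam b + T b.
Proof.
have w2i : (w ^+ 2 *: G) *m (wi ^+ 2 *: H) = 1%:M.
  by rewrite -scalemxAl -scalemxAr scalerA -exprMn wwi expr1n scale1r GH.
have w2s : (w ^+ 2 *: G)^T = w ^+ 2 *: G by rewrite linearZ /= Gsym.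
suff LCt : levi_civita D (w ^+ 2 *: G) (fun b => Gam b + T b).
  rewrite (levi_civita_unique w2s w2i half2 b LCw).
  by rewrite -(levi_civita_unique w2s w2i half2 b LCt).
split=> [{}b c a|{}b].
  by rewrite !mxE LC.1 (sG b c); ring.
apply/matrixP => c e; rewrite mxE [RHS]addmxE [X in _ + X]mxE.
have E c' e' : ((Gam b + T b) *m (w ^+ 2 *: G)) c' e' =
    w ^+ 2 * (\sum_a Gam b c' a * G a e') +
    w ^+ 2 * (G b e' * Y c' + G c' e' * Y b - G b c' * Y e').
  rewrite -T_lower -mulrDr -big_split -scalemxAr mxE mxE; congr (_ * _).
  by apply: eq_bigr => a _; rewrite mxE mulrDl.
rewrite !E mxE derM // (levi_civita_entry _ _ _ LC) big_split /=.
rewrite expr2 derM // (sG e c).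
have -> : D b w = w * Y b by rewrite /Y mulrA wwi mul1r.
by ring.
Qed.

Let ct (S : 'I_d -> 'I_d -> K) := \sum_b \sum_c H b c * S b c.

Let eq_ct S1 S2 : (forall b c, S1 b c = S2 b c) -> ct S1 = ct S2.
Proof.
by move=> E; apply: eq_bigr => b _; apply: eq_bigr => c _; rewrite E.
Qed.

Let ctD S1 S2 : ct (fun b c => S1 b c + S2 b c) = ct S1 + ct S2.
Proof.
rewrite -big_split; apply: eq_bigr => b _; rewrite -big_split.
by apply: eq_bigr => c _; rewrite mulrDr.
Qed.

Let ctZ k S : ct (fun b c => k * S b c) = k * ct S.
Proof.
rewrite mulr_sumr; apply: eq_bigr => b _; rewrite mulr_sumr.
by apply: eq_bigr => c _; rewrite mulrCA.
Qed.

Let ctB S1 S2 : ct (fun b c => S1 b c - S2 b c) = ct S1 - ct S2.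
Proof.
rewrite ctD; congr (_ + _); rewrite -mulN1r -ctZ; apply: eq_ct => b c.
by rewrite mulN1r.
Qed.

Let ct_sum (S : 'I_d -> 'I_d -> 'I_d -> K) :
  ct (fun b c => \sum_e S e b c) = \sum_e ct (S e).
Proof.
rewrite /ct [RHS]exchange_big; apply: eq_bigr => b _.
rewrite [RHS]exchange_big; apply: eq_bigr => c _.
by rewrite mulr_sumr.
Qed.

Let ct_sym S : ct (fun b c => S c b) = ct S.
Proof.
rewrite /ct exchange_big; apply: eq_bigr => b _.
by apply: eq_bigr => c _; rewrite sH.
Qed.

Let ct_G : ct (fun b c => G b c) = d%:R.
Proof.
rewrite /ct (eq_bigr (fun=> 1)); first by rewrite sumr_const card_ord.
move=> b _; transitivity (\sum_c H b c * G c b); last by rewrite sumHG // eqxx.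
by apply: eq_bigr => c _; rewrite (sG c).
Qed.

Let ct_Gl (F : 'I_d -> K) e : ct (fun b c => G b e * F c) = F e.
Proof.
rewrite -[RHS](sumdl F) -ct_sym; apply: eq_bigr => b _ /=.
under eq_bigr => c _ do rewrite mulrA.
by rewrite -mulr_suml eq_sym sumHG.
Qed.

(** A connection has two traces, H^{bc} Gamma^a_{bc} here and Gamma^a_{ac} below. The Laplacian
    involves only the first one. *)
Definition contracted_connection (X : 'I_d -> 'M[K]_d) a :=
  ct (fun b c => X b c a).
Definition connection_trace (X : 'I_d -> 'M[K]_d) c := \sum_a X a c a.

Let V := contracted_connection Gam.
Let gm := connection_trace Gam.
Let DY := ct (fun a b => D a (Y b)).

(** The coefficient [d - 2] of the rescaled Laplacian originates here: the two delta terms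
    contribute [Yu a] each, and the metric term subtracts it [d] times. *)
Let contract_T a : contracted_connection T a = (2%:R - d%:R) * Yu a.
Proof.
rewrite /contracted_connection.
rewrite (eq_ct (S2 := fun b c => (b == a)%:R * Y c + (c == a)%:R * Y b
   - Yu a * G b c)); last by move=> b c; rewrite mxE [Yu a * _]mulrC.
rewrite ctB ctD ctZ ct_G -[X in _ + X - _]ct_sym.
have -> : ct (fun b c => (b == a)%:R * Y c) = Yu a.
  rewrite /ct -[RHS](sumdl Yu); apply: eq_bigr => b _; rewrite mulr_sumr.
  by apply: eq_bigr => c _; rewrite eq_sym mulrCA.
by ring.
Qed.

Let trace_T c : connection_trace T c = d%:R * Y c.
Proof.
rewrite /connection_trace.
under eq_bigr => a _ do rewrite mxE eqxx mul1r sG.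
rewrite sumrB big_split /= sumr_const card_ord lower_Yu sumdl.
by rewrite addrK mulr_natl.
Qed.

Let contractE2 S : contract H S = ct (fun a b => S a b).
Proof. by []. Qed.

Let contractZ k S : contract (k *: H) S = k * contract H S.
Proof.
rewrite mulr_sumr; apply: eq_bigr => b _; rewrite mulr_sumr.
by apply: eq_bigr => c _; rewrite mxE mulrA.
Qed.

Let carreE f h : carre D H f h = ct (fun a b => D a f * D b h).
Proof. by apply: eq_ct => a b; rewrite !mxE big_ord1 !mxE. Qed.

Let carre_Yu f : \sum_e Yu e * D e f = wi * carre D H w f.
Proof.
rewrite carreE -ct_sym -ctZ; apply: eq_bigr => e _; rewrite mulr_suml.
by apply: eq_bigr => b _; rewrite /Y; ring.
Qed.

Lemma carre_conformal f h : carre D (wi ^+ 2 *: H) f h = wi ^+ 2 * carre D H f h.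
Proof. exact: contractZ. Qed.

Let lapE X f : lap D H X f =
  ct (fun a b => D a (D b f)) - \sum_e contracted_connection X e * D e f.
Proof.
rewrite /lap contractE2 -(eq_bigr _ (fun e _ => mulrC (D e f) _)).
rewrite -(eq_bigr _ (fun e _ => ctZ (D e f) _)) -ct_sum -ctB.
apply: eq_ct => a b; rewrite mxE; congr (_ - _).
by apply: eq_bigr => e _; rewrite mulrC.
Qed.

Let contracted_Gamw a :
  contracted_connection Gamw a = V a + (2%:R - d%:R) * Yu a.
Proof.
rewrite -contract_T -ctD; apply: eq_ct => b c.
by rewrite levi_civita_conformal mxE.
Qed.

Lemma lap_conformal f : lap D (wi ^+ 2 *: H) Gamw f =
  wi ^+ 2 * (lap D H Gam f + (d%:R - 2%:R) * (wi * carre D H w f)).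
Proof.
rewrite /lap contractZ; congr (_ * _); rewrite -!/(lap _ _ _ _) !lapE -carre_Yu.
rewrite mulr_sumr -addrA; congr (_ + _); rewrite -!sumrN -big_split.
by apply: eq_bigr => e _; rewrite contracted_Gamw -/V /=; ring.
Qed.

Let RicE X b c : Ric D X b c = \sum_a D a (X b c a) - D b (connection_trace X c)
  + \sum_e X b c e * connection_trace X e - \sum_a \sum_e X a c e * X b e a.
Proof.
rewrite mxE; under eq_bigr => a _ do rewrite 2!addmxE addmxE 2!oppmxE.
rewrite !big_split /= !sumrN; congr (_ - _ + _ - _).
- by apply: eq_bigr => a _; rewrite mxE.
- by rewrite der_sum //; apply: eq_bigr => a _; rewrite mxE.
- under eq_bigr => a _ do rewrite mxE.
  by rewrite exchange_big; apply: eq_bigr => e _; rewrite mulr_sumr.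
- by apply: eq_bigr => a _; rewrite mxE.
Qed.

Let ct_DG a : ct (fun b c => D a (G b c)) = 2%:R * gm a.
Proof.
rewrite (eq_ct (S2 := fun b c => \sum_q Gam a b q * G q c +
   \sum_q Gam a c q * G q b)); last first.
  by move=> b c; rewrite (levi_civita_entry _ _ _ LC) // big_split.
rewrite ctD (ct_sym (fun b c => \sum_q Gam a b q * G q c)).
suff -> : ct (fun b c => \sum_q Gam a b q * G q c) = gm a by ring.
rewrite -ct_sym ct_sum; apply: eq_bigr => q _.
rewrite LC.1 -(ct_Gl (fun c => Gam a c q)).
by apply: eq_ct => b c; rewrite sG mulrC.
Qed.

Let ct_divG e : ct (fun a b => D a (G b e)) = \sum_q V q * G q e + gm e.
Proof.
rewrite (eq_ct (S2 := fun a b => \sum_q Gam a b q * G q e +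
   \sum_q Gam a e q * G q b)); last first.
  by move=> a b; rewrite (levi_civita_entry _ _ _ LC) // big_split.
rewrite ctD !ct_sum; congr (_ + _); apply: eq_bigr => q _.
  rewrite mulrC -ctZ; apply: eq_ct => a b; exact: mulrC.
rewrite -(ct_Gl (fun a => Gam a e q)) -ct_sym.
by apply: eq_ct => a b; rewrite sG mulrC.
Qed.

Let VY := \sum_e V e * Y e.
Let gY := \sum_e gm e * Yu e.
Let YY := \sum_e Yu e * Y e.

(** Obtained by differentiating and contracting [lower_Yu], which avoids derivatives of the inverse
    metric; [ct_divG] supplies those of [G]. *)
Let div_Yu : \sum_a D a (Yu a) = DY - VY - gY.
Proof.
suff -> : DY = \sum_a D a (Yu a) + VY + gY by ring.
rewrite /DY (eq_ct (S2 := fun a b => \sum_e G b e * D a (Yu e)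
    + \sum_e Yu e * D a (G b e))); last first.
  by move=> a b; rewrite -(lower_Yu b) der_sum // -big_split; apply: eq_bigr => e _;
     rewrite derM.
rewrite ctD !ct_sum -addrA; congr (_ + _).
  apply: eq_bigr => e _; rewrite -(ct_Gl (fun a => D a (Yu e))) -ct_sym.
  exact: eq_ct.
under eq_bigr => e _ do rewrite ctZ ct_divG mulrDr.
rewrite big_split; congr (_ + _); last by apply: eq_bigr => e _; exact: mulrC.
under eq_bigr => e _ do rewrite mulr_sumr.
rewrite exchange_big; apply: eq_bigr => q _ /=; rewrite -(lower_Yu q) mulr_sumr.
by apply: eq_bigr => e _; ring.
Qed.

Let T_sym b c a : T b c a = T c b a.
Proof. by rewrite !mxE (sG b c); ring. Qed.

(** The second and third terms of [T] both produce the trace of [X] paired with [Yu], with opposite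
    signs, and cancel. It serves for [X := Gam] and for [X := T]. *)
Let ct_quadratic (X : 'I_d -> 'M[K]_d) : (forall b c a, X b c a = X c b a) ->
  ct (fun b c => \sum_a \sum_e X a c e * T b e a)
    = \sum_e contracted_connection X e * Y e.
Proof.
move=> Xs; pose trX := connection_trace X.
rewrite (eq_ct (S2 := fun b c => \sum_e X b c e * Y e + Y b * trX c -
   \sum_a \sum_e Yu a * (G b e * X a c e))); last first.
  move=> b c; rewrite mulr_sumr -!big_split -sumrB.
  rewrite (eq_bigr (fun a => \sum_e (b == a)%:R * (X a c e * Y e) +
     \sum_e (a == e)%:R * (X a c e * Y b) -
     \sum_e Yu a * (G b e * X a c e))); last first.
    move=> a _; rewrite -big_split -sumrB; apply: eq_bigr => e _ /=.
    by rewrite !mxE (eq_sym e); ring.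
  rewrite !sumrB !big_split /=; congr (_ + _ - _).
    by rewrite exchange_big /=; apply: eq_bigr => e _; rewrite sumdl.
  by apply: eq_bigr => a _; rewrite sumdl mulrC.
rewrite ctB ctD ct_sum.
have -> : ct (fun b c => Y b * trX c) = \sum_a Yu a * trX a.
  rewrite -ct_sym; apply: eq_bigr => c _; rewrite mulr_suml.
  by apply: eq_bigr => b _; rewrite mulrA.
rewrite ct_sum -addrA -sumrB [X in _ + X]big1 ?addr0.
  by apply: eq_bigr => e _; rewrite mulrC -ctZ; apply: eq_ct => b c; exact: mulrC.
move=> a _; rewrite ct_sum /trX /connection_trace mulr_sumr -sumrB.
apply: big1 => e _.
by rewrite ctZ (ct_Gl (fun c => X a c e)) Xs subrr.
Qed.

Let ct_quadratic_sym (X : 'I_d -> 'M[K]_d) : (forall b c a, X b c a = X c b a) ->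
  ct (fun b c => \sum_a \sum_e T a c e * X b e a) =
  ct (fun b c => \sum_a \sum_e X a c e * T b e a).
Proof.
move=> Xs; rewrite -ct_sym; apply: eq_ct => b c; rewrite exchange_big.
apply: eq_bigr => a _; apply: eq_bigr => e _.
by rewrite mulrC T_sym Xs.
Qed.

Let ct_divT : ct (fun b c => \sum_a D a (T b c a)) =
  2%:R * DY - 2%:R * gY - d%:R * (DY - VY - gY).
Proof.
rewrite (eq_ct (S2 := fun b c => D b (Y c) + D c (Y b) -
   \sum_a (D a (Yu a) * G b c + Yu a * D a (G b c)))); last first.
  move=> b c; rewrite (eq_bigr (fun a => (b == a)%:R * D a (Y c) +
     (c == a)%:R * D a (Y b) - (D a (Yu a) * G b c + Yu a * D a (G b c)))).
    by rewrite sumrB big_split /= !sumdl.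
  move=> a _; rewrite !mxE derB // derE // !derM // !der_nat //; ring.
rewrite ctB ctD (ct_sym (fun b c => D b (Y c))) ct_sum.
under eq_bigr => a _ do rewrite ctD !ctZ ct_G ct_DG.
rewrite big_split -mulr_suml /= div_Yu -/DY.
rewrite (eq_bigr (fun a => 2%:R * (gm a * Yu a))); last by move=> a _; ring.
rewrite -mulr_sumr -/gY; ring.
Qed.

Let D_wi a : D a wi = - (wi ^+ 2 * D a w).
Proof.
have := derM derD a w wi; rewrite wwi der1 // => E.
rewrite -[LHS]mul1r -wwi -mulrA.
have -> : wi * D a wi = D a wi * wi by rewrite mulrC.
have -> : w * (D a wi * wi) = wi * (w * D a wi) by ring.
have -> : w * D a wi = - (wi * D a w).
  by apply/eqP; rewrite -addr_eq0 -E.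
by ring.
Qed.

(** Both sides are the Laplacian of log [w]. *)
Let divY : DY - VY = wi * lap D H Gam w - wi ^+ 2 * carre D H w w.
Proof.
have -> : DY = wi * ct (fun a b => D a (D b w)) - wi ^+ 2 * carre D H w w.
  rewrite -ctZ carreE -ctZ -ctB; apply: eq_ct => a b.
  by rewrite /Y derM // D_wi; ring.
have -> : VY = wi * \sum_e V e * D e w.
  by rewrite mulr_sumr; apply: eq_bigr => e _; rewrite /Y mulrCA.
by rewrite lapE; ring.
Qed.

Let YYE : YY = wi ^+ 2 * carre D H w w.
Proof.
have -> : YY = wi * \sum_e Yu e * D e w.
  by rewrite mulr_sumr; apply: eq_bigr => e _; rewrite /Y mulrCA.
by rewrite carre_Yu; ring.
Qed.

Let trace_Gamw c : connection_trace Gamw c = gm c + d%:R * Y c.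
Proof.
rewrite -trace_T -big_split; apply: eq_bigr => a _.
by rewrite levi_civita_conformal mxE.
Qed.

(** The classical law Sc' = w^-2 (Sc - 2 (d-1) L - (d-1) (d-2) N), where L is the Laplacian of log
    [w] and N its squared gradient. Expanding [RicE] at [Gam + T] leaves terms whose contractions
    are all computed above. *)
Lemma sc_conformal : sc D (wi ^+ 2 *: H) Gamw =
  wi ^+ 2 * (sc D H Gam
    - 2%:R * (d%:R - 1) * (wi * lap D H Gam w - wi ^+ 2 * carre D H w w)
    - (d%:R - 1) * (d%:R - 2%:R) * (wi ^+ 2 * carre D H w w)).
Proof.
rewrite /sc contractZ; congr (_ * _); rewrite -divY -YYE [LHS]contractE2.
rewrite (eq_ct (S2 := fun b c => Ric D Gam b c + (\sum_a D a (T b c a)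
  + - d%:R * D b (Y c)
  + \sum_e (d%:R * Y e * Gam b c e + (gm e + d%:R * Y e) * T b c e)
  - (\sum_a \sum_e Gam a c e * T b e a + \sum_a \sum_e T a c e * Gam b e a
      + \sum_a \sum_e T a c e * T b e a)))); last first.
  move=> b c; rewrite !RicE trace_Gamw derE // derM // der_nat // mulr0 addr0.
  have -> : \sum_a D a (Gamw b c a) =
      \sum_a D a (Gam b c a) + \sum_a D a (T b c a).
    rewrite -big_split; apply: eq_bigr => a _.
    by rewrite levi_civita_conformal addmxE derE.
  have -> : \sum_e Gamw b c e * connection_trace Gamw e =
     \sum_e Gam b c e * connection_trace Gam e +
     \sum_e (d%:R * Y e * Gam b c e + (gm e + d%:R * Y e) * T b c e).
    rewrite -big_split; apply: eq_bigr => e _ /=.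
    by rewrite trace_Gamw levi_civita_conformal addmxE -/(gm e); ring.
  have -> : \sum_a \sum_e Gamw a c e * Gamw b e a =
     \sum_a \sum_e Gam a c e * Gam b e a + (\sum_a \sum_e Gam a c e * T b e a
      + \sum_a \sum_e T a c e * Gam b e a + \sum_a \sum_e T a c e * T b e a).
    rewrite -!big_split; apply: eq_bigr => a _; rewrite -!big_split.
    by apply: eq_bigr => e _ /=; rewrite !levi_civita_conformal !addmxE; ring.
  by rewrite -/(gm c); ring.
rewrite ctD -contractE2 -!addrA; congr (_ + _).
rewrite ctB !ctD ct_quadratic_sym; last exact: LC.1.
rewrite !ct_quadratic //; last exact: LC.1.
have -> : \sum_e contracted_connection T e * Y e = (2%:R - d%:R) * YY.
  by rewrite [RHS]mulr_sumr; apply: eq_bigr => e _; rewrite contract_T -mulrA.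
have -> : ct (fun b c => \sum_e (d%:R * Y e * Gam b c e +
    (gm e + d%:R * Y e) * T b c e)) =
    d%:R * VY + (2%:R - d%:R) * (gY + d%:R * YY).
  transitivity (\sum_e (d%:R * (V e * Y e) +
      (2%:R - d%:R) * (gm e * Yu e + d%:R * (Yu e * Y e)))).
    rewrite ct_sum; apply: eq_bigr => e _; rewrite ctD !ctZ.
    rewrite -!/(contracted_connection _ _) contract_T -/(V e); ring.
  by rewrite !big_split /= -!mulr_sumr big_split /= -mulr_sumr.
by rewrite ct_divT ctZ -/DY -/V -/VY; ring.
Qed.

End ConformalChange.

(** * Leibniz rules for the squared gradient and the Laplacian *)

Section SecondOrderCalculus.
Variables (K : comNzRingType) (d : nat) (D : 'I_d -> K -> K).
Variables (H : 'M[K]_d) (Gam : 'I_d -> 'M[K]_d).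
Hypotheses (derD : derivations D) (sH : forall a b, H a b = H b a).

Lemma contractD (S1 S2 : 'M[K]_d) :
  contract H (S1 + S2) = contract H S1 + contract H S2.
Proof.
rewrite -big_split; apply: eq_bigr => a _; rewrite -big_split.
by apply: eq_bigr => b _; rewrite mxE mulrDr.
Qed.

Lemma contractZr k (S : 'M[K]_d) : contract H (k *: S) = k * contract H S.
Proof.
rewrite mulr_sumr; apply: eq_bigr => a _; rewrite mulr_sumr.
by apply: eq_bigr => b _; rewrite mxE mulrCA.
Qed.

Lemma contract_tr (S : 'M[K]_d) : contract H S^T = contract H S.
Proof.
rewrite /contract exchange_big; apply: eq_bigr => a _.
by apply: eq_bigr => b _; rewrite mxE sH.
Qed.

Lemma gradD f h : grad D (f + h) = grad D f + grad D h.
Proof. by apply/matrixP => a j; rewrite !mxE derE. Qed.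

Lemma gradM f h : grad D (f * h) = f *: grad D h + h *: grad D f.
Proof. by apply/matrixP => a j; rewrite !mxE derM. Qed.

Lemma carreC f h : carre D H f h = carre D H h f.
Proof. by rewrite /carre -contract_tr trmx_mul trmxK. Qed.

Lemma carreDl f1 f2 h : carre D H (f1 + f2) h = carre D H f1 h + carre D H f2 h.
Proof. by rewrite /carre gradD mulmxDl contractD. Qed.

Lemma carreMl f1 f2 h :
  carre D H (f1 * f2) h = f1 * carre D H f2 h + f2 * carre D H f1 h.
Proof. by rewrite /carre gradM mulmxDl -!scalemxAl contractD !contractZr. Qed.

Lemma lapD f h : lap D H Gam (f + h) = lap D H Gam f + lap D H Gam h.
Proof.
rewrite /lap -contractD; congr (contract H _); apply/matrixP => a b.
rewrite !mxE !derE // addrACA -opprD -big_split; congr (_ - _).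
by apply: eq_bigr => e _; rewrite derE // mulrDr.
Qed.

Lemma lapM f h : lap D H Gam (f * h) =
  f * lap D H Gam h + h * lap D H Gam f + 2%:R * carre D H f h.
Proof.
have -> : 2%:R * carre D H f h =
    contract H (grad D f *m (grad D h)^T + grad D h *m (grad D f)^T).
  by rewrite contractD -!/(carre _ _ _ _) (carreC h f); ring.
rewrite /lap -!contractZr -!contractD; congr (contract H _).
apply/matrixP => a b; rewrite !mxE !big_ord1 !mxE.
rewrite (eq_bigr (fun e => f * (Gam a b e * D e h) + h * (Gam a b e * D e f))).
  by rewrite big_split -!mulr_sumr /= !derM // derE // !derM //; ring.
by move=> e _; rewrite derM //; ring.
Qed.

Lemma carreMr f h1 h2 :
  carre D H f (h1 * h2) = h1 * carre D H f h2 + h2 * carre D H f h1.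
Proof. by rewrite carreC carreMl !(carreC _ f). Qed.

Lemma carreX f h n :
  carre D H (f ^+ n.+1) h = n.+1%:R * f ^+ n * carre D H f h.
Proof.
elim: n => [|n IH]; first by rewrite expr0 !mul1r.
by rewrite exprS carreMl IH -[n.+2]addn1 natrD exprS; ring.
Qed.

Lemma lapX f n : lap D H Gam (f ^+ n.+2) =
  n.+2%:R * f ^+ n.+1 * lap D H Gam f + (n.+2 * n.+1)%:R * f ^+ n * carre D H f f.
Proof.
elim: n => [|n IH]; first by rewrite expr2 lapM expr0 expr1 muln1; ring.
rewrite exprS lapM IH carreC carreX !natrM -!(natr1 n.+2) -!(natr1 n.+1) !exprS.
by ring.
Qed.

Lemma carre_perturb h f n (w := h ^+ n.+2 * f) : carre D H (h + w) (h + w) =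
  carre D H h h + 2%:R * (h ^+ n.+2 * carre D H h f
     + n.+2%:R * h ^+ n.+1 * f * carre D H h h)
  + (h ^+ n.+2) ^+ 2 * carre D H f f
  + 2%:R * n.+2%:R * h ^+ n.+2 * h ^+ n.+1 * f * carre D H h f
  + (n.+2%:R * h ^+ n.+1 * f) ^+ 2 * carre D H h h.
Proof.
have hw u : carre D H w u =
    h ^+ n.+2 * carre D H f u + f * (n.+2%:R * h ^+ n.+1 * carre D H h u).
  by rewrite /w carreMl carreX.
rewrite carreDl !(carreC _ (h + w)) !carreDl (carreC h w) !hw.
by rewrite (carreC f w) !hw (carreC h w) !hw (carreC f h); ring.
Qed.

(** The term with [h ^+ n] is decisive: multiplied by [h] in I^2, it has the same order [h ^+ n.+1]
    as the cross term of [carre_perturb]. *)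
Lemma lap_perturb h f n : lap D H Gam (h + h ^+ n.+2 * f) =
  lap D H Gam h + h ^+ n.+2 * lap D H Gam f
  + f * (n.+2%:R * h ^+ n.+1 * lap D H Gam h
          + (n.+2 * n.+1)%:R * h ^+ n * carre D H h h)
  + 2%:R * (n.+2%:R * h ^+ n.+1 * carre D H h f).
Proof. by rewrite lapD lapM lapX carreX !addrA. Qed.

End SecondOrderCalculus.

(** * Local rings of smooth functions and chart invariance *)

Section SmoothRing.
Variables (R : realType) (d : nat) (V : set 'rV[R]_d).
Hypothesis Vo : open V.

Definition smooth_pred of open V : {pred 'rV[R]_d -> R} := fun f => `[< smooth V f >].

Lemma smooth_predP f : reflect (smooth V f) (f \in smooth_pred Vo).
Proof. exact: asboolP. Qed.

Lemma smooth_subring : subring_closed (smooth_pred Vo).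
Proof.
split=> [|f g /smooth_predP sf /smooth_predP sg|f g /smooth_predP sf /smooth_predP sg];
  apply/smooth_predP.
- exact: smooth_cst.
- exact: smoothB.
- exact: smoothM.
Qed.

HB.instance Definition _ := GRing.isSubringClosed.Build ('rV[R]_d -> R)
  (smooth_pred Vo) smooth_subring.

Record sfun (Vo' : open V) := SFun {
  sfun_val :> 'rV[R]_d -> R;
  sfun_valP : sfun_val \in smooth_pred Vo'
}.

HB.instance Definition _ := [isSub of (sfun Vo) for @sfun_val Vo].
HB.instance Definition _ := [Choice of (sfun Vo) by <:].
HB.instance Definition _ := [SubChoice_isSubComNzRing of (sfun Vo) by <:].

Notation K := (sfun Vo).

Definition ev (x : 'rV[R]_d) (f : K) : R := f x.

Lemma ev_zmod x : zmod_morphism (ev x). Proof. by []. Qed.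
Lemma ev_monoid x : monoid_morphism (ev x). Proof. by []. Qed.
HB.instance Definition _ x := GRing.isZmodMorphism.Build K R (ev x) (ev_zmod x).
HB.instance Definition _ x := GRing.isMonoidMorphism.Build K R (ev x) (ev_monoid x).

Lemma evD x (f h : K) : ev x (f + h) = ev x f + ev x h. Proof. by []. Qed.
Lemma evN x (f : K) : ev x (- f) = - ev x f. Proof. by []. Qed.
Lemma evM x (f h : K) : ev x (f * h) = ev x f * ev x h. Proof. by []. Qed.
Lemma ev_nat x n : ev x n%:R = n%:R. Proof. exact: rmorph_nat. Qed.
Lemma ev_sum x (I : Type) (r : seq I) (P : pred I) (F : I -> K) :
  ev x (\sum_(i <- r | P i) F i) = \sum_(i <- r | P i) ev x (F i).
Proof. exact: (rmorph_sum (ev x)). Qed.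

Lemma sfun_eqP (f g : K) : (forall x, ev x f = ev x g) -> f = g.
Proof. by move=> E; apply/val_inj/funext => x; apply: E. Qed.

Lemma sfun_mxP m n (A B : 'M[K]_(m, n)) :
  (forall x, map_mx (ev x) A = map_mx (ev x) B) -> A = B.
Proof.
move=> E; apply/matrixP => i j; apply: sfun_eqP => x.
by move/matrixP: (E x) => /(_ i j); rewrite !mxE.
Qed.

Lemma sfun_smooth (f : K) : smooth V f.
Proof. exact/smooth_predP/sfun_valP. Qed.

(* The value c off V keeps identities such as invertibility of a matrix valid on
   all of coordinate space. *)
Definition patch_on (c : R) (F : 'rV[R]_d -> R) x :=
  if `[< V x >] then F x else c.

Lemma patch_in c F x : V x -> patch_on c F x = F x.
Proof. by rewrite /patch_on => Vx; case: asboolP. Qed.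

Lemma patch_out c F x : ~ V x -> patch_on c F x = c.
Proof. by rewrite /patch_on => Vx; case: asboolP. Qed.

Lemma patch_smooth c F : smooth V F -> patch_on c F \in smooth_pred Vo.
Proof.
by move=> sF; apply/smooth_predP/(eq_smooth Vo _ sF) => x Vx; rewrite patch_in.
Qed.

Definition mk c F (sF : smooth V F) : K := SFun (patch_smooth c sF).

(** Equality in [sfun Vo] is equality on all of coordinate space. The value 0 off [V] makes the
    Leibniz rule and the commutation of the derivations hold there as well. *)
Definition der a (f : K) : K := mk 0 (smooth_partial a (@sfun_smooth f)).

Lemma ev_der a f x : V x -> ev x (der a f) = partial a f x.
Proof. exact: patch_in. Qed.

Lemma ev_der_out a f x : ~ V x -> ev x (der a f) = 0.
Proof. exact: patch_out. Qed.

Lemma der_derivations : derivations der.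
Proof.
have df (f : K) x : V x -> differentiable f x.
  by apply: smooth_diff; apply: sfun_smooth.
split=> a f h; apply: sfun_eqP => x; have [Vx|Vx] := pselect (V x).
- rewrite evD !ev_der //; exact: (partialD a (df f x Vx) (df h x Vx)).
- by rewrite evD !ev_der_out // addr0.
- rewrite evD !evM !ev_der //; exact: (partialM a (df f x Vx) (df h x Vx)).
- by rewrite evD !evM !ev_der_out // !mulr0 addr0.
Qed.

Lemma derC a b f : der a (der b f) = der b (der a f).
Proof.
have E k l x : V x -> partial k (der l f) x = partial k (partial l f) x.
  by move=> Vx; apply: (eq_partial _ Vo) => // y Vy; apply: ev_der.
apply: sfun_eqP => x; have [Vx|Vx] := pselect (V x).
  rewrite (ev_der a _ Vx) (ev_der b _ Vx) (E a b x Vx) (E b a x Vx).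
  exact: (partialC a b Vo (@sfun_smooth f) Vx).
by rewrite !(ev_der_out _ _ Vx).
Qed.

Definition half_fun : K := SFun (introT (smooth_predP _) (smooth_cst Vo 2^-1)).

Lemma half_fun2 : half_fun * 2%:R = 1.
Proof.
apply: sfun_eqP => x; rewrite rmorphM rmorph_nat rmorph1 /=.
by rewrite mulVf // pnatr_eq0.
Qed.

End SmoothRing.

(** * Charts, locality and the chain rule *)

Section ChartTopology.
Variables (R : realType) (d : nat) (M : manifold R d).

Lemma chart_image_open (i : cidx M) (W : set M) :
  open W -> W `<=` cdom i -> open (chart i @` W).
Proof.
move=> Wo Wi; rewrite openE => x [p Wp <-].
have dom : nbhs (chart i p) (chart i @` cdom i).
  by apply: open_nbhs_nbhs; split; [exact: ccod_open|exists p => //; exact: Wi].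
have inv : nbhs (chart i p) (cinv i @^-1` W).
  apply: (cinv_continuous (Wi _ Wp)); rewrite chartK; last exact: Wi.
  exact: open_nbhs_nbhs.
apply: filterS (filterI dom inv) => y [[q iq <-]]; rewrite /= chartK // => Wq.
by exists q.
Qed.

Lemma cdom_meet_open (U : set M) i : open U -> open (U `&` cdom i).
Proof. by move=> Uo; apply: openI => //; exact: cdom_open. Qed.

Lemma chart_nbhs (i : cidx M) (W : set M) (p : M) (P : 'rV[R]_d -> Prop) :
  open W -> W p -> cdom i p ->
  (forall q, W q -> cdom i q -> P (chart i q)) -> \forall x \near chart i p, P x.
Proof.
move=> Wo Wp ip WP; apply: (@near_open _ _ (chart i @` (W `&` cdom i))).
- apply: chart_image_open => [|q []//].
  by apply: openI => //; exact: cdom_open.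
- by exists p.
- by move=> y [q [Wq iq] <-]; exact: WP.
Qed.

Lemma pd_near (i : cidx M) a (U : set M) (f h : M -> R) p : open U -> U p ->
  cdom i p -> (forall q, U q -> f q = h q) -> pd i a f p = pd i a h p.
Proof.
move=> Uo Up ip fh; apply: near_partial; apply: (chart_nbhs Uo Up ip) => q Uq iq.
by rewrite /= chartK // fh.
Qed.

Lemma smooth_onP (U : set M) (f : M -> R) : open U ->
  smooth_on U f <-> (forall i, smooth (chart i @` (U `&` cdom i)) (f \o cinv i)).
Proof.
move=> Uo; split=> [sf i x [p [Up ip] <-]|sf i p Up ip]; first exact: sf.
by apply: sf; exists p.
Qed.

Lemma transition_diff (i j : cidx M) p : cdom i p -> cdom j p ->
  differentiable (chart j \o cinv i) (chart i p).
Proof.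
move=> ip jp.
have -> : chart j \o cinv i = \sum_(b < d)
    ((fun x => chart j (cinv i x) 0 b *: (delta_mx 0 b : 'rV[R]_d))
     : 'rV[R]_d -> 'rV[R]_d).
  by apply/funext => x /=; rewrite fct_sumE [LHS]row_sum_delta.
apply: differentiable_sum => b; apply: differentiableZl.
exact: (transition_smooth ip jp b [::]).
Qed.

Lemma transition_near (i j : cidx M) p (F : M -> R) : cdom i p -> cdom j p ->
  \forall x \near chart i p, ((F \o cinv j) \o (chart j \o cinv i)) x = (F \o cinv i) x.
Proof.
move=> ip jp; apply: (@chart_nbhs _ (cdom j)) => //; first exact: cdom_open.
by move=> q jq iq /=; rewrite !chartK.
Qed.

Lemma diff_chart (i j : cidx M) p (F : M -> R) : cdom i p -> cdom j p ->
  differentiable (F \o cinv j) (chart j p) -> differentiable (F \o cinv i) (chart i p).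
Proof.
move=> ip jp dF; apply: (near_differentiable (transition_near F ip jp)).
apply: differentiable_comp; first exact: transition_diff.
by rewrite /= chartK.
Qed.

Lemma pd_chain (i j : cidx M) p (F : M -> R) a : cdom i p -> cdom j p ->
  differentiable (F \o cinv j) (chart j p) ->
  pd i a F p = \sum_c jacobian (chart j \o cinv i) (chart i p) a c * pd j c F p.
Proof.
move=> ip jp dF; set phi := chart j \o cinv i.
have phip : phi (chart i p) = chart j p by rewrite /phi /= chartK.
have dphi : differentiable phi (chart i p) by exact: transition_diff.
have dF' : differentiable (F \o cinv j) (phi (chart i p)) by rewrite phip.
transitivity (partial a ((F \o cinv j) \o phi) (chart i p)).
  by apply/esym/near_partial/(transition_near F ip jp).
have -> : partial a ((F \o cinv j) \o phi) (chart i p) =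
    'd (F \o cinv j) (phi (chart i p)) ('d phi (chart i p) (delta_mx 0 a)).
  have dc := differentiable_comp dphi dF'.
  apply: etrans (deriveE _ dc) _.
  exact: (congr1 (fun h : 'rV[R]_d -> R => h (delta_mx 0 a)) (diff_comp dphi dF')).
have -> : 'd phi (chart i p) (delta_mx 0 a) =
    \sum_c jacobian phi (chart i p) a c *: (delta_mx 0 c : 'rV[R]_d).
  rewrite -(deriveE _ dphi) (deriveEjacobian _ dphi) -rowE [LHS]row_sum_delta.
  by apply: eq_bigr => c _; rewrite mxE.
rewrite linear_sum; apply: eq_bigr => c _; rewrite linearZ /=; congr (_ * _).
by rewrite -(deriveE _ dF') phip.
Qed.

Lemma jacobianE (i j : cidx M) p a b : cdom i p -> cdom j p ->
  jacobian (chart j \o cinv i) (chart i p) a b =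
  partial a (fun x => chart j (cinv i x) 0 b) (chart i p).
Proof.
move=> ip jp; have dphi := transition_diff ip jp.
transitivity (((delta_mx 0 a : 'rV[R]_d) *m jacobian (chart j \o cinv i) (chart i p)) 0 b).
  by rewrite -rowE [RHS]mxE.
rewrite -(deriveEjacobian _ dphi) derive_mx ?mxE //.
exact: diff_derivable.
Qed.

End ChartTopology.

(** The polarization of [chart_gradsq], needed since Leibniz rules pair different functions; on the
    diagonal the two are convertible. *)
Definition chart_carre (R : realType) (d : nat) (M : manifold R d) (g : metric M)
    (i : cidx M) (f h : M -> R) (p : M) : R :=
  \sum_a \sum_b ginv g i a b p * (pd i a f p * pd i b h p).

Lemma gmx_unit (R : realType) (d : nat) (M : manifold R d) (g : metric M)
  (i : cidx M) (p : M) : cdom i p -> gmx g i p \in unitmx.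
Proof.
move=> ip; rewrite unitmxE unitfE; apply/negP => /det0P[v v0 vG].
by have := gmx_pos g ip v0; rewrite vG mul0mx mxE ltxx.
Qed.

(** * Geometric quantities as elements of the ring of a chart *)

Section Representation.
Variables (R : realType) (d : nat) (M : manifold R d) (i : cidx M) (W : set M).
Hypotheses (Wo : open W) (Wi : W `<=` cdom i).

Let V := chart i @` W.
Let Vo : open V := chart_image_open Wo Wi.
Notation K := (sfun Vo).

Definition rep (F : M -> R) (f : K) := forall p, W p -> ev (chart i p) f = F p.

Lemma repD F H f h : rep F f -> rep H h -> rep (fun p => F p + H p) (f + h).
Proof. by move=> rf rh p Wp; rewrite evD rf ?rh. Qed.

Lemma repN F f : rep F f -> rep (fun p => - F p) (- f).
Proof. by move=> rf p Wp; rewrite evN rf. Qed.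

Lemma repB F H f h : rep F f -> rep H h -> rep (fun p => F p - H p) (f - h).
Proof. by move=> rf rh; apply: repD => //; apply: repN. Qed.

Lemma repM F H f h : rep F f -> rep H h -> rep (fun p => F p * H p) (f * h).
Proof. by move=> rf rh p Wp; rewrite evM rf ?rh. Qed.

Lemma rep_sum (I : Type) (r : seq I) (P : pred I) (F : I -> M -> R) (f : I -> K) :
  (forall k, rep (F k) (f k)) ->
  rep (fun p => \sum_(k <- r | P k) F k p) (\sum_(k <- r | P k) f k).
Proof. by move=> rf p Wp; rewrite ev_sum; apply: eq_bigr => k _; exact: (rf k p Wp). Qed.

Lemma rep_half : rep (fun=> 2^-1) (half_fun Vo).
Proof. by []. Qed.

Lemma rep_in F f x : rep F f -> V x -> f x = (F \o cinv i) x.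
Proof. by move=> rf [p Wp <-] /=; rewrite chartK; [exact: (rf p Wp)|exact: Wi]. Qed.

Lemma rep_smooth F f : rep F f -> smooth V (F \o cinv i).
Proof.
move=> rf; apply: (eq_smooth Vo _ (@sfun_smooth _ _ _ Vo f)) => x.
exact: rep_in.
Qed.

Lemma rep_diff F f p : rep F f -> W p -> differentiable (F \o cinv i) (chart i p).
Proof. by move=> rf Wp; apply: (smooth_diff (rep_smooth rf)); exists p. Qed.

Lemma rep_pd a F f : rep F f -> rep (pd i a F) (der a f).
Proof.
move=> rf p Wp; have Vp : V (chart i p) by exists p.
rewrite ev_der //; apply: (eq_partial a Vo) => // x Vx; exact: rep_in.
Qed.

Lemma exists_rep c F : smooth V (F \o cinv i) -> exists f : K,
  [/\ rep F f & forall x, ~ V x -> ev x f = c].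
Proof.
move=> sF; exists (mk Vo c sF); split=> [p Wp|x Vx]; last exact: patch_out.
have Vp : V (chart i p) by exists p.
apply: etrans (patch_in c _ Vp) _.
by rewrite /= chartK //; exact: Wi.
Qed.

Section Geometry.
Variables (g : metric M) (k : cidx M) (E : 'I_d -> K -> K) (G H : 'M[K]_d).
Hypothesis rep_E : forall a F f, rep F f -> rep (pd k a F) (E a f).
Hypothesis rep_G : forall a b, rep (fun p => gmx g k p a b) (G a b).
Hypothesis rep_H : forall a b, rep (ginv g k a b) (H a b).
Hypothesis symH' : forall a b, H a b = H b a.

Let Gam := koszul E G H (half_fun Vo).

(** The chart [k] may differ from the chart [i] that defines the ring: only operators [E]
    representing [pd k] are required. This lets two charts be compared inside one ring. *)
Lemma rep_christoffel a b c : rep (christoffel g k a b c) (Gam b c a).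
Proof.
have -> : Gam b c a = half_fun Vo *
    \sum_e H a e * (E b (G e c) + E c (G e b) - E e (G b c)).
  rewrite !mxE; congr (_ * _); apply: eq_bigr => e _.
  by rewrite !mxE mulrC symH'.
apply: repM; first exact: rep_half.
apply: rep_sum => e; apply: repM; first exact: rep_H.
by apply: repB; [apply: repD|]; apply: rep_E; apply: rep_G.
Qed.

Lemma rep_ricci b c : rep (ricci g k b c) (Ric E Gam b c).
Proof.
rewrite mxE; apply: rep_sum => a.
rewrite curvature_entry; apply: repD.
  by apply: repB; apply: rep_E; apply: rep_christoffel.
by apply: rep_sum => e; apply: repB; apply: repM; apply: rep_christoffel.
Qed.

Lemma rep_scal : rep (chart_scal g k) (sc E H Gam).
Proof.
by apply: rep_sum => a; apply: rep_sum => b; apply: repM; [|apply: rep_ricci].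
Qed.

Lemma rep_carre F f F' f' : rep F f -> rep F' f' ->
  rep (chart_carre g k F F') (carre E H f f').
Proof.
move=> rf rf'; apply: rep_sum => a; apply: rep_sum => b; apply: repM => //.
by rewrite !mxE big_ord1 !mxE; apply: repM; apply: rep_E.
Qed.

Lemma rep_laplacian F f : rep F f -> rep (chart_laplacian g k F) (lap E H Gam f).
Proof.
move=> rf; apply: rep_sum => a; apply: rep_sum => b; apply: repM => //.
rewrite mxE; apply: repB; first by do 2 apply: rep_E.
by apply: rep_sum => e; apply: repM; [apply: rep_christoffel|apply: rep_E].
Qed.

End Geometry.

Lemma exists_rep_mx (A : M -> 'M[R]_d) :
  (forall a b, smooth V (fun x => A (cinv i x) a b)) ->
  exists B : 'M[K]_d, (forall a b, rep (fun p => A p a b) (B a b)) /\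
    (forall x, ~ V x -> map_mx (ev x) B = 1%:M).
Proof.
move=> sA.
have e a b := exists_rep (a == b)%:R (F := fun p => A p a b) (sA a b).
exists (\matrix_(a, b) sval (cid (e a b))); split=> [a b|x Vx].
  by rewrite mxE; have [] := svalP (cid (e a b)).
apply/matrixP => a b; rewrite !mxE.
by have [_ ->] := svalP (cid (e a b)).
Qed.

Lemma rep_mx_ev (A : M -> 'M[R]_d) (B : 'M[K]_d) p :
  (forall a b, rep (fun p => A p a b) (B a b)) -> W p ->
  map_mx (ev (chart i p)) B = A p.
Proof. by move=> rA Wp; apply/matrixP => a b; rewrite mxE rA. Qed.

Lemma rep_mx_eq (A B : 'M[K]_d) :
  (forall p, W p -> map_mx (ev (chart i p)) A = map_mx (ev (chart i p)) B) ->
  (forall x, ~ V x -> map_mx (ev x) A = map_mx (ev x) B) -> A = B.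
Proof.
move=> E E'; apply: sfun_mxP => x; have [[p Wp <-]|Vx] := pselect (V x).
  exact: E.
exact: E'.
Qed.

Lemma exists_rep_metric (g : metric M) (k : cidx M) : W `<=` cdom k ->
  exists G H : 'M[K]_d, [/\ forall a b, rep (fun p => gmx g k p a b) (G a b),
    forall a b, rep (ginv g k a b) (H a b),
    forall x, ~ V x -> map_mx (ev x) G = 1%:M & [/\ G^T = G, G *m H = 1%:M & H *m G = 1%:M]].
Proof.
move=> Wk.
have sG a b : smooth V (fun x => gmx g k (cinv i x) a b).
  by move=> x [p Wp <-]; apply: (gmx_smooth g) => //; [apply: Wk|apply: Wi].
have [G [rG oG]] := exists_rep_mx sG.
have sH a b : smooth V (fun x => invmx (gmx g k (cinv i x)) a b).
  apply: smooth_invmx => // x [p Wp <-]; rewrite chartK; last exact: Wi.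
  by rewrite -unitfE -unitmxE gmx_unit //; apply: Wk.
have [H [rH oH]] := exists_rep_mx (A := fun p => invmx (gmx g k p)) sH.
exists G, H; split=> //; split.
- apply: rep_mx_eq => [p Wp|x Vx]; rewrite -map_trmx.
    by rewrite (rep_mx_ev rG) // gmx_sym //; apply: Wk.
  by rewrite oG // trmx1.
- apply: rep_mx_eq => [p Wp|x Vx]; rewrite map_mxM map_mx1.
    by rewrite (rep_mx_ev rG) // (rep_mx_ev rH) // mulmxV // gmx_unit //; apply: Wk.
  by rewrite oG // oH // mulmx1.
- apply: rep_mx_eq => [p Wp|x Vx]; rewrite map_mxM map_mx1.
    by rewrite (rep_mx_ev rG) // (rep_mx_ev rH) // mulVmx // gmx_unit //; apply: Wk.
  by rewrite oG // oH // mulmx1.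
Qed.

End Representation.

(** * Independence of the chart *)

Section ChartInvariance.
Variables (R : realType) (d : nat) (M : manifold R d) (i j : cidx M) (W : set M).
Hypotheses (Wo : open W) (Wi : W `<=` cdom i) (Wj : W `<=` cdom j).

Let V := chart i @` W.
Let Vo : open V := chart_image_open Wo Wi.
Notation K := (sfun Vo).
Notation rep := (@rep R d M i W Wo Wi).

Let y b (x : 'rV[R]_d) := chart j (cinv i x) 0 b.
Let jac p := jacobian (chart j \o cinv i) (chart i p).

Lemma smooth_transition b : smooth V (y b).
Proof. by move=> x [p Wp <-]; apply: transition_smooth; [exact: Wi|exact: Wj]. Qed.

Lemma jac_unit p : W p -> jac p \in unitmx.
Proof.
move=> Wp; rewrite unitmxE unitfE gt_eqF //.
by apply: transition_oriented; [exact: Wi|exact: Wj].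
Qed.

(** Both charts must act on a single ring, that of chart [i]. So the coordinate derivations of chart
    [j] are defined by the inverse Jacobian, and the chain rule shows that they represent [pd j].
    Off [V] the Jacobian is the identity, in accordance with the metric matrices there. *)
Lemma exists_frame : exists (E : 'I_d -> K -> K) (J Ji : 'M[K]_d),
  [/\ derivations E /\ (forall a F f, rep F f -> rep (pd j a F) (E a f)),
      J *m Ji = 1%:M /\ Ji *m J = 1%:M,
      forall a b c, der a (J b c) = der b (J a c),
      forall a f, der a f = \sum_c J a c * E c f &
      (forall p, W p -> map_mx (ev (chart i p)) J = jac p) /\
      (forall x, ~ V x -> map_mx (ev x) J = 1%:M)].
Proof.
have jacV p a b : W p -> partial a (y b) (chart i p) = jac p a b.
  by move=> Wp; rewrite /jac jacobianE //; [exact: Wi|exact: Wj].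
have sJ a b : smooth V ((fun p => jac p a b) \o cinv i).
  apply: (eq_smooth Vo _ (smooth_partial a (@smooth_transition b))) => x [p Wp <-] /=.
  by rewrite chartK; [exact: jacV|exact: Wi].
have [J [rJ oJ]] := exists_rep_mx Wo Wi sJ.
have sJi a b : smooth V ((fun p => invmx (jac p) a b) \o cinv i).
  apply: (smooth_invmx Vo (A := fun x => jac (cinv i x))) => // x [p Wp <-].
  rewrite chartK; last exact: Wi.
  by rewrite -unitfE -unitmxE jac_unit.
have [Ji [rJi oJi]] := exists_rep_mx Wo Wi (A := fun p => invmx (jac p)) sJi.
have JJi : J *m Ji = 1%:M.
  apply: rep_mx_eq => [p Wp|x Vx]; rewrite map_mxM map_mx1.
    by rewrite (rep_mx_ev rJ) // (rep_mx_ev rJi) // mulmxV // jac_unit.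
  by rewrite oJ // oJi // mulmx1.
have JiJ : Ji *m J = 1%:M.
  apply: rep_mx_eq => [p Wp|x Vx]; rewrite map_mxM map_mx1.
    by rewrite (rep_mx_ev rJ) // (rep_mx_ev rJi) // mulVmx // jac_unit.
  by rewrite oJ // oJi // mulmx1.
pose E c (f : K) := \sum_a Ji c a * der a f.
have [dD dM] := der_derivations Vo.
have DE a f : der a f = \sum_c J a c * E c f.
  rewrite (eq_bigr (fun c => \sum_b J a c * Ji c b * der b f)); last first.
    by move=> c _; rewrite mulr_sumr; apply: eq_bigr => b _; rewrite mulrA.
  rewrite exchange_big /= (eq_bigr (fun b => (a == b)%:R * der b f)).
    by rewrite sumdl.
  move=> b _; rewrite -mulr_suml; congr (_ * _).
  by move/matrixP: JJi => /(_ a b); rewrite !mxE.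
exists E, J, Ji; split=> //.
- split; first split.
  + move=> c f h; rewrite -big_split; apply: eq_bigr => a _.
    by rewrite dD mulrDr.
  + move=> c f h; rewrite !mulr_sumr -big_split; apply: eq_bigr => a _.
    by rewrite dM /= mulrDr; congr (_ + _); exact: mulrCA.
  + move=> c F f rf p Wp; rewrite /E ev_sum.
    have dFj : differentiable (F \o cinv j) (chart j p).
      by apply: (@diff_chart _ _ _ j i) (rep_diff rf Wp); [exact: Wj|exact: Wi].
    rewrite (eq_bigr (fun a => \sum_b invmx (jac p) c a * jac p a b * pd j b F p)).
      rewrite exchange_big (eq_bigr (fun b => (c == b)%:R * pd j b F p)) ?sumdl //.
      move=> b _; rewrite -mulr_suml; congr (_ * _).
      by have /matrixP/(_ c b) := mulVmx (jac_unit Wp); rewrite !mxE.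
    move=> a _; rewrite evM (rJi c a p Wp) (rep_pd a rf Wp).
    rewrite (@pd_chain _ _ _ i j) //; [|exact: Wi|exact: Wj].
    by rewrite mulr_sumr; apply: eq_bigr => b _; rewrite mulrA.
(* The integrability condition is the symmetry of the second derivatives of the transition map. *)
- have rJy a b x : V x -> J a b x = partial a (y b) x.
    by move=> [p Wp <-]; rewrite jacV //; exact: (rJ a b p Wp).
  move=> a b c; apply: sfun_eqP => x; have [Vx|Vx] := pselect (V x); last first.
    by rewrite !(ev_der_out _ _ Vx).
  rewrite (ev_der a _ Vx) (ev_der b _ Vx).
  rewrite (eq_partial a Vo (rJy b c) Vx) (eq_partial b Vo (rJy a c) Vx).
  exact: (partialC a b Vo (@smooth_transition c) Vx).
- by split=> [p Wp|x Vx]; [exact: rep_mx_ev|exact: oJ].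
Qed.

Lemma chart_invariance (g : metric M) p : W p ->
  [/\ chart_scal g i p = chart_scal g j p,
      forall F, smooth V (F \o cinv i) ->
        chart_laplacian g i F p = chart_laplacian g j F p &
      forall F F', smooth V (F \o cinv i) -> smooth V (F' \o cinv i) ->
        chart_carre g i F F' p = chart_carre g j F F' p].
Proof.
move=> Wp.
have [E [J [Ji [[dE rE] [JJi JiJ] DJ DE [eJ oJ]]]]] := exists_frame.
have [G [H [rG rH oG [Gs GH HG]]]] := exists_rep_metric Wo Wi g Wi.
have [G' [H' [rG' rH' oG' [Gs' GH' HG']]]] := exists_rep_metric Wo Wi g Wj.
have dD := der_derivations Vo.
have GG' : G = J *m G' *m J^T.
  apply: rep_mx_eq => [q Wq|x Vx]; rewrite !map_mxM -map_trmx.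
    rewrite (rep_mx_ev rG) // (rep_mx_ev rG') // eJ //.
    by apply: gmx_change; [exact: Wi|exact: Wj].
  by rewrite oG // oG' // oJ // trmx1 !mulmx1.
have h2 := half_fun2 Vo.
have LC := koszulP (der (Vo:=Vo)) Gs HG h2.
have LC' := koszulP E Gs' HG' h2.
have rD a F f : rep F f -> rep (pd i a F) (der a f) by exact: rep_pd.
have sH := symH Gs HG; have sH' := symH Gs' HG'.
split.
- rewrite -(rep_scal rD rG rH sH Wp) -(rep_scal rE rG' rH' sH' Wp).
  by rewrite (sc_change dD (@derC _ _ _ Vo) JJi JiJ DJ DE Gs GH HG GH' h2 GG' LC LC').
- move=> F /(exists_rep Wo Wi 0)[f [rf _]].
  rewrite -(rep_laplacian rD rG rH sH rf Wp) -(rep_laplacian rE rG' rH' sH' rf Wp).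
  by rewrite (lap_change dD JJi JiJ DJ DE Gs GH HG GH' h2 GG' LC LC').
- move=> F F' /(exists_rep Wo Wi 0)[f [rf _]] /(exists_rep Wo Wi 0)[f' [rf' _]].
  rewrite -(rep_carre rD rH rf rf' Wp) -(rep_carre rE rH' rf rf' Wp).
  by rewrite (carre_change JJi JiJ DE HG GH' GG').
Qed.

End ChartInvariance.

Section GlobalOperators.
Variables (R : realType) (d : nat) (M : manifold R d).
Implicit Types (U : set M) (f h : M -> R) (g : metric M) (p : M).

Definition carre_du_champ g f h p := chart_carre g (chart_at p) f h p.

(** [Isq s g] is convertible to [Isq_fun g (s g)]; fixing the scale leaves an operator on
    functions. *)
Definition Isq_fun g f p := gradsq g f p
  - 2 / d%:R * (f p * (laplacian g f p + Jscal g p * f p)).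

Section OneChart.
Variables (U : set M) (i : cidx M).
Hypothesis Uo : open U.
Let W := U `&` cdom i.
Let Wo : open W := cdom_meet_open i Uo.
Let Wi : W `<=` cdom i := @subIsetr _ U (cdom i).
Let V := chart i @` W.
Let Vo : open V := chart_image_open Wo Wi.
Notation K := (sfun Vo).
Notation rep := (@rep R d M i W Wo Wi).

Lemma smooth_on_rep f : smooth_on U f -> exists F : K, rep f F.
Proof.
move=> sf; have sV : smooth V (f \o cinv i) by move=> x [p [Up ip] <-]; exact: sf.
by have [F [rF _]] := exists_rep Wo Wi 0 sV; exists F.
Qed.

Lemma rep_geometry g : exists (H : 'M[K]_d) (Gam : 'I_d -> 'M[K]_d),
  [/\ forall a b, H a b = H b a, rep (chart_scal g i) (sc (der (Vo:=Vo)) H Gam),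
   forall f F, rep f F -> rep (chart_laplacian g i f) (lap (der (Vo:=Vo)) H Gam F) &
   forall f f' F F', rep f F -> rep f' F' ->
      rep (chart_carre g i f f') (carre (der (Vo:=Vo)) H F F')].
Proof.
have [G [H [rG rH _ [Gs GH HG]]]] := exists_rep_metric Wo Wi g Wi.
have rD a F (q : K) : rep F q -> rep (pd i a F) (der a q) by exact: rep_pd.
have sH := symH Gs HG.
exists H, (koszul (der (Vo:=Vo)) G H (half_fun Vo)); split=> //.
- exact: (rep_scal rD rG rH sH).
- by move=> f F rf; exact: (rep_laplacian rD rG rH sH rf).
- by move=> f f' F F' rf rf'; exact: (rep_carre rD rH rf rf').
Qed.

Lemma rep_conformal g g' Om : conformal_to g g' Om ->
  exists (H : 'M[K]_d) (Gam : 'I_d -> 'M[K]_d) (w wi : K),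
  [/\ (forall a b, H a b = H b a) /\ rep Om w,
   rep (fun p => (Om p)^-1) wi /\ w * wi = 1,
   [/\ rep (chart_scal g i) (sc (der (Vo:=Vo)) H Gam),
   forall f F, rep f F -> rep (chart_laplacian g i f) (lap (der (Vo:=Vo)) H Gam F) &
   forall f f' F F', rep f F -> rep f' F' ->
      rep (chart_carre g i f f') (carre (der (Vo:=Vo)) H F F')] &
   [/\ rep (chart_scal g' i) (wi ^+ 2 * (sc (der (Vo:=Vo)) H Gam
    - 2%:R * (d%:R - 1) * (wi * lap (der (Vo:=Vo)) H Gam w
       - wi ^+ 2 * carre (der (Vo:=Vo)) H w w)
    - (d%:R - 1) * (d%:R - 2%:R) * (wi ^+ 2 * carre (der (Vo:=Vo)) H w w))),
    forall f F, rep f F -> rep (chart_laplacian g' i f)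
     (wi ^+ 2 * (lap (der (Vo:=Vo)) H Gam F
        + (d%:R - 2%:R) * (wi * carre (der (Vo:=Vo)) H w F))) &
    forall f f' F F', rep f F -> rep f' F' ->
      rep (chart_carre g' i f f') (wi ^+ 2 * carre (der (Vo:=Vo)) H F F')]].
Proof.
move=> [sOm Om0 gg'].
have [G [H [rG rH _ [Gs GH HG]]]] := exists_rep_metric Wo Wi g Wi.
have rD a F (q : K) : rep F q -> rep (pd i a F) (der a q) by exact: rep_pd.
have sH := symH Gs HG; have h2 := half_fun2 Vo.
have sOmV : smooth V (Om \o cinv i) by move=> x [p [Up ip] <-]; exact: sOm.
(* The default value 1 off [V], also given to the inverse, makes [w * wi = 1] hold everywhere. *)
have [w [rw ow]] := exists_rep Wo Wi 1 sOmV.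
have Om_neq0 p : Om p != 0 by rewrite gt_eqF.
have sOmI : smooth V ((fun p => (Om p)^-1) \o cinv i).
  by apply: (smoothV Vo sOmV) => x _; exact: Om_neq0.
have [wi [rwi owi]] := exists_rep Wo Wi 1 sOmI.
have wwi : w * wi = 1.
  apply: sfun_eqP => x; rewrite evM; have [[p Wp <-]|Vx] := pselect (V x).
    by rewrite (rw p Wp) (rwi p Wp) divff ?Om_neq0 // -[RHS]/(1 : R).
  by rewrite (ow x Vx) (owi x Vx) mulr1.
have LC := koszulP (der (Vo:=Vo)) Gs HG h2.
have Gs' : (w ^+ 2 *: G)^T = w ^+ 2 *: G by rewrite linearZ /= Gs.
have HG' : (wi ^+ 2 *: H) *m (w ^+ 2 *: G) = 1%:M.
  by rewrite -scalemxAl -scalemxAr scalerA -exprMn mulrC wwi expr1n scale1r HG.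
have LC' := koszulP (der (Vo:=Vo)) Gs' HG' h2.
have sH' := symH Gs' HG'.
have rG' a b : rep (fun p => gmx g' i p a b) ((w ^+ 2 *: G) a b).
  move=> p Wp; rewrite mxE evM (rG a b p Wp) gg'; last exact: Wi.
  by rewrite mxE expr2 evM (rw p Wp).
have rH' a b : rep (ginv g' i a b) ((wi ^+ 2 *: H) a b).
  move=> p Wp; rewrite mxE evM (rH a b p Wp) /ginv gg'; last exact: Wi.
  rewrite invmxZ ?mxE; last by rewrite unitmxZ ?unitfE ?expf_neq0 ?Om_neq0 ?gmx_unit //; exact: Wi.
  by rewrite expr2 evM (rwi p Wp) -expr2 exprVn.
exists H, (koszul (der (Vo:=Vo)) G H (half_fun Vo)), w, wi; split; split=> //.
- exact: (rep_scal rD rG rH sH).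
- by move=> f F rf; exact: (rep_laplacian rD rG rH sH rf).
- by move=> f f' F F' rf rf'; exact: (rep_carre rD rH rf rf').
- rewrite -(sc_conformal (der_derivations Vo) Gs GH HG h2 wwi LC LC').
  exact: (rep_scal rD rG' rH' sH').
- move=> f F rf; rewrite -(lap_conformal (der_derivations Vo) Gs GH HG h2 wwi LC LC').
  exact: (rep_laplacian rD rG' rH' sH' rf).
- move=> f f' F F' rf rf'; rewrite -carre_conformal.
  exact: (rep_carre rD rH' rf rf').
Qed.

End OneChart.
End GlobalOperators.

(** * Smooth functions and smooth operators on the manifold *)

Section SmoothOnManifold.
Variables (R : realType) (d : nat) (M : manifold R d).
Implicit Types (U W : set M) (f h : M -> R) (g : metric M) (p : M) (i : cidx M).

Lemma chart_dom_open U i : open U -> open (chart i @` (U `&` cdom i)).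
Proof.
by move=> Uo; apply: chart_image_open => [|p []//]; exact: cdom_meet_open.
Qed.

Lemma smooth_on_sub U W f : U `<=` W -> smooth_on W f -> smooth_on U f.
Proof. by move=> UW sf i p Up ip; apply: sf => //; exact: UW. Qed.

Lemma eq_smooth_on U f h : open U -> (forall p, U p -> f p = h p) ->
  smooth_on U f -> smooth_on U h.
Proof.
move=> Uo fh /(smooth_onP _ Uo) sf; apply/(smooth_onP _ Uo) => i.
apply: (@eq_smooth R d _ (f \o cinv i) (h \o cinv i) (chart_dom_open Uo) _ (sf i)) => x [p [Up ip] <-] /=.
by rewrite chartK // fh.
Qed.

Lemma smooth_on_cst U c : open U -> smooth_on U (fun=> c).
Proof.
by move=> Uo; apply/(smooth_onP _ Uo) => i; exact: (smooth_cst (chart_dom_open Uo) c).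
Qed.

Lemma smooth_onD U f h : open U -> smooth_on U f -> smooth_on U h ->
  smooth_on U (fun p => f p + h p).
Proof.
move=> Uo /(smooth_onP _ Uo) sf /(smooth_onP _ Uo) sh; apply/(smooth_onP _ Uo) => i.
exact: (smoothD (chart_dom_open Uo) (sf i) (sh i)).
Qed.

Lemma smooth_onM U f h : open U -> smooth_on U f -> smooth_on U h ->
  smooth_on U (fun p => f p * h p).
Proof.
move=> Uo /(smooth_onP _ Uo) sf /(smooth_onP _ Uo) sh; apply/(smooth_onP _ Uo) => i.
exact: (smoothM (chart_dom_open Uo) (sf i) (sh i)).
Qed.

Lemma smooth_onN U f : open U -> smooth_on U f -> smooth_on U (fun p => - f p).
Proof.
move=> Uo /(smooth_onP _ Uo) sf; apply/(smooth_onP _ Uo) => i.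
exact: (smoothN (chart_dom_open Uo) (sf i)).
Qed.

Lemma smooth_onB U f h : open U -> smooth_on U f -> smooth_on U h ->
  smooth_on U (fun p => f p - h p).
Proof. by move=> Uo sf sh; apply: smooth_onD => //; exact: smooth_onN. Qed.

Lemma smooth_onX U f n : open U -> smooth_on U f -> smooth_on U (fun p => f p ^+ n).
Proof.
move=> Uo sf; elim: n => [|n IH]; first exact: smooth_on_cst.
apply: (eq_smooth_on Uo _ (smooth_onM Uo sf IH)) => p _; by rewrite exprS.
Qed.

Lemma smooth_onV U f : open U -> smooth_on U f -> (forall p, U p -> f p != 0) ->
  smooth_on U (fun p => (f p)^-1).
Proof.
move=> Uo /(smooth_onP _ Uo) sf f0; apply/(smooth_onP _ Uo) => i.
apply: (smoothV (chart_dom_open Uo) (sf i)) => x [p [Up ip] <-] /=.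
by rewrite chartK // f0.
Qed.

Lemma pdM U i a f h p : open U -> U p -> cdom i p -> smooth_on U f -> smooth_on U h ->
  pd i a (fun q => f q * h q) p = f p * pd i a h p + h p * pd i a f p.
Proof.
move=> Uo Up ip sf sh.
have df : differentiable (f \o cinv i) (chart i p) by exact: (sf i p Up ip [::]).
have dh : differentiable (h \o cinv i) (chart i p) by exact: (sh i p Up ip [::]).
by have := partialM a df dh; rewrite /= chartK.
Qed.

Lemma smooth_on_chart U i W f : W `<=` U `&` cdom i -> smooth_on U f ->
  smooth (chart i @` W) (f \o cinv i).
Proof. by move=> WU sf x [p /WU[Up ip] <-]; exact: sf. Qed.

Section ChartIndependence.
Variables (U : set M) (g : metric M).
Hypothesis Uo : open U.

Let indep i p (Up : U p) (ip : cdom i p) :=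
  @chart_invariance R d M (chart_at p) i (U `&` cdom (chart_at p) `&` cdom i)
    (cdom_meet_open i (cdom_meet_open (chart_at p) Uo))
    (fun q '(conj (conj _ Q) _) => Q) (fun q '(conj _ Q) => Q) g p
    (conj (conj Up (mem_chart_at p)) ip).

Let sub i p : U `&` cdom (chart_at p) `&` cdom i `<=` U `&` cdom (chart_at p).
Proof. by move=> q []. Qed.

Lemma scal_chart i p : U p -> cdom i p -> scal g p = chart_scal g i p.
Proof. by move=> Up ip; have [E _ _] := indep Up ip; exact: E. Qed.

Lemma laplacian_chart i p f : smooth_on U f -> U p -> cdom i p ->
  laplacian g f p = chart_laplacian g i f p.
Proof.
move=> sf Up ip; have [_ E _] := indep Up ip.
exact: (E f (smooth_on_chart (@sub i p) sf)).
Qed.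

Lemma carre_chart i p f h : smooth_on U f -> smooth_on U h -> U p -> cdom i p ->
  carre_du_champ g f h p = chart_carre g i f h p.
Proof.
move=> sf sh Up ip; have [_ _ E] := indep Up ip.
exact: (E f h (smooth_on_chart (@sub i p) sf) (smooth_on_chart (@sub i p) sh)).
Qed.

Lemma smooth_on_scal : smooth_on U (scal g).
Proof.
apply/(smooth_onP _ Uo) => i.
have [H [Gam [_ rs _ _]]] := rep_geometry i Uo g.
apply: (@eq_smooth R d _ _ _ (chart_dom_open Uo) _ (rep_smooth rs)) => x [p [Up ip] <-] /=.
by rewrite (chartK ip); exact: esym (@scal_chart i p Up ip).
Qed.

Lemma smooth_on_laplacian f : smooth_on U f -> smooth_on U (laplacian g f).
Proof.
move=> sf; apply/(smooth_onP _ Uo) => i.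
have [H [Gam [_ _ rl _]]] := rep_geometry i Uo g.
have [F rF] := smooth_on_rep i Uo sf.
apply: (@eq_smooth R d _ _ _ (chart_dom_open Uo) _ (rep_smooth (rl f F rF))) => x [p [Up ip] <-] /=.
by rewrite (chartK ip); exact: esym (@laplacian_chart i p f sf Up ip).
Qed.

Lemma smooth_on_carre f h : smooth_on U f -> smooth_on U h ->
  smooth_on U (carre_du_champ g f h).
Proof.
move=> sf sh; apply/(smooth_onP _ Uo) => i.
have [H [Gam [_ _ _ rc]]] := rep_geometry i Uo g.
have [F rF] := smooth_on_rep i Uo sf.
have [F' rF'] := smooth_on_rep i Uo sh.
apply: (@eq_smooth R d _ _ _ (chart_dom_open Uo) _ (rep_smooth (rc f h F F' rF rF'))) => x [p [Up ip] <-] /=.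
by rewrite (chartK ip); exact: esym (@carre_chart i p f h sf sh Up ip).
Qed.

Lemma smooth_on_Jscal : smooth_on U (Jscal g).
Proof. by apply: smooth_onM => //; [exact: smooth_on_scal|exact: smooth_on_cst]. Qed.

Lemma smooth_on_Isq f : smooth_on U f -> smooth_on U (Isq_fun g f).
Proof.
move=> sf; apply: smooth_onB => //; first exact: smooth_on_carre.
apply: smooth_onM => //; first exact: smooth_on_cst.
apply: smooth_onM => //; apply: smooth_onD => //; first exact: smooth_on_laplacian.
by apply: smooth_onM => //; exact: smooth_on_Jscal.
Qed.

End ChartIndependence.

End SmoothOnManifold.

(** * Conformal invariance and perturbation of the squared scale tractor *)

Section IsqCalculus.
Variables (R : realType) (d : nat) (M : manifold R d).
Implicit Types (U W : set M) (f h a : M -> R) (g : metric M) (p : M) (i : cidx M).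

Lemma ev1 (V : set 'rV[R]_d) (Vo : open V) x : ev x (1 : sfun Vo) = 1.
Proof. by []. Qed.

Lemma evX (V : set 'rV[R]_d) (Vo : open V) x (F : sfun Vo) n :
  ev x (F ^+ n) = ev x F ^+ n.
Proof. exact: (rmorphXn (ev x)). Qed.

(** All quantities of [g'] are expressed in the ring by those of [g], with [f'] as [w * F]. The
    derivatives of [w] coming from the squared gradient, the Laplacian and [Jscal] then cancel;
    [1 < d] keeps the denominator of [Jscal] nonzero. *)
Lemma Isq_conformal U g g' Om f f' p : (1 < d)%N -> open U ->
  conformal_to g g' Om -> smooth_on U f -> (forall q, U q -> f' q = Om q * f q) ->
  U p -> Isq_fun g' f' p = Isq_fun g f p.
Proof.
move=> d1 Uo gg' sf ff' Up; pose i := chart_at p.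
have ip : cdom i p by exact: mem_chart_at.
have Om0 : Om p != 0 by case: gg' => _ /(_ p)/gt_eqF -> _.
have [H [Gam [w [wi [[sH rw] [rwi wwi] [rs rl rc] [rs' rl' rc']]]]]] :=
  rep_conformal i Uo gg'.
have [F rF] := smooth_on_rep i Uo sf.
have rF' : @rep _ _ _ _ _ (cdom_meet_open i Uo) (@subIsetr _ U (cdom i)) f' (w * F).
  move=> q [Uq iq]; rewrite evM (rF q (conj Uq iq)) ff' //.
  by rewrite (rw q (conj Uq iq)).
have Wp : (U `&` cdom i) p by [].
set Vo := chart_image_open _ _ in w wi wwi rw rwi rs rl rc rs' rl' rc' F rF rF'.
have dD := der_derivations Vo; pose D := @der R d _ Vo.
pose x := chart i p.
have Es : scal g p = ev x (sc D H Gam) by rewrite (rs p Wp).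
have El : laplacian g f p = ev x (lap D H Gam F) by rewrite (rl f F rF p Wp).
have Ec : gradsq g f p = ev x (carre D H F F) by rewrite (rc f f F F rF rF p Wp).
have Es' := rs' p Wp.
have El' := rl' f' (w * F) rF' p Wp.
have Ec' := rc' f' f' (w * F) (w * F) rF' rF' p Wp.
have Ew : ev x w = Om p := rw p Wp.
have Ewi : ev x wi = (Om p)^-1 := rwi p Wp.
have EF : f p = ev x F by rewrite (rF p Wp).
rewrite /Isq_fun /Jscal Es El Ec EF.
rewrite -[scal g' p]/(chart_scal g' i p) -[laplacian g' f' p]/(chart_laplacian g' i f' p).
rewrite -[gradsq g' f' p]/(chart_carre g' i f' f' p) -Es' -El' -Ec' ff' // EF.
rewrite (lapM Gam dD sH) (carreMl _ dD) !(carreMr dD sH) (carreC D sH F w).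
rewrite -/x -/D {Es El Ec Es' El' Ec' rs rl rc rs' rl' rc'}.
move: (sc D H Gam) (lap D H Gam F) (lap D H Gam w) => S L Lw.
move: (carre D H F F) (carre D H w F) (carre D H w w) => C Cw Cww.
rewrite !expr2 !(evM, evD, evN, ev_nat, ev1) Ew Ewi.
have d0 : d%:R != 0 :> R by rewrite pnatr_eq0; case: (d) d1.
have d10 : d%:R - 1 != 0 :> R.
  by rewrite subr_eq0 pnatr_eq1; case: (d) d1 => [|[|]].
by field; rewrite d0 Om0 d10.
Qed.

(** This is alpha_k at [k = n.+1]. The cross term of the squared gradient gives [2 (n+2)], and [h]
    times the Laplacian of [h ^+ n.+2 * a] takes away [(2/d) (n+2) (n+1)]. *)
Definition indicial n : R := 2 * n.+2%:R * (d%:R - n.+1%:R) / d%:R.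

Lemma Isq_perturb U g h a n : (0 < d)%N -> open U ->
  smooth_on U h -> smooth_on U a ->
  exists2 X, smooth_on U X & forall p, U p ->
    Isq_fun g (fun q => h q + h q ^+ n.+2 * a q) p =
    Isq_fun g h p + h p ^+ n.+1 * (indicial n * a p * gradsq g h p + h p * X p).
Proof.
move=> d0 Uo sh sa.
pose e : R := 2 / d%:R; pose m : R := n.+2%:R.
pose J := Jscal g; pose c := carre_du_champ g; pose L := laplacian g.
(* The powers of [h] are divided out by hand, because [h] may vanish; the result is polynomial in
   smooth quantities, hence smooth. *)
pose X p := 2 * c h a p + h p ^+ n * (h p * (h p * c a a p) +
    2 * m * a p * (h p * c h a p) + m * m * (a p * (a p * c h h p))) -
  e * (a p * (L h p + J p * h p) + h p * L a p + m * (a p * L h p)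
       + 2 * m * c h a p + h p * (J p * a p) +
    a p * (h p ^+ n * (h p * (h p * L a p) + m * (a p * (h p * L h p))
       + m * n.+1%:R * (a p * c h h p) + 2 * m * (h p * c h a p))
      + J p * (h p ^+ n.+2 * a p))).
exists X.
  have sC u v : smooth_on U u -> smooth_on U v -> smooth_on U (c u v).
    by move=> su sv; exact: smooth_on_carre.
  have sL u : smooth_on U u -> smooth_on U (L u) by move=> su; exact: smooth_on_laplacian.
  have sJ : smooth_on U J by exact: smooth_on_Jscal.
  do !(first [exact: sh | exact: sa | exact: sJ | exact: (smooth_onX _ Uo sh)
    | apply: sC | apply: sL
    | apply: (smooth_onB Uo) | apply: (smooth_onD Uo) | apply: (smooth_onM Uo)
    | exact: (smooth_on_cst _ Uo)]).
move=> p Up; pose i := chart_at p.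
have ip : cdom i p by exact: mem_chart_at.
have Wp : (U `&` cdom i) p by [].
have [H [Gam [sH _ rl rc]]] := rep_geometry i Uo g.
have [Fh rh] := smooth_on_rep i Uo sh.
have [Fa ra] := smooth_on_rep i Uo sa.
set Vo := chart_image_open _ _ in rl rc Fh rh Fa ra.
have rX (F : sfun Vo) u k : @rep _ _ _ i _ (cdom_meet_open i Uo) (@subIsetr _ U (cdom i)) u F ->
    @rep _ _ _ i _ (cdom_meet_open i Uo) (@subIsetr _ U (cdom i)) (fun q => u q ^+ k) (F ^+ k).
  by move=> ru q Wq; rewrite evX (ru q Wq).
have rw := repD rh (repM (rX _ _ n.+2 rh) ra).
have dD := der_derivations Vo; pose D := @der R d _ Vo; pose x := chart i p.
have El := rl _ _ rw p Wp; have Ec := rc _ _ _ _ rw rw p Wp.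
rewrite (lap_perturb _ dD sH) in El; rewrite (carre_perturb dD sH) in Ec.
have Elh : L h p = ev x (lap D H Gam Fh) by rewrite (rl h Fh rh p Wp).
have Ela : L a p = ev x (lap D H Gam Fa) by rewrite (rl a Fa ra p Wp).
have Ehh : c h h p = ev x (carre D H Fh Fh) by rewrite (rc h h Fh Fh rh rh p Wp).
have Eha : c h a p = ev x (carre D H Fh Fa) by rewrite (rc h a Fh Fa rh ra p Wp).
have Eaa : c a a p = ev x (carre D H Fa Fa) by rewrite (rc a a Fa Fa ra ra p Wp).
have Eh : h p = ev x Fh by rewrite (rh p Wp).
have Ea : a p = ev x Fa by rewrite (ra p Wp).
rewrite /Isq_fun /X.
set hw := (fun q : M => _); rewrite -[laplacian g hw p]/(chart_laplacian g i hw p).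
rewrite -[gradsq g hw p]/(chart_carre g i hw hw p) -[gradsq g h p]/(c h h p).
rewrite -El -Ec -/(L h p) -/J {}/hw Elh Ela Ehh Eha Eaa Eh Ea.
rewrite -/x -/D {Elh Ela Ehh Eha Eaa El Ec rl rc}.
move: (lap D H Gam Fh) (lap D H Gam Fa) => Lh La.
move: (carre D H Fh Fh) (carre D H Fh Fa) (carre D H Fa Fa) => C Cha Ca.
rewrite !expr2 !natrM !exprS -/m.
(* Numerals of the ring become atoms with known values, so that after evaluation [field] works over
   [R]. *)
have -> : n.+2%:R = n%:R + 1 + 1 :> sfun Vo by rewrite !natr1.
have -> : n.+1%:R = n%:R + 1 :> sfun Vo by rewrite !natr1.
have Em : m = n%:R + 1 + 1 by rewrite /m !natr1.
have En1 : n.+1%:R = n%:R + 1 :> R by rewrite natr1.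
have := ev_nat Vo x n; move: (n%:R : sfun Vo) => k Ek.
have ev2 : ev x (2%:R : sfun Vo) = 2%:R by exact: ev_nat.
move: (2%:R : sfun Vo) ev2 => two ev2.
rewrite !(evM, evD, evN, ev1, evX) Ek ev2 /indicial -/m Em En1 /e.
set P := ev x Fh ^+ n.
have d0' : d%:R != 0 :> R by rewrite pnatr_eq0; case: (d) d0.
by field.
Qed.

(** The hypothesis on [N] makes the squared gradient 1 up to a multiple of [h], which goes into the
    remainder. *)
Lemma Isq_perturb1 U g h a N n : (0 < d)%N -> open U ->
  smooth_on U h -> smooth_on U a -> smooth_on U N ->
  (forall p, U p -> Isq_fun g h p = 1 + h p * N p) ->
  exists2 X, smooth_on U X & forall p, U p ->
    Isq_fun g (fun q => h q + h q ^+ n.+2 * a q) p =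
    Isq_fun g h p + h p ^+ n.+1 * (indicial n * a p + h p * X p).
Proof.
move=> d0 Uo sh sa sN IN; have [X sX EX] := Isq_perturb g n d0 Uo sh sa.
exists (fun p => X p + indicial n * (a p *
    (N p + 2 / d%:R * (laplacian g h p + Jscal g p * h p)))).
  have sL : smooth_on U (laplacian g h) by exact: smooth_on_laplacian.
  have sJ : smooth_on U (Jscal g) by exact: smooth_on_Jscal.
  do !(first [exact: sh | exact: sa | exact: sJ | exact: sL | exact: sX | exact: sN
    | apply: (smooth_onD Uo) | apply: (smooth_onM Uo) | exact: (smooth_on_cst _ Uo)]).
move=> p Up; rewrite EX //; congr (_ + _ * _).
have -> : gradsq g h p = 1 + h p * N p + 2 / d%:R * (h p * (laplacian g h p + Jscal g p * h p)).
  by rewrite -IN // /Isq_fun subrK.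
ring.
Qed.

End IsqCalculus.

(** * Division of smooth functions by a defining function *)

Section Hadamard.
Variables (R : realType) (d : nat).
Implicit Types (f h rho : 'rV[R]_d -> R) (x u p : 'rV[R]_d).

Lemma diff_line f x u (s : R) : differentiable f (x + s *: u) ->
  derivable (fun t : R => f (x + t *: u)) s 1.
Proof. by move=> /is_derive_line[]. Qed.

(** With slope at least [c], [h] climbs from [h x] to 0 within the parameter [- h x / c];
    monotonicity keeps its absolute value below the initial one on the way. *)
Lemma line_zero h x u (c : R) : 0 < c -> h x <= 0 ->
  (forall s, 0 <= s <= - h x / c ->
     differentiable h (x + s *: u) /\ c <= 'D_u h (x + s *: u)) ->
  exists t, [/\ 0 <= t <= - h x / c, h (x + t *: u) = 0 &
    forall s, 0 <= s <= t -> `|h (x + s *: u)| <= `|h x|].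
Proof.
move=> c0; rewrite le_eqVlt => /predU1P[hx0 _|hx0 dh].
  exists 0; rewrite hx0 oppr0 mul0r lexx scale0r addr0; split=> // s s0.
  have -> : s = 0 by apply/eqP; rewrite eq_le andbC.
  by rewrite scale0r addr0 hx0.
set t1 := - h x / c; have t10 : 0 < t1 by rewrite divr_gt0 // oppr_gt0.
have mono s t : 0 <= s -> s <= t -> t <= t1 -> h (x + s *: u) <= h (x + t *: u).
  move=> s0; rewrite le_eqVlt => /predU1P[-> //|st] tt1.
  have ts0 : 0 < t - s by rewrite subr_gt0.
  have dd r : 0 <= r <= t - s -> differentiable h (x + s *: u + r *: u).
    move=> /andP[r0 rt]; rewrite -addrA -scalerDl; apply: (dh _ _).1.
    by rewrite addr_ge0 //= (le_trans _ tt1) // addrC -lerBrDr.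
  have [r /andP[r0 rt]] := line_MVT ts0 dd.
  rewrite -!addrA -!scalerDl subrKC => E.
  rewrite -subr_ge0 E mulr_ge0 ?ltW // (lt_le_trans c0) //; apply: (dh _ _).2.
  by rewrite addr_ge0 ?(ltW r0) //= (le_trans _ tt1) // addrC -lerBrDr ltW.
have dd0 s : 0 <= s <= t1 -> differentiable h (x + s *: u) by move=> /dh[].
have h1 : 0 <= h (x + t1 *: u).
  have [r /andP[r0 rt] E] := line_MVT t10 dd0.
  have /dh[_ cD] : 0 <= r <= t1 by rewrite !ltW.
  have : t1 * c <= h (x + t1 *: u) - h x by rewrite E ler_pM2l.
  by rewrite /t1 divfK ?gt_eqF // lerBrDr addNr.
have [t] : exists2 t, t \in `[0, t1] & h (x + t *: u) = 0.
  apply: (@IVT R (fun t => h (x + t *: u))); first exact: ltW.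
    apply: derivable_within_continuous => s; rewrite in_itv/= => /dd0.
    exact: diff_line.
  by rewrite scale0r addr0 ge_min le_max h1 (ltW hx0) orbT.
rewrite in_itv/= => /andP[t0 tt1] ht; exists t; split=> [|//|s /andP[s0 st]].
  by rewrite t0.
have hs : h (x + s *: u) <= 0 by rewrite -ht mono.
have : h x <= h (x + s *: u).
  by have := mono 0 s (lexx 0) s0 (le_trans st tt1); rewrite scale0r addr0.
by rewrite !ler0_norm ?lerN2 // ltW.
Qed.

(** A substitute for straightening the zero set: a point near the zero [p] is joined to a zero by a
    segment parallel to the [n]-th axis, of length controlled by the value of [h]. By continuity the
    slope stays above [c], half the absolute slope at [p]. *)
Lemma normal_zero V h (n : 'I_d) p : open V -> smooth V h -> V p -> h p = 0 ->
  partial n h p != 0 ->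
  exists2 c : R, 0 < c & forall e, 0 < e -> exists2 r, 0 < r &
    forall x, `|x - p| < r -> exists th t : R, let u := th *: (delta_mx 0 n : 'rV[R]_d) in
      [/\ `|th| = 1, 0 <= t <= `|h x| / c, h (x + t *: u) = 0 &
       forall s, 0 <= s <= t -> `|x + s *: u - p| < e /\ `|h (x + s *: u)| <= `|h x|].
Proof.
move=> Vo sh Vp hp D0; set D := partial n h p; set en : 'rV[R]_d := delta_mx 0 n.
pose c := `|D| / 2; have c0 : 0 < c by rewrite divr_gt0 ?normr_gt0.
exists c => // e e0.
have Dc : {for p, continuous (partial n h)}.
  by apply/differentiable_continuous/(smooth_diff (smooth_partial n sh)).
have hc : {for p, continuous h}.
  by apply/differentiable_continuous/(smooth_diff sh).
have Vn : \forall y \near p, V y by apply: open_nbhs_nbhs.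
have /cvgrPdist_lt/(_ _ c0) Cn := Dc.
have [e1 /= e10 H1] := (nbhs_normP p _).1 (filterI Vn Cn).
pose e2 := Num.min e e1; have e20 : 0 < e2 by rewrite lt_min e0.
pose N := `|en| + 1; have N0 : 0 < N by rewrite ltr_wpDl.
have b0 : 0 < c * (e2 / 2 / N) by rewrite mulr_gt0 // !divr_gt0.
have /cvgrPdist_lt/(_ _ b0) Hn := hc.
have [r1 /= r10 H2] := (nbhs_normP p _).1 Hn.
exists (Num.min r1 (e2 / 2)); first by rewrite lt_min r10 divr_gt0.
move=> x; rewrite lt_min => /andP[xr1 xe2].
have hx : `|h x| / c < e2 / 2 / N.
  rewrite ltr_pdivrMr // mulrC -normrN -sub0r -hp; apply: H2.
  by rewrite /= distrC.
(* [eta] makes [k] nonpositive at [x], and [Num.sg D] orients the segment so that [k] increases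
   along it. *)
pose eta : R := if h x <= 0 then 1 else -1.
have eta1 : `|eta| = 1 by rewrite /eta; case: ifP; rewrite ?normrN normr1.
have etaE : eta * eta = 1.
  by rewrite /eta; case: ifP; rewrite ?mulrNN mulr1.
pose th := eta * Num.sg D; pose u := th *: en; pose k y := eta * h y.
have th1 : `|th| = 1 by rewrite normrM eta1 mul1r normr_sg D0.
have kx : k x <= 0.
  rewrite /k /eta; case: ifPn; rewrite ?mul1r // -ltNge => /ltW.
  by rewrite mulN1r oppr_le0.
have kn y : `|k y| = `|h y| by rewrite normrM eta1 mul1r.
have near s : 0 <= s <= `|h x| / c -> `|x + s *: u - p| < e2.
  move=> /andP[s0 sc]; rewrite addrAC (le_lt_trans (ler_normD _ _)) //.
  rewrite [ltRHS]splitr ltr_leD // /u normrZ [X in _ * X]normrZ th1 mul1r ger0_norm //.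
  apply: (@le_trans _ _ (e2 / 2 / N * N)); last by rewrite divfK // gt_eqF.
  by rewrite ler_pM // ?(le_trans sc (ltW hx)) // /N lerDl.
have [t [tc kt kb]] : exists t, [/\ 0 <= t <= - k x / c, k (x + t *: u) = 0 &
    forall s, 0 <= s <= t -> `|k (x + s *: u)| <= `|k x|].
  apply: line_zero => // s; rewrite -(ler0_norm kx) kn => /near xs.
  have xs1 : `|x + s *: u - p| < e1 by rewrite (lt_le_trans xs) // ge_min lexx orbT.
  rewrite distrC in xs1; have [Vy Dy] := H1 _ xs1.
  have dh := smooth_diff sh Vy.
  have dk : differentiable k (x + s *: u) by apply: differentiableM.
  split; first exact: dk.
  have -> : 'D_u k (x + s *: u) = Num.sg D * partial n h (x + s *: u).
    rewrite [LHS]deriveMl; last exact: diff_derivable.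
    have -> : 'D_u h (x + s *: u) = th * partial n h (x + s *: u).
      by rewrite (deriveE _ dh) [LHS]linearZ /partial (deriveE _ dh).
    by rewrite /th !mulrA etaE mul1r.
  set dy := partial n h (x + s *: u) in Dy *; have A : Num.sg D * D = `|D| by rewrite -normrEsg.
  have B : Num.sg D * (D - dy) <= `|D - dy|.
    by rewrite (le_trans (ler_norm _)) // normrM normr_sg D0 mul1r.
  rewrite mulrBr A in B; have := le_lt_trans B Dy; rewrite /c -/D; lra.
exists th, t; split=> //.
- by rewrite -(ler0_norm kx) kn in tc.
- by have := kt; rewrite /k => /eqP; rewrite mulf_eq0 -normr_eq0 eta1 oner_eq0 => /eqP.
- move=> s /andP[s0 st]; split; last first.
    by rewrite -!kn; apply: kb; rewrite s0.
  have /near xs : 0 <= s <= `|h x| / c.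
    rewrite s0 (le_trans st) //; rewrite -(ler0_norm kx) kn in tc.
    by case/andP: tc.
  by rewrite (lt_le_trans xs) // ge_min lexx.
Qed.

End Hadamard.

(** * Functions vanishing to finite order on a zero set *)

Section Flatness.
Variables (R : realType) (d : nat) (V : set 'rV[R]_d) (h : 'rV[R]_d -> R) (n : 'I_d).
Hypotheses (Vo : open V) (sh : smooth V h).
Hypothesis hn0 : forall x, V x -> partial n h x != 0.
Implicit Types (f rho : 'rV[R]_d -> R) (x u p : 'rV[R]_d).

(* Vanishing to order m along the zero set of h in V. *)
Fixpoint flat m rho : Prop :=
  if m is k.+1 then
    (forall x, V x -> h x = 0 -> rho x = 0) /\ forall a, flat k (partial a rho)
  else True.

Lemma eq_flat m f rho : (forall x, V x -> f x = rho x) -> flat m f -> flat m rho.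
Proof.
elim: m f rho => [//|m IH] f rho E [f0 fD]; split=> [x Vx hx|a].
  by rewrite -E // f0.
by apply: IH (fD a) => x Vx; exact: (eq_partial a Vo E Vx).
Qed.

Lemma flatW m f : flat m.+1 f -> flat m f.
Proof. by elim: m f => [//|m IH] f [f0 fD]; split=> // a; exact: IH. Qed.

Lemma flat_leq m k f : (m <= k)%N -> flat k f -> flat m f.
Proof.
by move=> /subnK <-; elim: (k - m)%N => [//|l IH] fl; apply: IH; exact: flatW fl.
Qed.

Lemma flatD m f rho : smooth V f -> smooth V rho -> flat m f -> flat m rho ->
  flat m (fun x => f x + rho x).
Proof.
elim: m f rho => [//|m IH] f rho sf sr [f0 fD] [r0 rD]; split=> [x Vx hx|a].
  by rewrite f0 // r0 // addr0.
apply: eq_flat (IH _ _ (smooth_partial a sf) (smooth_partial a sr) (fD a) (rD a)).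
by move=> x Vx; exact: esym (partialD a (smooth_diff sf Vx) (smooth_diff sr Vx)).
Qed.

Lemma flatM m f rho : smooth V f -> smooth V rho -> flat m rho ->
  flat m (fun x => f x * rho x).
Proof.
elim: m f rho => [//|m IH] f rho sf sr fr; split=> [x Vx hx|a].
  by rewrite fr.1 // mulr0.
have [sfa sra] := (smooth_partial a sf, smooth_partial a sr).
have A := IH _ _ sf sra (fr.2 a); have B := IH _ _ sfa sr (flatW fr).
apply: eq_flat (flatD (smoothM Vo sf sra) (smoothM Vo sfa sr) A B) => x Vx.
rewrite [RHS](partialM a (smooth_diff sf Vx) (smooth_diff sr Vx)).
by congr (_ + _); exact: mulrC.
Qed.

Lemma flat_hM m rho : smooth V rho -> flat m rho -> flat m.+1 (fun x => h x * rho x).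
Proof.
elim: m rho => [|m IH] rho sr fr.
  by split=> // x Vx ->; rewrite mul0r.
split=> [x Vx ->|a]; first by rewrite mul0r.
have [sha sra] := (smooth_partial a sh, smooth_partial a sr).
have A := IH _ sra (fr.2 a); have B := flatM sha sr fr.
apply: eq_flat (flatD (smoothM Vo sh sra) (smoothM Vo sha sr) A B) => x Vx.
rewrite [RHS](partialM a (smooth_diff sh Vx) (smooth_diff sr Vx)).
by congr (_ + _); exact: mulrC.
Qed.

Lemma smooth_exp f k : smooth V f -> smooth V (fun x => f x ^+ k).
Proof.
move=> sf; elim: k => [|k IH]; first exact: (smooth_cst Vo).
by apply: (eq_smooth Vo _ (smoothM Vo sf IH)) => x Vx; rewrite exprS.
Qed.

Lemma flat_exp m f : smooth V f -> flat m (fun x => h x ^+ m * f x).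
Proof.
move=> sf; elim: m => [//|m IH].
have s1 := smoothM Vo (smooth_exp m sh) sf.
apply: eq_flat (flat_hM s1 IH) => x Vx.
by rewrite exprS mulrA.
Qed.

(** Induction on the order: the derivative in direction [n] obeys the bound of order [m], and the
    mean value theorem along the segment of [normal_zero], of length at most [|h x| / c], gains one
    factor [|h x|]. The bound applies along the segment since [|h|] does not exceed [|h x|]
    there. *)
Lemma flat_bound m rho p : smooth V rho -> flat m rho -> V p -> h p = 0 ->
  exists (r C : R), [/\ 0 < r, 0 <= C &
    forall x, `|x - p| < r -> V x /\ `|rho x| <= C * `|h x| ^+ m].
Proof.
move=> + + Vp hp; elim: m rho => [|m IH] rho sr fr.
  have hc : {for p, continuous rho}.
    by apply/differentiable_continuous/(smooth_diff sr).
  have Vn : \forall y \near p, V y by apply: open_nbhs_nbhs.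
  have /cvgrPdist_lt/(_ _ ltr01) Cn := hc.
  have [r /= r0 H] := (nbhs_normP p _).1 (filterI Vn Cn).
  exists r, (`|rho p| + 1); split=> //; first by rewrite addr_ge0.
  move=> x; rewrite distrC => /H[Vx xr]; split=> //.
  rewrite expr0 mulr1 addrC -lerBlDr (le_trans (lerB_dist _ _)) // distrC.
  exact: ltW.
have [r1 [C [r10 C0 H1]]] := IH _ (smooth_partial n sr) (fr.2 n).
have [c c0 /(_ _ r10)[r r0 H]] := normal_zero Vo sh Vp hp (hn0 Vp).
exists (Num.min r r1), (C / c); split; rewrite ?lt_min ?r0 //; first by rewrite divr_ge0 // ltW.
move=> x; rewrite lt_min => /andP[/H[th [t [th1 /andP[t0 tc] hz near]]] xr1].
have [Vx _] := H1 _ xr1; split=> //.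
set u := th *: _ in hz near.
have near' s : 0 <= s <= t -> [/\ V (x + s *: u), `|h (x + s *: u)| <= `|h x| &
   `|partial n rho (x + s *: u)| <= C * `|h x| ^+ m].
  move=> /near[xs hs]; have [Vs bs] := H1 _ xs; split=> //.
  by rewrite (le_trans bs) // ler_wpM2l // lerXn2r // nnegrE.
have rz : rho (x + t *: u) = 0.
  by apply: fr.1 => //; have [] := near' t; rewrite ?t0 ?lexx.
move: t0; rewrite le_eqVlt => /predU1P[t0|t0].
  move: rz; rewrite -t0 scale0r addr0 => ->; rewrite normr0.
  by rewrite mulr_ge0 ?exprn_ge0 // divr_ge0 // ltW.
have [s /andP[s0 st] E] := line_MVT t0 (fun s st =>
  let: And3 Vs _ _ := near' s st in smooth_diff sr Vs).
have [Vs _ bs] : [/\ V (x + s *: u), `|h (x + s *: u)| <= `|h x| &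
   `|partial n rho (x + s *: u)| <= C * `|h x| ^+ m] by apply: near'; rewrite !ltW.
have Du : 'D_u rho (x + s *: u) = th * partial n rho (x + s *: u).
  have dr := smooth_diff sr Vs.
  by rewrite (deriveE _ dr) [LHS]linearZ /partial (deriveE _ dr).
move: E; rewrite rz sub0r Du => E.
rewrite -normrN E !normrM th1 mul1r (gtr0_norm t0).
rewrite [leRHS](_ : _ = `|h x| / c * (C * `|h x| ^+ m)); last by rewrite exprS; ring.
by rewrite ler_pM // ltW.
Qed.

(** Along the direction [v] with ['D_v h p = 0], the bound of [|f|] by a multiple of [|h|] carries
    over to difference quotients, so ['D_v f p = 0]. No curve inside the zero set is constructed. *)
Lemma lagrange_multiplier f p a : smooth V f -> (forall x, V x -> h x = 0 -> f x = 0) ->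
  V p -> h p = 0 -> partial n h p * partial a f p = partial a h p * partial n f p.
Proof.
move=> sf f0 Vp hp.
have [r [C [r0 C0 H]]] : exists (r C : R), [/\ 0 < r, 0 <= C &
    forall x, `|x - p| < r -> V x /\ `|f x| <= C * `|h x| ^+ 1].
  exact: flat_bound.
have [df dh] := (smooth_diff sf Vp, smooth_diff sh Vp).
pose v : 'rV[R]_d := partial n h p *: delta_mx 0 a - partial a h p *: delta_mx 0 n.
have dhv : 'D_v h p = 0.
  rewrite (deriveE _ dh) /v linearB !linearZ /= -!(deriveE _ dh) -!/(partial _ _ _).
  by rewrite scalerN; apply/eqP; rewrite subr_eq0; apply/eqP; exact: mulrC.
have dfv : 'D_v f p = partial n h p * partial a f p - partial a h p * partial n f p.
  rewrite (deriveE _ df) /v linearB !linearZ /= -!(deriveE _ df).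
  by rewrite scalerN.
apply/eqP; rewrite -subr_eq0 -dfv -normr_eq0; apply/negPn/negP => D0.
set D := `| _ | in D0; have Dpos : 0 < D by rewrite lt_neqAle eq_sym D0 normr_ge0.
pose q k (s : R) : R := s^-1 * (k (s *: v + p) - k p).
have cq k : differentiable k p -> q k @ 0^' --> 'D_v k p.
  by move=> /(@diff_derivable _ _ _ _ _ v).
have D2 : 0 < D / 2 by rewrite divr_gt0.
have E0 : 0 < D / 2 / (C + 1) by rewrite divr_gt0 // ltr_wpDl.
have N0 : 0 < r / (`|v| + 1) by rewrite divr_gt0 // ltr_wpDl.
have /cvgrPdist_lt/(_ _ D2) Cf := cq f df.
have /cvgrPdist_lt/(_ _ E0) Ch := cq h dh.
have Cn : \forall s \near (0 : R)^', `|s| < r / (`|v| + 1) by exact: dnbhs0_lt.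
have FF : ProperFilter (0 : R)^' by exact: Proper_dnbhs_numFieldType.
have FI := @filterI _ _ (@filter_filter _ _ FF).
have [s [Hf [Hh Hn]]] := @filter_ex _ _ FF _ (FI _ _ Cf (FI _ _ Ch Cn)).
move: Hf Hh Hn => /= Hf Hh Hn.
have [|_ Hb] := H (s *: v + p).
  rewrite addrK normrZ (le_lt_trans (ler_wpM2l _ (_ : `|v| <= `|v| + 1))) ?lerDl //.
  by rewrite -ltr_pdivlMr // ltr_wpDl.
have qb : `|q f s| <= C * `|q h s|.
  rewrite /q (f0 p Vp hp) hp !subr0 !normrM mulrCA.
  by rewrite ler_wpM2l // -[`|h _|]expr1.
rewrite dhv sub0r normrN in Hh.
have : D < D.
  rewrite {1}/D -[X in `|X|](subrK (q f s)) (le_lt_trans (ler_normD _ _)) //.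
  rewrite [ltRHS]splitr ltr_leD // (le_trans qb) //.
  apply: (@le_trans _ _ ((C + 1) * (D / 2 / (C + 1)))).
    by rewrite ler_pM // ?(ltW Hh) // lerDl.
  by rewrite mulrC divfK // gt_eqF // ltr_wpDl.
by rewrite ltxx.
Qed.

(* The tangential derivatives are recovered from the normal one by the multiplier
   rule above. *)
Lemma flat_of_normal m rho : smooth V rho -> (forall x, V x -> h x = 0 -> rho x = 0) ->
  flat m (partial n rho) -> flat m.+1 rho.
Proof.
elim: m rho => [|m IH] rho sr r0 fr; first by split; [exact: r0|].
split=> [|a]; first exact: r0.
have sa := smooth_partial a sr; have sn := smooth_partial n sr.
apply: IH => [|x Vx hx|]; first exact: sa.
  have := lagrange_multiplier a sr r0 Vx hx; rewrite (fr.1 x Vx hx) mulr0 => /eqP.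
  by rewrite mulf_eq0 (negbTE (hn0 Vx)) => /eqP.
apply: eq_flat (fr.2 a) => x Vx; exact: (partialC a n Vo sr Vx).
Qed.

(* Successive integration by parts along the n-th direction: psi is divided by
   partial n h and integrated against h ^+ m, with h as new variable. *)
Lemma taylor f m : smooth V f -> (forall x, V x -> h x = 0 -> f x = 0) ->
  exists rho t, [/\ smooth V rho, smooth V t,
    forall x, V x -> f x = rho x + h x * t x & flat m.+1 rho].
Proof.
move=> sf f0.
have shn := smooth_partial n sh.
have skap : smooth V (fun x => (partial n h x)^-1) by exact: smoothV.
suff [rho [t [psi [sr st sp [E r0 Dr]]]]] : exists rho t psi,
   [/\ smooth V rho, smooth V t, smooth V psi &
   [/\ forall x, V x -> f x = rho x + h x * t x,
       forall x, V x -> h x = 0 -> rho x = 0 &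
       forall x, V x -> partial n rho x = h x ^+ m * psi x]].
  exists rho, t; split=> //; apply: flat_of_normal => //.
  by apply: eq_flat (flat_exp m sp) => x Vx; rewrite Dr.
elim: m => [|m [rho [t [psi [sr st sp [E r0 Dr]]]]]].
  exists f, (fun=> 0), (partial n f); split=> //.
  - exact: smooth_cst.
  - exact: smooth_partial.
  - split=> // x Vx; first by rewrite mulr0 addr0.
    by rewrite expr0 mul1r.
pose chi x := (partial n h x)^-1 * psi x * (m.+1%:R)^-1.
have schi : smooth V chi.
  by apply: smoothM => //; [apply: smoothM|apply: smooth_cst].
have shm : smooth V (fun x => h x ^+ m) by exact: smooth_exp.
have shm1 : smooth V (fun x => h x ^+ m.+1) by exact: smooth_exp.
have sprod : smooth V (fun x => h x ^+ m.+1 * chi x) by exact: smoothM.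
exists (fun x => rho x + - (h x ^+ m.+1 * chi x)), (fun x => t x + h x ^+ m * chi x).
exists (fun x => - partial n chi x); split.
- by apply: smoothB.
- by apply: smoothD => //; apply: smoothM.
- by apply: smoothN => //; apply: smooth_partial.
have Dpow k x : V x -> partial n (fun x => h x ^+ k.+1) x =
    k.+1%:R * h x ^+ k * partial n h x.
  move=> Vx; have := @deriveX _ _ h k.+1 x (delta_mx 0 n)
    (smooth_derivable (v := delta_mx 0 n) sh Vx).
  by rewrite exprfctE.
split=> x Vx.
- by rewrite E // exprS; ring.
- by move=> hx; rewrite r0 // hx expr0n mul0r oppr0 addr0.
have dchi := smooth_diff schi Vx; have dpw := smooth_diff shm1 Vx.
have dpr := smooth_diff sprod Vx.
have dN : differentiable (fun x => - (h x ^+ m.+1 * chi x)) x.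
  by apply: differentiableN.
rewrite (partialD n (smooth_diff sr Vx) dN) Dr //.
have -> : partial n (fun x => - (h x ^+ m.+1 * chi x)) x =
    - partial n (fun x => h x ^+ m.+1 * chi x) x.
  exact: (deriveN (diff_derivable dpr)).
rewrite (partialM n dpw dchi) Dpow // /chi exprS.
have h0 := hn0 Vx; have m0 : m.+1%:R != 0 :> R by rewrite pnatr_eq0.
by field; rewrite h0 andbT addrC natr1.
Qed.

End Flatness.

Section QuadraticDecay.
Variables (R : realType) (d : nat).
Implicit Types (f h : 'rV[R]_d -> R) (p v y : 'rV[R]_d).

Lemma diff_quadratic f p (r C : R) : 0 < r -> 0 <= C ->
  (forall y, `|y - p| < r -> `|f y| <= C * `|y - p| ^+ 2) ->
  differentiable f p /\ forall v, 'D_v f p = 0.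
Proof.
move=> r0 C0 H.
have fp : f p = 0.
  apply/eqP; rewrite -normr_eq0 eq_le normr_ge0 andbT.
  by have := H p; rewrite subrr normr0 expr0n mulr0; apply.
have E : f \o shift p = cst (f p) + (\0 : 'rV[R]_d -> R) +o_ (0 : 'rV[R]_d) id.
  apply/eqaddoP => e e0.
  have k0 : 0 < Num.min r (e / (C + 1)) by rewrite lt_min r0 divr_gt0 // ltr_wpDl.
  apply/(@nbhs_normP R 'rV[R]_d 0); exists (Num.min r (e / (C + 1))) => //= y.
  rewrite /ball_ /= ?add0r ?normrN lt_min => /andP[yr ye].
  rewrite !fctE /= fp /shift/= addr0 subr0.
  have := H (y + p); rewrite addrK => /(_ yr) Hy; apply: (le_trans Hy).
  rewrite expr2 mulrA ler_wpM2r //.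
  apply: (@le_trans _ _ ((C + 1) * `|y|)); first by rewrite ler_wpM2r // lerDl.
  have C1 : 0 < C + 1 by rewrite ltr_wpDl.
  by rewrite mulrC -ler_pdivlMr // ltW.
have c0 : continuous (\0 : 'rV[R]_d -> R) by exact: (@cst_continuous _ _ (0 : R)).
have dE : 'd f p = (\0 : 'rV[R]_d -> R) :> ('rV[R]_d -> R).
  exact: (@diff_unique _ _ _ f \0 p c0 E).
have df : differentiable f p.
  by apply/diff_locallyP; rewrite dE; split.
by split=> // v; rewrite (deriveE _ df) dE.
Qed.

Lemma diff_lipschitz h p : differentiable h p ->
  exists r L : R, [/\ 0 < r, 0 < L & forall y, `|y - p| < r -> `|h y - h p| <= L * `|y - p|].
Proof.
move=> dh; have cd := diff_continuous dh.
have [k k0 Hk] := linear_lipschitz cd.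
have := diff_locally dh; move=> /eqaddoP/(_ 1 ltr01) near0.
have [r /= r0 Hr] := (nbhs_normP (0 : 'rV[R]_d) _).1 near0.
exists r, (k + 1); split=> // [|y yr]; first by rewrite addr_gt0.
have := Hr (y - p); rewrite /ball_ /= ?add0r ?normrN !fctE /= /shift/= subrK mul1r => /(_ yr) H.
rewrite -(subrK ('d h p (y - p)) (h y - h p)) (le_trans (ler_normD _ _)) //.
by rewrite mulrDl mul1r addrC lerD // (le_trans _ H) // opprD addrA.
Qed.

End QuadraticDecay.

Lemma open_nonzero (R : realType) (d : nat) (V : set 'rV[R]_d) (h : 'rV[R]_d -> R) :
  open V -> smooth V h -> open [set y | V y /\ h y != 0].
Proof.
move=> Vo sh; rewrite openE => y [Vy hy]; have hc : {for y, continuous h}.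
  by apply/differentiable_continuous/(smooth_diff sh).
have hy0 : 0 < `|h y| by rewrite normr_gt0.
have /cvgrPdist_lt/(_ _ hy0) Ch := hc.
have Vn : \forall z \near y, V z by apply: open_nbhs_nbhs.
have [r /= r0 H] := (nbhs_normP y _).1 (filterI Vn Ch).
apply/(nbhs_normP y); exists r => //= z yz; have [Vz hz] := H z yz.
by split=> //; apply: contraTneq hz => ->; rewrite subr0 ltxx.
Qed.

(** * Differentiability of quotients by powers of a defining function *)

Section LocalQuotient.
Variables (R : realType) (d : nat) (V : set 'rV[R]_d) (h : 'rV[R]_d -> R) (n : 'I_d).
Hypotheses (Vo : open V) (sh : smooth V h).
Hypothesis hn0 : forall x, V x -> partial n h x != 0.
Implicit Types (f rho : 'rV[R]_d -> R) (x u p : 'rV[R]_d).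

Notation flat := (flat V h).

(* For k > 0 the value is 0 on the zero set of h, where Rocq's division gives 0. *)
Definition hquot rho k x := rho x / h x ^+ k.
(** The numerator over [h x ^+ k.+1] of a partial derivative of [hquot rho k]. *)
Definition hquot_num a k rho x :=
  h x * partial a rho x + - k%:R * (partial a h x * rho x).

Lemma smooth_hquot_num a k rho : smooth V rho -> smooth V (hquot_num a k rho).
Proof.
move=> sr; apply: smoothD => //; first by apply: smoothM => //; exact: smooth_partial.
apply: smoothM => //; first exact: smooth_cst.
by apply: smoothM => //; exact: smooth_partial.
Qed.

(** Differentiation costs one order of flatness and multiplication by [h] restores it, so the order
    survives any number of steps while only the exponent in the denominator grows. *)
Lemma flat_hquot_num m a k rho : smooth V rho -> flat m rho ->
  flat m (hquot_num a k rho).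
Proof.
move=> sr fr; have sra := smooth_partial a sr; have sha := smooth_partial a sh.
apply: flatD => //.
- exact: smoothM.
- by apply: smoothM => //; [exact: smooth_cst|exact: smoothM].
- case: m fr => [|m] fr; first by [].
  apply: (flat_hM Vo sh sra); exact: (fr.2 a).
- apply: (flatM Vo); [exact: smooth_cst|exact: smoothM|].
  exact: (flatM Vo sha sr fr).
Qed.

(** On the zero set, flatness of order [k.+2] leaves a quotient of size [h ^+ 2], hence quadratic in
    the distance, so its differential is 0; this agrees with the default value of the right-hand
    side. Elsewhere it is the quotient rule. *)
Lemma diff_hquot k rho x : (0 < k)%N -> smooth V rho -> flat k.+2 rho -> V x ->
  differentiable (hquot rho k) x /\
  forall a, partial a (hquot rho k) x = hquot (hquot_num a k rho) k.+1 x.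
Proof.
move=> k0 sr fr Vx; have [hx|hx] := eqVneq (h x) 0.
  have [r1 [C [r10 C0 H1]]] := flat_bound Vo sh hn0 sr fr Vx hx.
  have [r2 [L [r20 L0 H2]]] := diff_lipschitz (smooth_diff sh Vx).
  have [] := @diff_quadratic R d (hquot rho k) x (Num.min r1 r2) (C * L ^+ 2).
  - by rewrite lt_min r10.
  - by rewrite mulr_ge0 // exprn_ge0 // ltW.
  - move=> y; rewrite lt_min => /andP[/H1[Vy b1] /H2]; rewrite hx subr0 => b2.
    apply: (@le_trans _ _ (C * `|h y| ^+ 2)); last first.
      by rewrite -mulrA -exprMn ler_wpM2l // lerXn2r // nnegrE // mulr_ge0 // ltW.
    have [hy|hy] := eqVneq (h y) 0.
      rewrite /hquot hy expr0n gtn_eqF // invr0 mulr0 !normr0.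
      by rewrite mulr_ge0 // exprn_ge0.
    rewrite /hquot normrM normfV normrX ler_pdivrMr ?exprn_gt0 ?normr_gt0 //.
    by rewrite -mulrA -exprD addnC addn2.
  move=> dq Dq; split=> // a; rewrite [LHS]Dq /hquot hx expr0n /=.
  by rewrite invr0 mulr0.
pose V0 := [set y | V y /\ h y != 0].
have V0o : open V0 by exact: open_nonzero.
have V0x : V0 x by [].
have sub f : smooth V f -> smooth V0 f by move=> sf y [Vy _]; exact: sf.
have dh := smooth_diff sh Vx; have dr := smooth_diff sr Vx.
have shk : smooth V (fun y => h y ^+ k) by exact: smooth_exp.
have dhk := smooth_diff shk Vx.
have hk0 y : V0 y -> h y ^+ k != 0 by move=> [_ ?]; rewrite expf_neq0.
have sinv := smoothV V0o (sub _ shk) hk0.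
have dinv := smooth_diff sinv V0x.
split; first exact: (smooth_diff (smoothM V0o (sub _ sr) sinv) V0x).
move=> a; rewrite [LHS](partialM a dr dinv) (partialV a (hk0 _ V0x) dhk).
have -> : partial a (fun y => h y ^+ k) x = k%:R * h x ^+ k.-1 * partial a h x.
  have := @deriveX _ _ h k x (delta_mx 0 a)
    (smooth_derivable (v := delta_mx 0 a) sh Vx).
  by rewrite exprfctE.
rewrite /hquot /hquot_num -[in RHS](prednK k0) !exprS -[in LHS](prednK k0) !exprS.
have P0 : h x ^+ k.-1 != 0 by rewrite expf_neq0.
by field; rewrite hx P0.
Qed.

Lemma iter_partial_hquot (s : seq 'I_d) t rho k m : (0 < k)%N ->
  smooth V t -> smooth V rho -> flat m rho -> (k + size s + 2 <= m)%N ->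
  exists rho', [/\ smooth V rho', flat m rho' & forall x, V x ->
    foldr (@partial R d) (fun y => t y + hquot rho k y) s x =
    foldr (@partial R d) t s x + hquot rho' (k + size s) x].
Proof.
move=> k0 st sr fr; elim: s => [|a s IH] /= sm.
  by exists rho; split=> // x _; rewrite addn0.
have sm' : (k + size s + 2 <= m)%N by apply: leq_trans sm; rewrite leq_add2r leq_add2l.
have [rho' [sr' fr' E]] := IH sm'.
exists (hquot_num a (k + size s) rho'); split.
- exact: smooth_hquot_num.
- exact: flat_hquot_num.
move=> x Vx; rewrite (eq_partial a Vo E Vx).
have ks : (0 < k + size s)%N by rewrite addn_gt0 k0.
have fr2 : flat (k + size s).+2 rho' by apply: flat_leq fr'; rewrite -addn2.
have [dq Dq] := diff_hquot ks sr' fr2 Vx.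
have st' := smooth_foldr_partial s st.
by rewrite (partialD a (smooth_diff st' Vx) dq) Dq addnS.
Qed.

(* For every order, f is a smooth multiple of h plus a remainder which is so flat
   that its quotient by h is differentiable to that order. *)
Lemma hadamard_local f : smooth V f -> (forall x, V x -> h x = 0 -> f x = 0) ->
  smooth V (fun x => if h x == 0 then partial n f x / partial n h x else f x / h x).
Proof.
move=> sf f0 x Vx s; set q := fun x => _.
have [rho [t [sr st E fr]]] := taylor Vo sh hn0 (size s).+3 sf f0.
have qE y : V y -> t y + hquot rho 1 y = q y.
  move=> Vy; rewrite /q /hquot expr1; have [hy|hy] := eqVneq (h y) 0.
    rewrite hy invr0 mulr0 addr0.
    have -> : partial n f y = t y * partial n h y.
      have [dr dt dh] := And3 (smooth_diff sr Vy) (smooth_diff st Vy) (smooth_diff sh Vy).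
      have dht : differentiable (fun x => h x * t x) y by exact: differentiableM.
      rewrite (eq_partial n Vo E Vy) (partialD n dr dht) (partialM n dh dt).
      by rewrite (fr.2 n).1 // hy mul0r !add0r.
    by rewrite mulfK // hn0.
  by rewrite E //; field.
have [|rho' [sr' fr' E']] := iter_partial_hquot (s := s) (ltn0Sn 0) st sr fr.
  by rewrite add1n addn2.
have st' := smooth_foldr_partial s st.
have fr2 : flat (1 + size s).+2 rho' by apply: flat_leq fr'.
have [dq _] := diff_hquot (isT : (0 < 1 + size s)%N) sr' fr2 Vx.
have dsum := differentiableD (smooth_diff st' Vx) dq.
have fE y : V y -> foldr (@partial R d) t s y + hquot rho' (1 + size s) y =
    foldr (@partial R d) q s y.
  move=> Vy; rewrite -E' //; elim: (s) y Vy => [|b l IHl] y Vy /=; first exact: qE.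
  exact: (eq_partial b Vo IHl Vy).
apply: near_differentiable dsum; exact: (near_open Vo Vx fE).
Qed.

End LocalQuotient.

(** * Hypersurfaces, densities and the recursion *)

Section HypersurfaceCalculus.
Variables (R : realType) (d : nat) (M : manifold R d) (U : set M).
Hypothesis Uo : open U.
Implicit Types (f h : M -> R) (p : M) (i : cidx M) (g : metric M).

Lemma smooth_on_diff f i p : smooth_on U f -> U p -> cdom i p ->
  differentiable (f \o cinv i) (chart i p).
Proof. by move=> sf Up ip; exact: (sf i p Up ip [::]). Qed.

Lemma differential_neq0P f p : differential f p != 0 ->
  exists n, pd (chart_at p) n f p != 0.
Proof.
move=> df; apply/existsP; apply: contraR df; rewrite negb_exists => /forallP all0.
by apply/eqP/rowP => a; rewrite !mxE; apply/eqP; have := all0 a; rewrite negbK.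
Qed.

Lemma differential_chart f i p : smooth_on U f -> U p -> cdom i p ->
  differential f p != 0 -> exists n, pd i n f p != 0.
Proof.
move=> sf Up ip /differential_neq0P[n]; rewrite (@pd_chain _ _ _ _ i) //; last first.
- exact: smooth_on_diff.
- exact: mem_chart_at.
move=> sum0; apply/existsP; apply: contraR sum0.
rewrite negb_exists => /forallP all0; rewrite big1 // => c _.
by have := all0 c; rewrite negbK => /eqP ->; rewrite mulr0.
Qed.

Lemma differential_eq0 f (W : set M) p : open W -> W p -> U p ->
  (forall q, W q -> U q -> f q = 0) -> differential f p = 0.
Proof.
move=> Wo Wp Up f0; apply/rowP => a; rewrite !mxE.
have ip := mem_chart_at p.
rewrite (@pd_near _ _ _ _ a (U `&` W) f (fun=> 0)) //; [|exact: openI|].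
  by have := @partial_cst R d 0 a (chart (chart_at p) p).
by move=> q [Uq Wq]; exact: f0.
Qed.

Lemma nonzero_nearby h (W : set M) p : open W -> W p -> U p ->
  differential h p != 0 -> exists2 q, (W `&` U) q & h q != 0.
Proof.
move=> Wo Wp Up dh; apply: contrapT => none; move/eqP: dh; apply.
apply: (@differential_eq0 h W) => // q Wq Uq; apply/eqP/negPn/negP => hq.
by apply: none; exists q.
Qed.

Lemma pos_open f : smooth_on U f -> open [set p | U p /\ 0 < f p].
Proof.
move=> sf; rewrite openE => p [Up fp].
have ip := mem_chart_at p.
have fc : {for p, continuous ((f \o cinv (chart_at p)) \o chart (chart_at p))}.
  apply: continuous_comp; first exact: chart_continuous.
  exact/differentiable_continuous/smooth_on_diff.
have E : ((f \o cinv (chart_at p)) \o chart (chart_at p)) p = f p by rewrite /= chartK.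
have Pn : \forall q \near p, 0 < ((f \o cinv (chart_at p)) \o chart (chart_at p)) q.
  apply: cvgr_gt; first exact: fc.
  by rewrite E.
have Un : \forall q \near p, U q by apply: open_nbhs_nbhs.
have Dn : \forall q \near p, cdom (chart_at p) q.
  by apply: open_nbhs_nbhs; split; [exact: cdom_open|].
apply: filterS (filterI Un (filterI Dn Pn)) => q [Uq [Dq]].
by rewrite /= chartK.
Qed.

Section DefiningFunction.
Variable h : M -> R.
Hypotheses (sh : smooth_on U h).
Hypothesis dh : forall p, U p -> h p = 0 -> differential h p != 0.

(** At a zero of [h], differentiating [h * q = 0] in a direction where [h] has nonzero derivative
    leaves [q] times that derivative. *)
Lemma cancel q : smooth_on U q -> (forall p, U p -> h p * q p = 0) ->
  forall p, U p -> q p = 0.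
Proof.
move=> sq hq0 p Up; have [hp|hp] := eqVneq (h p) 0; last first.
  by apply/eqP; have /eqP := hq0 p Up; rewrite mulf_eq0 (negbTE hp).
have [n dn] := differential_neq0P (dh Up hp); have ip := mem_chart_at p.
have := pdM n Uo Up ip sh sq; rewrite hp mul0r add0r.
rewrite (@pd_near _ _ _ _ n U _ (fun=> 0) p Uo Up ip hq0).
have -> : pd (chart_at p) n (fun=> 0) p = 0 :> R.
  exact: (@partial_cst R d 0 n (chart (chart_at p) p)).
by move/esym/eqP; rewrite mulf_eq0 (negbTE dn) orbF => /eqP.
Qed.

Lemma cancelX k q : smooth_on U q -> (forall p, U p -> h p ^+ k * q p = 0) ->
  forall p, U p -> q p = 0.
Proof.
move=> sq; elim: k => [|k IH] hq p Up; first by have := hq p Up; rewrite mul1r.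
apply: IH => //; apply: cancel.
  by apply: smooth_onM => //; exact: smooth_onX.
by move=> r Ur; rewrite mulrA -exprS hq.
Qed.

(** Local quotients need no gluing: on the zero set the value is prescribed as a ratio of partial
    derivatives, in a direction chosen separately for each point. By the multiplier rule the ratio
    depends neither on the direction nor on the chart, so near each zero the function agrees with a
    local quotient. *)
Lemma hadamard_on f : smooth_on U f -> (forall p, U p -> h p = 0 -> f p = 0) ->
  exists2 q, smooth_on U q & forall p, U p -> f p = h p * q p.
Proof.
move=> sf f0.
have ex p : exists n : option 'I_d, U p -> h p = 0 -> exists2 k, n = Some k &
    pd (chart_at p) k h p != 0.
  have [[Up hp]|UhN] := pselect (U p /\ h p = 0); last first.
    by exists None => Up hp; case: UhN.
  by have [k dk] := differential_neq0P (dh Up hp); exists (Some k) => _ _; exists k.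
have [nu nuP] := choice ex.
pose q p := if h p == 0 then
    (if nu p is Some k then pd (chart_at p) k f p / pd (chart_at p) k h p else 0)
  else f p / h p.
exists q; last first.
  move=> p Up; rewrite /q; have [hp|hp] := eqVneq (h p) 0.
    by rewrite hp mul0r f0.
  by rewrite mulrC divfK.
move=> i p Up ip.
have Vio := chart_dom_open (i := i) Uo.
have shi := (smooth_onP h Uo).1 sh i; have sfi := (smooth_onP f Uo).1 sf i.
have Vp : (chart i @` (U `&` cdom i)) (chart i p) by exists p.
have [hp|hp] := eqVneq (h p) 0; last first.
  have Wo := open_nonzero Vio shi.
  set W := [set x | _] in Wo.
  have Wp : W (chart i p) by split; rewrite //= chartK.
  have sub k : smooth (chart i @` (U `&` cdom i)) k -> smooth W k.
    by move=> sk x [Vx _]; exact: sk.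
  have sinv := smoothV Wo (sub _ shi) (fun x '(conj _ hx) => hx).
  apply: (eq_smooth Wo _ (smoothM Wo (sub _ sfi) sinv)) Wp => x [_ hx] /=.
  by rewrite /q (negbTE hx).
have [n dn] := differential_chart sh Up ip (dh Up hp).
have Wo := open_nonzero Vio (smooth_partial n shi).
set W := [set x | _] in Wo.
have Wp : W (chart i p) by split.
have sub k : smooth (chart i @` (U `&` cdom i)) k -> smooth W k.
  by move=> sk x [Vx _]; exact: sk.
have fi0 x : W x -> (h \o cinv i) x = 0 -> (f \o cinv i) x = 0.
  by move=> [[r [Ur ir] <-] _] /=; rewrite chartK //; exact: f0.
have hn0 x (Wx : W x) : partial n (h \o cinv i) x != 0 := proj2 Wx.
have sq := hadamard_local Wo (sub _ shi) hn0 (sub _ sfi) fi0.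
apply: (eq_smooth Wo _ sq) Wp => x Wx; have [[r [Ur ir] rx] _] := Wx.
have cx : cinv i x = r by rewrite -rx chartK.
rewrite /q /= cx; have [hr|//] := eqVneq (h r) 0.
have [k -> dk] := nuP r Ur hr.
have hx : (h \o cinv i) x = 0 by rewrite /= cx.
have L a : partial n (h \o cinv i) x * partial a (f \o cinv i) x =
    partial a (h \o cinv i) x * partial n (f \o cinv i) x.
  exact: (@lagrange_multiplier R d W (h \o cinv i) n Wo (sub _ shi) hn0 (f \o cinv i) x a
    (sub _ sfi) fi0 Wx hx).
have nx := hn0 x Wx.
have jr := mem_chart_at r.
have Ck (F : M -> R) : smooth_on U F -> pd (chart_at r) k F r =
    \sum_c jacobian (chart i \o cinv (chart_at r)) (chart (chart_at r) r) k c
      * partial c (F \o cinv i) x.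
  move=> sF; rewrite (@pd_chain _ _ _ _ i) //; last exact: smooth_on_diff.
  by apply: eq_bigr => c _; rewrite /pd rx.
have E : pd (chart_at r) k f r = partial n (f \o cinv i) x / partial n (h \o cinv i) x
    * pd (chart_at r) k h r.
  rewrite !Ck // mulr_sumr; apply: eq_bigr => c _.
  rewrite mulrCA; congr (_ * _); apply: (mulfI nx).
  by rewrite L mulrA mulrCA divff // mulr1 mulrC.
by rewrite E mulfK.
Qed.

End DefiningFunction.
End HypersurfaceCalculus.

(** * Solutions and their obstruction in a fixed scale *)

Section OneScale.
Variables (R : realType) (d : nat) (M : manifold R d) (g : metric M).
Implicit Types (U W : set M) (f h A B : M -> R) (p : M).

(** Locality of I^2, read off from its conformal invariance with factor 1. *)
Lemma eq_Isq U f h p : (1 < d)%N -> open U -> smooth_on U f ->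
  (forall q, U q -> h q = f q) -> U p -> Isq_fun g h p = Isq_fun g f p.
Proof.
move=> d1 Uo sf hf Up; apply: (@Isq_conformal _ _ _ U g g (fun=> 1)) => //.
  split=> [|_|i q _]; [|by []|by rewrite expr1n scale1r].
  by apply: smooth_on_cst; exact: openT.
by move=> q Uq; rewrite hf // mul1r.
Qed.

Lemma Isq_zero f p : f p = 0 -> Isq_fun g f p = gradsq g f p.
Proof. by move=> fp; rewrite /Isq_fun fp mul0r mulr0 subr0. Qed.

(** On the zero set, I^2 reduces to the squared gradient and the differential of [f] is [v] times
    that of [h], so [v ^+ 2 = 1]. The value -1 is excluded at a nearby point with [h] nonzero, where
    [v] is the positive ratio. *)
Lemma ratio_of_solutions U f h v : open U -> smooth_on U f -> smooth_on U h ->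
  smooth_on U v -> (forall p, U p -> h p = 0 -> differential h p != 0) ->
  (forall p, U p -> f p = h p * v p) ->
  (forall p, U p -> h p != 0 -> 0 < f p / h p) ->
  (forall p, U p -> h p = 0 -> Isq_fun g f p = 1 /\ Isq_fun g h p = 1) ->
  forall p, U p -> h p = 0 -> v p = 1.
Proof.
move=> Uo sf sh sv dh fE pos I1 p Up hp.
have [If Ih] := I1 p Up hp.
have fp : f p = 0 by rewrite fE // hp mul0r.
rewrite Isq_zero // in If; rewrite Isq_zero // in Ih.
have pdf a : pd (chart_at p) a f p = v p * pd (chart_at p) a h p.
  have ip := mem_chart_at p.
  rewrite (@pd_near _ _ _ _ a U f (fun q => h q * v q)) // (pdM a Uo Up ip sh sv).
  by rewrite hp mul0r add0r.
have E : gradsq g f p = v p ^+ 2 * gradsq g h p.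
  rewrite /gradsq /chart_gradsq mulr_sumr; apply: eq_bigr => a _.
  by rewrite mulr_sumr; apply: eq_bigr => b _; rewrite !pdf; ring.
rewrite If Ih mulr1 in E.
have /eqP := esym E; rewrite sqrf_eq1 => /orP[/eqP//|/eqP vN].
have vpos : 0 < - v p by rewrite vN opprK.
have [q [[Uq vq] _] hq] := nonzero_nearby Uo (pos_open Uo (smooth_onN Uo sv))
  (conj Up vpos) Up (dh p Up hp).
have := pos q Uq hq; rewrite fE // mulrC mulKf // => v0.
by move: vq; rewrite oppr_gt0 => /(lt_trans v0); rewrite ltxx.
Qed.

Lemma indicial_neq0 n : (0 < d)%N -> n.+1 != d -> indicial R d n != 0.
Proof.
move=> d0 nd; rewrite /indicial !mulf_neq0 ?invr_neq0 ?pnatr_eq0 //.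
  by rewrite subr_eq0 eqr_nat eq_sym.
by rewrite -lt0n.
Qed.

Lemma obstruction_unique U f h A B : (1 < d)%N -> open U ->
  smooth_on U f -> smooth_on U h -> smooth_on U A -> smooth_on U B ->
  (forall p, U p -> h p = 0 -> differential h p != 0) ->
  (forall p, U p -> h p = 0 -> f p = 0) ->
  (forall p, U p -> h p != 0 -> 0 < f p / h p) ->
  (forall p, U p -> Isq_fun g f p = 1 + f p ^+ d * A p) ->
  (forall p, U p -> Isq_fun g h p = 1 + h p ^+ d * B p) ->
  exists2 v, smooth_on U v & (forall p, U p -> f p = h p * v p) /\
    forall p, U p -> h p = 0 -> v p = 1 /\ A p = B p.
Proof.
move=> d1 Uo sf sh sA sB dh f0 pos If Ih; have d0 : (0 < d)%N by exact: ltnW.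
have [v sv fE] := hadamard_on Uo sh dh sf f0.
have zd (x y : R) : x = 0 -> 1 + x ^+ d * y = 1.
  by move=> ->; rewrite expr0n gtn_eqF // mul0r addr0.
have v1 p : U p -> h p = 0 -> v p = 1.
  move=> Up hp; apply: (@ratio_of_solutions U f h v) => // q Uq hq.
  by rewrite If // Ih // !zd // f0.
exists v => //; split=> // p Up hp; split; first exact: v1.
have [a0 sa0 E0] : exists2 a0, smooth_on U a0 & forall p, U p -> v p - 1 = h p * a0 p.
  apply: hadamard_on => //; last by move=> q Uq hq; rewrite v1 // subrr.
  by apply: smooth_onB => //; exact: smooth_on_cst.
pose N p := h p ^+ d.-1 * B p.
have sN : smooth_on U N by apply: smooth_onM => //; exact: smooth_onX.
have IN q : U q -> Isq_fun g h q = 1 + h q * N q.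
  by move=> Uq; rewrite Ih // /N mulrA -exprS prednK.
(* The equation of [f] is compared with the perturbation formula at [h]; as [f = h v], the two
   remainders differ by a multiple of [h ^+ d]. *)
have pert n (a : M -> R) : smooth_on U a -> (forall p, U p -> f p = h p + h p ^+ n.+2 * a p) ->
   exists2 X, smooth_on U X & forall p, U p ->
    h p ^+ d * (v p ^+ d * A p - B p) =
    h p ^+ n.+1 * (indicial R d n * a p + h p * X p).
  move=> sa fa; have [X sX EX] := Isq_perturb1 n d0 Uo sh sa sN IN.
  exists X => // q Uq; have := EX q Uq.
  have sw : smooth_on U (fun q => h q + h q ^+ n.+2 * a q).
    by apply: smooth_onD => //; apply: smooth_onM => //; exact: smooth_onX.
  rewrite -(@eq_Isq U _ f) // If // Ih // => E.
  apply: (@addrI _ (1 + h q ^+ d * B q)); rewrite -E fE // exprMn; ring.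
have expansion n : (n < d)%N -> exists2 a, smooth_on U a &
    forall p, U p -> f p = h p + h p ^+ n.+2 * a p.
  elim: n => [_|n IH nd].
    exists a0 => // q Uq; rewrite fE // -[v q](subrK 1) E0 //; ring.
  have [a sa fa] := IH (ltnW nd).
  have [X sX EX] := pert n a sa fa.
  have a_zero q : U q -> h q = 0 -> a q = 0.
    move=> Uq hq.
    (* As [n.+1 < d], the factor [h ^+ n.+1] can be cancelled, and on the zero set only
       [indicial R d n * a r] remains. *)
    pose F r := indicial R d n * a r + h r * X r -
        h r ^+ (d - n.+1) * (v r ^+ d * A r - B r).
    have sF : smooth_on U F.
      apply: smooth_onB => //.
        by apply: smooth_onD => //; apply: smooth_onM => //; exact: smooth_on_cst.
      apply: smooth_onM => //; first exact: smooth_onX.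
      by apply: smooth_onB => //; apply: smooth_onM => //; exact: smooth_onX.
    have F0 r : U r -> h r ^+ n.+1 * F r = 0.
      by move=> Ur; rewrite /F mulrBr -EX // mulrA -exprD subnKC ?subrr // ltnW.
    have Z := cancelX Uo sh dh sF F0 Uq.
    move: Z; rewrite /F hq mul0r addr0 expr0n subn_eq0 leqNgt nd /= mul0r subr0 => /eqP.
    by rewrite mulf_eq0 (negbTE (indicial_neq0 d0 _)) ?(ltn_eqF nd) // => /eqP.
  have [b sb ab] := hadamard_on Uo sh dh sa a_zero.
  exists b => // q Uq; rewrite fa // ab //; congr (_ + _).
  by rewrite mulrA -exprSr.
have dd : (d.-1 < d)%N by rewrite prednK.
have [a sa fa] := expansion d.-1 dd.
have [X sX EX] := pert d.-1 a sa fa.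
(* At the last order the coefficient vanishes: the equation no longer restricts [a] on the zero set
   and becomes a relation between [A] and [B]. *)
have ind0 : indicial R d d.-1 = 0 by rewrite /indicial prednK // subrr mulr0 mul0r.
pose F q := v q ^+ d * A q - B q - h q * X q.
have sF : smooth_on U F.
  apply: smooth_onB => //; last by apply: smooth_onM.
  by apply: smooth_onB => //; apply: smooth_onM => //; exact: smooth_onX.
have F0 q : U q -> h q ^+ d * F q = 0.
  by move=> Uq; rewrite /F mulrBr EX // prednK // ind0 mul0r add0r subrr.
have Z := cancelX Uo sh dh sF F0 Up.
move: Z; rewrite /F hp mul0r subr0 v1 // expr1n mul1r => /eqP.
by rewrite subr_eq0 => /eqP.
Qed.

(** The factor [u] adds [t ^+ n.+2 * a] to [t], where [a] is [- A] divided by the indicial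
    coefficient, the choice that cancels the leading term [t ^+ n.+1 * A]. *)
Lemma improve_solution U t A n (u := fun p => 1 - (indicial R d n)^-1 * (Isq_fun g t p - 1)) :
  (1 < d)%N -> n.+1 != d -> open U -> smooth_on U t -> smooth_on U A ->
  (forall p, U p -> Isq_fun g t p = 1 + t p ^+ n.+1 * A p) ->
  (forall p, U p -> u p != 0) ->
  exists2 B, smooth_on U B & forall p, U p ->
    Isq_fun g (fun q => t q * u q) p = 1 + (t p * u p) ^+ n.+2 * B p.
Proof.
move=> d1 nd Uo st sA It u0; have d0 : (0 < d)%N by exact: ltnW.
pose c := (indicial R d n)^-1; pose a p := - c * A p.
have sa : smooth_on U a by apply: smooth_onM => //; exact: smooth_on_cst.
pose N p := t p ^+ n * A p.
have sN : smooth_on U N by apply: smooth_onM => //; exact: smooth_onX.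
have IN q : U q -> Isq_fun g t q = 1 + t q * N q.
  by move=> Uq; rewrite It // /N mulrA -exprS.
have [X sX EX] := Isq_perturb1 n d0 Uo st sa sN IN.
have su : smooth_on U u.
  apply: smooth_onB => //; first exact: smooth_on_cst.
  apply: smooth_onM => //; first exact: smooth_on_cst.
  by apply: smooth_onB => //; [exact: smooth_on_Isq|exact: smooth_on_cst].
(* Division by [u ^+ n.+2] turns the power of [t] into a power of the new function [t * u]. *)
exists (fun p => X p * ((u p) ^+ n.+2)^-1).
  apply: smooth_onM => //; apply: smooth_onV => //; first exact: smooth_onX.
  by move=> p Up; rewrite expf_neq0 // u0.
move=> p Up.
rewrite (@eq_Isq U (fun q => t q + t q ^+ n.+2 * a q)) //; first last.
- by move=> q Uq; rewrite /u It // /a -/c [t q ^+ n.+2]exprS; ring.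
- by apply: smooth_onD => //; apply: smooth_onM => //; exact: smooth_onX.
rewrite EX // It // exprMn.
have un : u p ^+ n.+2 != 0 by rewrite expf_neq0 // u0.
have i0 := indicial_neq0 d0 nd.
rewrite -[t p ^+ n.+2 * _ * _]mulrA [u p ^+ _ * _]mulrCA divff // mulr1 /a /c.
by rewrite mulNr mulrN mulrA divff // mul1r !exprSr; ring.
Qed.

End OneScale.

(** * From one scale to densities *)

Section Densities.
Variables (R : realType) (d : nat) (M : manifold R d) (c : conformal_class M).
Hypothesis d1 : (1 < d)%N.
Implicit Types (U S : set M) (s t A B N : scaled M) (p : M) (g : metric M).

Lemma conformal_pair g g' : c g -> c g' -> exists Om, conformal_to g g' Om.
Proof. by move=> cg; apply: (cmemP cg g').1. Qed.

Lemma Isq_invariant U t g g' p : open U -> density c U 1 t -> c g -> c g' -> U p ->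
  Isq t g' p = Isq t g p.
Proof.
move=> Uo [st wt] cg cg' Up; have [Om gg'] := conformal_pair cg cg'.
apply: (@Isq_conformal _ _ _ U g g' Om) => //; first exact: st.
by move=> q Uq; rewrite (wt g g' Om) // expr1z.
Qed.

(* Along the zero set of t the weight is obtained by cancelling t^l. *)
Lemma weight_of_quotient U t N A (l : nat) : open U -> density c U 1 t ->
  (forall g p, c g -> U p -> t g p = 0 -> differential (t g) p != 0) ->
  (forall g g' p, c g -> c g' -> U p -> N g' p = N g p) ->
  (forall g, c g -> smooth_on U (A g)) ->
  (forall g p, c g -> U p -> N g p = t g p ^+ l * A g p) ->
  density c U (- l%:Z) A.
Proof.
move=> Uo [st wt] dt NN sA NE; split=> // g g' Om cg cg' gg' p Up.
have [sOm Om0 _] := gg'.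
have sOmU : smooth_on U Om by apply: smooth_on_sub sOm.
pose F q := Om q ^+ l * A g' q - A g q.
have sF : smooth_on U F.
  apply: smooth_onB => //; last exact: sA.
  by apply: smooth_onM => //; [exact: smooth_onX|exact: sA].
have F0 q : U q -> t g q ^+ l * F q = 0.
  move=> Uq; have := wt g g' Om cg cg' gg' q Uq; rewrite expr1z => tE.
  by rewrite /F mulrBr mulrCA mulrA -exprMn -tE -!NE // (NN g g') // subrr.
have := cancelX Uo (st g cg) (fun q Uq => dt g q cg Uq) sF F0 Up.
have Oml : Om p ^+ l != 0 by rewrite expf_neq0 // gt_eqF.
move=> /eqP; rewrite /F subr_eq0 => /eqP <-.
by rewrite -exprnN mulKf.
Qed.

Lemma defining_differential S U t : defining_density c S U t ->
  forall g p, c g -> U p -> t g p = 0 -> differential (t g) p != 0.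
Proof. by move=> [_ tS dt] g p cg Up tp; exact: dt cg Up ((tS g p cg Up).1 tp). Qed.

(** The remainders may be chosen separately in each scale: cancelling [t ^+ l] makes them unique on
    [U], which forces their weight. *)
Lemma asc_eq_exists S U t (l : nat) : open U -> defining_density c S U t ->
  (forall g, c g -> exists2 A, smooth_on U A &
     forall p, U p -> Isq t g p = 1 + t g p ^+ l * A p) ->
  exists A, asc_eq c U l t A.
Proof.
move=> Uo Dt ex; have [dt _ _] := Dt.
have ex' g : exists A : M -> R, c g -> smooth_on U A /\
    forall p, U p -> Isq t g p = 1 + t g p ^+ l * A p.
  have [cg|ncg] := pselect (c g); last by exists (fun=> 0).
  by have [A sA EA] := ex g cg; exists A.
have [A AP] := choice ex'; exists A; split; last by move=> g p cg; apply: (AP g cg).2.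
apply: (weight_of_quotient (N := fun g p => Isq t g p - 1) Uo dt).
- exact: defining_differential Dt.
- by move=> g g' p cg cg' Up; rewrite (Isq_invariant Uo dt cg cg' Up).
- by move=> g cg; apply: (AP g cg).1.
- by move=> g p cg Up; rewrite (AP g cg).2 // addrC addKr.
Qed.

Lemma improve_density S U s t t' n : n.+1 != d -> solves_on c S U s t n.+1 ->
  (forall g p, c g -> t' g p =
     t g p * (1 - (indicial R d n)^-1 * (Isq t g p - 1))) ->
  exists U', solves_on c S U' s t' n.+2.
Proof.
move=> nd [[Uo SU] Dt Ct [A [dA EA]]] t'E; have [dt tS Dtn] := Dt.
pose u g p := 1 - (indicial R d n)^-1 * (Isq t g p - 1).
have su g : c g -> smooth_on U (u g).
  move=> cg; apply: smooth_onB => //; first exact: smooth_on_cst.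
  apply: smooth_onM => //; first exact: smooth_on_cst.
  apply: smooth_onB => //; last exact: smooth_on_cst.
  by apply: smooth_on_Isq => //; exact: dt.1.
have uS g p : c g -> S p -> u g p = 1.
  move=> cg Sp; have Up := SU p Sp.
  have tp : t g p = 0 := (tS g p cg Up).2 Sp.
  by rewrite /u EA // tp exprS mul0r mul0r addr0 subrr mulr0 subr0.
have [g0 cg0] := cmem_nonempty c.
(* One scale [g0] suffices, since [u] has weight 0 by the invariance of I^2. Positivity of [u] holds
   on [S], where [u] is 1, and preserves both the zero set and the orientation. *)
pose U' := [set p | U p /\ 0 < u g0 p].
have U'o : open U' by exact: (pos_open Uo (su g0 cg0)).
have U'U : U' `<=` U by move=> p [].
have uE g p : c g -> U p -> u g p = u g0 p.
  by move=> cg Up; rewrite /u (Isq_invariant Uo dt cg0 cg Up).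
have upos g p : c g -> U' p -> 0 < u g p by move=> cg [Up up]; rewrite uE.
have SU' : S `<=` U' by move=> p Sp; split; [exact: SU|rewrite uS].
have t'fun g : c g -> t' g = (fun p => t g p * u g p).
  by move=> cg; apply/funext => p; rewrite t'E.
have st g : c g -> smooth_on U (t g) by move=> cg; exact: dt.1.
have Dt' : defining_density c S U' t'.
  split.
  - split=> [g cg|g g' Om cg cg' gg' p U'p].
      rewrite t'fun //; apply: smooth_on_sub (smooth_onM Uo (st g cg) (su g cg)).
      exact: U'U.
    have Up := U'U p U'p.
    rewrite !t'fun // (dt.2 g g' Om) // -mulrA; congr (_ * (_ * _)).
    by rewrite !uE.
  - move=> g p cg U'p; have Up := U'U p U'p; rewrite t'fun //.
    split=> [/eqP|Sp].
      by rewrite mulf_eq0 (gt_eqF (upos g p cg U'p)) orbF => /eqP tp; exact: (tS g p cg Up).1 tp.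
    by rewrite ((tS g p cg Up).2 Sp) mul0r.
  - move=> g p cg U'p Sp; have Up := U'U p U'p.
    have tp : t g p = 0 := (tS g p cg Up).2 Sp.
    have -> : differential (t' g) p = differential (t g) p; last exact: Dtn.
    apply/rowP => a; rewrite !mxE t'fun //.
    rewrite (pdM a Uo Up (mem_chart_at p) (st g cg) (su g cg)).
    by rewrite tp mul0r add0r uS // mul1r.
exists U'; split=> //.
- move=> g p cg U'p Sp; rewrite t'fun // mulrAC mulr_gt0 //; last exact: upos.
  by apply: Ct => //; exact: U'U.
- apply: (asc_eq_exists U'o Dt') => g cg.
  have [B sB EB] := improve_solution (g := g) (U := U') (t := t g) (A := A g) d1 nd U'o
    (smooth_on_sub U'U (st g cg)) (smooth_on_sub U'U (dA.1 g cg))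
    (fun p U'p => EA g p cg (U'U p U'p)) (fun p U'p => lt0r_neq0 (upos g p cg U'p)).
  exists B => // p U'p; rewrite t'fun //; have := EB p U'p.
  by rewrite -[Isq t' g p]/(Isq_fun g (t' g) p) t'fun.
Qed.

Lemma solutions_agree S U1 U2 s t1 t2 A1 A2 :
  open_nbhd S U1 -> open_nbhd S U2 ->
  defining_density c S U1 t1 -> defining_density c S U2 t2 ->
  co_oriented c S U1 s t1 -> co_oriented c S U2 s t2 ->
  asc_eq c U1 d t1 A1 -> asc_eq c U2 d t2 A2 ->
  forall g p, c g -> S p -> A1 g p = A2 g p.
Proof.
move=> [U1o SU1] [U2o SU2] [dt1 tS1 Dt1] [dt2 tS2 Dt2] C1 C2 [dA1 E1] [dA2 E2] g p cg Sp.
have Uo : open (U1 `&` U2) by exact: openI.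
have sub1 : U1 `&` U2 `<=` U1 by move=> q [].
have sub2 : U1 `&` U2 `<=` U2 by move=> q [].
have pos q : (U1 `&` U2) q -> t2 g q != 0 -> 0 < t1 g q / t2 g q.
  move=> [Uq1 Uq2] tq; have nS : ~ S q by move=> /(tS2 g q cg Uq2).2/eqP; rewrite (negbTE tq).
  have := mulr_gt0 (C1 g q cg Uq1 nS) (_ : 0 < (t2 g q / s g q)^-1).
  rewrite invr_gt0 => /(_ (C2 g q cg Uq2 nS)); rewrite invf_div mulrA.
  (* A zero of [s] would make the positive ratio [t2 g q / s g q] equal to 0, as the inverse of 0 is
     0. *)
  have s0 : s g q != 0.
    by apply/eqP => sq; have := C2 g q cg Uq2 nS; rewrite sq invr0 mulr0 ltxx.
  by rewrite divfK.
have [v _ [_ vS]] := obstruction_unique (g := g) (U := U1 `&` U2) (f := t1 g) (h := t2 g)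
  (A := A1 g) (B := A2 g) d1 Uo (smooth_on_sub sub1 (dt1.1 g cg))
  (smooth_on_sub sub2 (dt2.1 g cg)) (smooth_on_sub sub1 (dA1.1 g cg))
  (smooth_on_sub sub2 (dA2.1 g cg))
  (fun q '(conj _ Uq) tq => Dt2 g q cg Uq ((tS2 g q cg Uq).1 tq))
  (fun q '(conj Uq1 Uq2) tq => (tS1 g q cg Uq1).2 ((tS2 g q cg Uq2).1 tq)) pos
  (fun q '(conj Uq _) => E1 g q cg Uq) (fun q '(conj _ Uq) => E2 g q cg Uq).
have Up : (U1 `&` U2) p by split; [exact: SU1|exact: SU2].
exact: (vS p Up ((tS2 g p cg (SU2 p Sp)).2 Sp)).2.
Qed.

End Densities.

(** * The recursion and the orders beyond the obstruction *)

Section Recursion.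
Variables (R : realType) (d : nat) (M : manifold R d) (c : conformal_class M).
Variables (S : set M) (s : scaled M) (sb : nat -> scaled M).
Hypotheses (d1 : (1 < d)%N) (Ds : defining_density c S setT s).
Hypotheses (Ns : normal_density c s) (Rs : asc_recursion c s sb).

(** I^2 differs from the squared gradient by a multiple of [s], so a normal density is a solution of
    order 1. The factor in [normal_density] depends on the scale, but the total remainder acquires
    its weight by [asc_eq_exists]. *)
Lemma normal_solves : solves_on c S setT s s 1.
Proof.
have [ds sS _] := Ds; split=> //.
- by split=> //; exact: openT.
- move=> g p cg _ nS; have sp : s g p != 0.
    by apply/eqP => sp; apply: nS; exact: (sS g p cg I).1 sp.
  by rewrite divff.
apply: (asc_eq_exists d1 openT Ds) => g cg; have [A sA EA] := Ns cg.
exists (fun p => A p - 2 / d%:R * (laplacian g (s g) p + Jscal g p * s g p)).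
  have sT := @openT M; have sg := ds.1 g cg.
  apply: smooth_onB => //; apply: smooth_onM => //; first exact: smooth_on_cst.
  apply: smooth_onD => //; first exact: smooth_on_laplacian.
  by apply: smooth_onM => //; exact: smooth_on_Jscal.
by move=> p _; rewrite /Isq EA expr1; ring.
Qed.

(** The constant of the recursion is the inverse of [indicial R d k], which explains the factors
    [d - k - 1] and [k + 2]. The subtraction of natural numbers is exact since [k.+1 < d]. *)
Lemma recursion_step k g p : (k.+1 < d)%N -> c g -> sb k.+1 g p =
  sb k g p * (1 - (indicial R d k)^-1 * (Isq (sb k) g p - 1)).
Proof.
move=> kd cg; rewrite !Rs // ?(ltnW kd) // big_ord_recr /= mulrA; congr (_ * (1 - _)).
rewrite mulrCA mulrC; congr (_ * _).
rewrite -subnDA addn1 addn2 natrB ?(ltnW kd) // /indicial.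
have d0 : d%:R != 0 :> R by rewrite pnatr_eq0; case: (d) d1.
have k0 : k.+2%:R != 0 :> R by rewrite pnatr_eq0.
have dk0 : d%:R - k.+1%:R != 0 :> R by rewrite subr_eq0 eqr_nat gtn_eqF.
move: (k.+2%:R) (k.+1%:R) k0 dk0 => x y x0 y0.
by field; rewrite d0 x0 y0.
Qed.

Lemma recursion_solves k : (k < d)%N -> exists U, solves_on c S U s (sb k) k.+1.
Proof.
elim: k => [_|k IH kd].
  have sE g : c g -> sb 0 g = s g.
    by move=> cg; apply/funext => p; rewrite Rs ?(ltnW d1) // big_ord0 mulr1.
  exists setT; have [Uo [ds sS dS] Cs [A [dA EA]]] := normal_solves.
  split=> //; first split; first split.
  - by move=> g cg; rewrite sE //; exact: ds.1.
  - by move=> g g' Om cg cg'; rewrite !sE //; exact: ds.2.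
  - by move=> g p cg; rewrite sE //; exact: sS.
  - by move=> g p cg; rewrite sE //; exact: dS.
  - by move=> g p cg; rewrite sE //; exact: Cs.
  - exists A; split=> // g p cg Up.
    by rewrite /Isq sE //; exact: EA.
have [U HU] := IH (ltnW kd).
apply: (improve_density d1 _ HU); first by rewrite ltn_eqF.
by move=> g p cg; exact: recursion_step.
Qed.

(** The solution is [t = s v] with [v = 1] on [S], so replacing [t ^+ d] by [s ^+ d] in the
    denominator multiplies the quotient by [v ^+ d], without effect on [S]. *)
Lemma quotient_of_solution U t A B :
  solves_on c S U s t d -> asc_eq c U d t A -> (forall g p, c g -> S p -> B g p = A g p) ->
  quotient_on c S (fun g p => Isq t g p - 1) s d B.
Proof.
move=> [[Uo SU] [dt tS Dt] Ct _] [dA EA] BA.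
have [ds sS dS] := Ds; have dsU : density c U 1 s.
  split=> [g cg|g g' Om cg cg' gg' p _]; last exact: ds.2.
  by apply: smooth_on_sub (ds.1 g cg).
have sn g p : c g -> U p -> s g p = 0 -> differential (s g) p != 0.
  by move=> cg Up sp; apply: dS => //; exact: (sS g p cg I).1 sp.
have ex g : exists v : M -> R, c g -> [/\ smooth_on U v,
    forall p, U p -> t g p = s g p * v p & forall p, S p -> v p = 1].
  have [cg|ncg] := pselect (c g); last by exists (fun=> 0).
  have ts p : U p -> s g p = 0 -> t g p = 0.
    by move=> Up sp; apply: (tS g p cg Up).2; exact: (sS g p cg I).1 sp.
  have sg := dsU.1 g cg; have tg := dt.1 g cg.
  have [v sv vE] := hadamard_on Uo sg (fun p Up => sn g p cg Up) tg ts.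
  exists v => _; split=> // p Sp.
  have [_ _ _ [A0 [_ E0]]] := normal_solves.
  apply: (@ratio_of_solutions _ _ _ g U (t g) (s g) v) => //.
  - by move=> q Uq; exact: sn.
  - move=> q Uq sq; apply: Ct => // Sq.
    by move: sq; rewrite ((sS g q cg I).2 Sq) eqxx.
  - move=> q Uq sq; split.
      by rewrite -[LHS]/(Isq t g q) EA // ts // expr0n gtn_eqF ?(ltnW d1) // mul0r addr0.
    by rewrite -[LHS]/(Isq s g q) E0 // sq expr1 mul0r addr0.
  - exact: SU.
  - exact: (sS g p cg I).2 Sp.
have [v vP] := choice ex.
exists U, (fun g p => v g p ^+ d * A g p).
have QE g p : c g -> U p -> Isq t g p - 1 = s g p ^+ d * (v g p ^+ d * A g p).
  move=> cg Up; have [_ vE _] := vP g cg.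
  by rewrite EA // addrC addKr vE // exprMn mulrA.
split=> //.
- apply: (weight_of_quotient (N := fun g p => Isq t g p - 1) Uo dsU) => //.
  + by move=> g g' p cg cg' Up; rewrite (Isq_invariant d1 Uo dt cg cg' Up).
  + move=> g cg; have [sv _ _] := vP g cg.
    by apply: smooth_onM => //; [exact: smooth_onX|exact: dA.1].
- move=> g p cg Up nS; rewrite QE // [RHS]mulrC mulKf // expf_neq0 //.
  by apply/eqP => sp; apply: nS; exact: (sS g p cg I).1 sp.
- move=> g p cg Sp; have [_ _ v1] := vP g cg.
  by rewrite BA // v1 // expr1n mul1r.
Qed.

Lemma solvable_vanishing l B : asc_obstruction c S s B -> (d < l)%N ->
  solvable c S s l -> forall g p, c g -> S p -> B g p = 0.
Proof.
move=> [U [t [Bt [NU Dt Ct Et BE]]]] dl [U' [t' [NU' Dt' Ct' [A [dA EA]]]]] g p cg Sp.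
have [dt' tS' _] := Dt'; have [U'o SU'] := NU'.
(* A solution of order [l] also has order [d], with a remainder that vanishes on [S]; by
   [solutions_agree] this remainder gives the obstruction. *)
pose A' := (fun g p => t' g p ^+ (l - d) * A g p) : scaled M.
have EA' g0 q : c g0 -> U' q -> Isq t' g0 q = 1 + t' g0 q ^+ d * A' g0 q.
  by move=> cg0 Uq; rewrite EA // /A' mulrA -exprD subnKC // ltnW.
have E' : asc_eq c U' d t' A'.
  split=> //; apply: (weight_of_quotient (N := fun g p => Isq t' g p - 1) U'o dt').
  - exact: defining_differential Dt'.
  - by move=> g1 g2 q c1 c2 Uq; rewrite (Isq_invariant d1 U'o dt' c1 c2 Uq).
  - move=> g1 c1; apply: smooth_onM => //; last exact: dA.1.
    by apply: smooth_onX => //; exact: dt'.1.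
  - by move=> g1 q c1 Uq; rewrite EA' // addrC addKr.
rewrite BE // (solutions_agree d1 NU NU' Dt Dt' Ct Ct' Et E') // /A'.
by rewrite ((tS' g p cg (SU' p Sp)).2 Sp) expr0n subn_eq0 leqNgt dl mul0r.
Qed.

Lemma vanishing_solvable l B : asc_obstruction c S s B -> (d < l)%N ->
  (forall g p, c g -> S p -> B g p = 0) -> solvable c S s l.
Proof.
move=> [U [t [Bt [NU Dt Ct [dB EB] BE]]]] dl B0.
have [dt tS _] := Dt; have [Uo SU] := NU.
have base : solves_on c S U s t d.+1.
  split=> //; apply: (asc_eq_exists d1 Uo Dt) => g cg.
  have [q sq qE] := hadamard_on Uo (dt.1 g cg)
    (fun p Up => defining_differential Dt cg Up) (dB.1 g cg)
    (fun p Up tp => etrans (esym (BE g p cg ((tS g p cg Up).1 tp)))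
                      (B0 g p cg ((tS g p cg Up).1 tp))).
  by exists q => // p Up; rewrite EB // qE // mulrA -exprSr.
have {dl} [j ->] : exists j, l = (d + j).+1.
  by exists (l - d.+1)%N; rewrite -addSn subnKC.
elim: j => [|j [U' [t' H]]]; first by exists U, t; rewrite addn0.
(* [indicial R d (d + j)] is alpha_k at [k = d + j + 1], hence nonzero beyond the obstructed
   order. *)
pose t'' := (fun g p => t' g p * (1 - (indicial R d (d + j))^-1 * (Isq t' g p - 1))) : scaled M.
have [|//|U'' H''] := @improve_density _ _ _ c d1 S U' s t' t'' (d + j) _ H.
  by rewrite gtn_eqF // ltnS leq_addr.
by exists U'', t''; rewrite addnS.
Qed.

End Recursion.

Theorem proposition4p9 (R : realType) (d : nat) (M : manifold R d)
    (c : conformal_class M) (S : set M) (s : scaled M) (sb : nat -> scaled M) :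
  (3 <= d)%N ->
  hypersurface S ->
  defining_density c S setT s ->
  normal_density c s ->
  asc_recursion c s sb ->
  [/\ (forall k : nat, (k < d)%N ->
         exists U : set M, solves_on c S U s (sb k) k.+1),
      (exists B : scaled M, asc_obstruction c S s B) &
      (forall B : scaled M, asc_obstruction c S s B ->
         quotient_on c S (fun g p => Isq (sb d.-1) g p - 1) s d B /\
         (forall l : nat, (d < l)%N ->
            (solvable c S s l <-> (forall g p, c g -> S p -> B g p = 0))))].
Proof.
move=> d3 _ Ds Ns Rs; have d1 : (1 < d)%N by exact: ltnW.
have d0 : (0 < d)%N by exact: ltnW.
have sol := recursion_solves d1 Ds Ns Rs.
have [U] : exists U, solves_on c S U s (sb d.-1) d.
  by have := sol d.-1; rewrite prednK //; apply.
move=> HU; have [NU DU CU [A EA]] := HU.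
split=> //; first by exists A, U, (sb d.-1), A.
move=> B OB; split.
  apply: (quotient_of_solution d1 Ds Ns HU EA) => g p cg Sp.
  have [U' [t' [A' [NU' Dt' Ct' Et' BE]]]] := OB.
  by rewrite BE // (solutions_agree d1 NU' NU Dt' DU Ct' CU Et' EA).
move=> l dl; split; first exact: (solvable_vanishing d1 OB dl).
exact: (vanishing_solvable d1 OB dl).
Qed.
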